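(* Let $T>0$, $M>0$, and let $H$ be a counting process with intensity $\lambda$ bounded by $M$, i.e. $\lambda$ is a non-negative $\mathbb F^N$-predictable process with $\lambda_t\le M$ for all $t\ge0$, $\mathbb P$-a.s., and $$H_t=\int_{(0,t]\times\mathbb R_+}\mathbf 1_{\{\theta\le\lambda_s\}}N(ds,d\theta)=\int_{(0,t]\times[0,M]}\mathbf 1_{\{\theta\le\lambda_s\}}N(ds,d\theta),\quad t\ge0.$$ Then $H_T$ admits a pseudo-chaotic expansion with respect to $N^{T,M}$, with $$H_T=\sum_{k=1}^{+\infty}\int_{([0,T]\times[0,M])^k}\frac1{k!}\,c_k(x_1,\ldots,x_k)\,N(dx_1)\cdots N(dx_k),$$ $$c_k(x_1,\ldots,x_k):=\mathbb E\left[L^{T,M}\,D^{k-1}_{(x_{(1)},\ldots,x_{(k-1)})}\mathbf 1_{\{\theta_{(k)}\le\lambda_{t_{(k)}}\}}\right],\qquad \forall (x_1,\ldots,x_k)\in([0,T]\times[0,M])^k,$$ where $0\le t_{(1)}\le\cdots\le t_{(k)}\le T$ are the ordered elements of $(t_1,\ldots,t_k)$, $x_i=(t_i,\theta_i)$, and $x_{(i)}=(t_{(i)},\theta_{(i)})$ is the point among $x_1,\dots,x_k$ with the $i$-th smallest time.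
   Context: Setting. $\mathbb X=\mathbb R_+\times\mathbb R_+$, with elements $x=(t,\theta)$ and Lebesgue measure $dx=dt\,d\theta$. $\Omega$ is the space of locally finite configurations $\omega=\sum_i\delta_{x_i}$ on $\mathbb X$ whose atoms $x_i=(t_i,\theta_i)$ have pairwise distinct, strictly positive times $t_i$, with the $\sigma$-field of the vague topology; $\mathbb P$ is the probability measure under which the canonical random measure $N(A)(\omega)=\omega(A)$ is a Poisson random measure with intensity $dx$. $\mathcal F^N_t=\sigma(N(\mathcal T\times B):\mathcal T\in\mathcal B([0,t]),B\in\mathcal B(\mathbb R_+))$, $\mathbb F^N=(\mathcal F^N_t)_{t\ge0}$, $\mathcal F^N_\infty$ is the $\sigma$-field generated by all $\mathcal F^N_t$, and $L^2(\Omega)$ is the set of square-integrable $\mathcal F_\infty^N$-measurable real random variables. $L^2_s$ denotes symmetric square-integrable functions. $N^{T,M}(A)=N(A\cap([0,T]\times[0,M]))$. Malliavin derivative. For $x_1,\ldots,x_n\in\mathbb X$, $D^n_{(x_1,\ldots,x_n)}F(\omega)=\sum_{J\subset\{1,\ldots,n\}}(-1)^{n-|J|}F(\omega+\sum_{j\in J}\delta_{x_j})$, where points already present in $\omega$ are not added a second time; $D^0F=F$. Iterated integrals. With $\Delta_j=\{(x_1,\ldots,x_j)\in\mathbb X^j:\ x_i\neq x_k\ \forall i\ne k\}$ and $f_j\in L^2_s(\mathbb X^j)$, $I_j(f_j)=\int_{\Delta_j}f_j(x_1,\ldots,x_j)(N(dx_1)-dx_1)\cdots(N(dx_j)-dx_j)$.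 Multiple integrals against $N(dx_1)\cdots N(dx_j)$ are likewise always over $j$-tuples of pairwise distinct points. $L^{2,T,M}(\Omega)$ is the set of $F\in L^2(\Omega)$ for which there exist $f_j\in L^2_s(([0,T]\times[0,M])^j)$, $j\ge1$, such that $F=\mathbb E[F]+\sum_{j\ge1}\frac1{j!}I_j(f_j)$. Pseudo-chaotic expansion. $F\in L^{2,T,M}(\Omega)$ is said to have a pseudo-chaotic expansion with respect to $N^{T,M}$ if there exist $g_j\in L^2_s(([0,T]\times[0,M])^j)$, $j\ge1$, with $F=\sum_{j\ge1}\frac1{j!}\int_{([0,T]\times[0,M])^j}g_j(x_1,\ldots,x_j)N(dx_1)\cdots N(dx_j)$, the series converging in $L^2(\Omega)$. $L^{T,M}=e^{MT}\mathbf 1_{\{N([0,T]\times[0,M])=0\}}$.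
   Formalization: It is additionally assumed that H_T is a.s. equal to a σ(N^{T,M})-measurable variable, a condition necessary for the conclusion: an F^N-predictable λ may depend on points of N with θ > M, and then H_T need not have such an expansion. *)

(* Defs.v *)
From HB Require Import structures.
From mathcomp Require Import all_boot all_order all_algebra.
From mathcomp Require Import all_classical all_reals all_analysis.
From mathcomp Require Import measurable_realfun.
Set Implicit Arguments.
Unset Strict Implicit.
Unset Printing Implicit Defensive.
Import Order.TTheory GRing.Theory Num.Theory.
Import numFieldNormedType.Exports.
Local Open Scope classical_set_scope.
Local Open Scope ring_scope.

(* Points x = (t, theta) live in the quadrant XX inside R * R. *)
Definition XX {R : realType} : set (R * R) := `[0, +oo[ `*` `[0, +oo[.

Definition box {R : realType} (T M : R) : set (R * R) := `[0, T] `*` `[0, M].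

(* dx = dt dtheta; always integrated over, or evaluated on, subsets of XX. *)
Notation dx R := ((@lebesgue_measure R) \x (@lebesgue_measure R))%E.

(* Since the times of the atoms are pairwise distinct, a configuration is a
   simple point measure and is encoded by the set of its atoms. *)
Definition is_config {R : realType} (A : set (R * R)) : Prop :=
  [/\ A `<=` XX,
      forall K, compact K -> finite_set (A `&` K),
      forall x, A x -> 0 < x.1 &
      forall x y, A x -> A y -> x.1 = y.1 -> x = y].

Record config (R : realType) := Config {
  atoms :> set (R * R);
  configP : is_config atoms }.

Lemma is_config0 (R : realType) : is_config (set0 : set (R * R)).
Proof. by split=> // K _; rewrite set0I; exact: finite_set0. Qed.

HB.instance Definition _ (R : realType) := gen_eqMixin (config R).
HB.instance Definition _ (R : realType) := gen_choiceMixin (config R).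
HB.instance Definition _ (R : realType) :=
  isPointed.Build (config R) (Config (is_config0 R)).

(* The vague topology is the coarsest topology making w |-> \int f dw
   continuous for every continuous f : XX -> R with compact support. *)
Definition vague_subbase (R : realType) : set_system (config R) :=
  [set V | exists (f : R * R -> R) (K : set (R * R)) (U : set R),
    [/\ {within XX, continuous f}, compact K,
        forall x, XX x -> ~ K x -> f x = 0, open U &
        V = [set w : config R | U (\sum_(x \in (w : set _)) f x)]]].

HB.instance Definition _ (R : realType) :=
  @isSubBaseTopological.Build (config R) (set (config R))
    (@vague_subbase R) id.

Definition vague_open (R : realType) : set_system (config R) := open.

HB.instance Definition _ (R : realType) :=
  Measurable.copy (config R) (g_sigma_algebraType (@vague_open R)).

Section point_process.
Context {R : realType}.
Implicit Types (A B : set (R * R)) (w : config R).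

Definition N A w : \bar R := counting (w `&` A).

Definition NTM (T M : R) A w : \bar R := N (A `&` box T M) w.

Definition poisson_random_measure (P : probability (config R) R) : Prop :=
  [/\ forall A, measurable A -> A `<=` XX ->
        measurable_fun [set: config R] (N A),
      forall A k, measurable A -> A `<=` XX -> (dx R A < +oo)%E ->
        P [set w | N A w = k%:R%:E] =
        (let r := fine (dx R A) in r ^+ k / k`!%:R * expR (- r))%:E,
      forall A, measurable A -> A `<=` XX -> dx R A = +oo%E ->
        P [set w | N A w = +oo%E] = 1%E &
      forall (n : nat) (A : 'I_n -> set (R * R)) (Y : 'I_n -> set (\bar R)),
        (forall i, measurable (A i) /\ A i `<=` XX) ->
        (forall i j, i != j -> A i `&` A j = set0) ->
        (forall i, measurable (Y i)) ->
        P (\bigcap_(i in [set: 'I_n]) (N (A i) @^-1` Y i)) =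
        (\prod_(i < n) P (N (A i) @^-1` Y i))%E].

Definition sigma_of (C : set (config R -> \bar R)) : set_system (config R) :=
  <<s \bigcup_(f in C) preimage_set_system setT f measurable >>.

Definition FN (t : R) : set_system (config R) :=
  sigma_of [set f | exists (S B : set R),
    [/\ measurable S, S `<=` `[0, t], measurable B, B `<=` `[0, +oo[ &
        f = N (S `*` B)]].

Definition FN_inf : set_system (config R) :=
  <<s \bigcup_(t in `[0, +oo[) FN t >>.

Definition FNTM (T M : R) : set_system (config R) :=
  sigma_of [set NTM T M A | A in measurable].

Definition measurable_wrt (G : set_system (config R)) (F : config R -> R) :=
  forall Y, measurable Y -> G (F @^-1` Y).

Definition time_domain : set (R * config R) := `[0, +oo[ `*` setT.

Definition predictable_sets : set_system (R * config R) :=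
  <<s time_domain,
    [set [set 0] `*` A | A in FN 0] `|`
    [set D | exists (s t : R) (A : set (config R)),
       [/\ 0 <= s, s < t, FN s A & D = `]s, t] `*` A]] >>.

Definition predictable (lambda : R -> config R -> R) : Prop :=
  forall Y, measurable Y ->
    predictable_sets
      (time_domain `&` [set p : R * config R | Y (lambda p.1 p.2)]).

(* \int_A f dN for nonnegative f. *)
Definition intN A (f : R * R -> \bar R) w : \bar R :=
  (\esum_(x in w `&` A) f x)%E.

Definition counting_process (lambda : R -> config R -> R) (t : R) w : R :=
  fine (intN (`]0, t] `*` `[0, +oo[)
    (fun x => (\1_[set y : R * R | y.2 <= lambda y.1 w] x)%:E) w).

(* w + \sum_(x in A) delta_x, points already present not being added again.
   If this is not a configuration (a time is null or shared by two atoms) it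
   is set to w by convention; for a given A with admissible times this
   happens with probability zero. *)
Definition add_points w A : config R :=
  match pselect (is_config (w `|` A)) with
  | left wA => Config wA
  | right _ => w
  end.

Definition malliavin (xs : seq (R * R)) (F : config R -> R) w : R :=
  \sum_(J : {set 'I_(size xs)}) (-1) ^+ (size xs - #|J|) *
    F (add_points w [set nth (0, 0) xs i | i in [set` J]]).

Definition in_power B (j : nat) : set (j.-tuple (R * R)) :=
  [set s | forall i, B (tnth s i)].

(* Iterated Lebesgue integral of a nonnegative function over B^j. *)
Fixpoint lebesgue_power B (j : nat) : (j.-tuple (R * R) -> \bar R) -> \bar R :=
  match j with
  | 0 => fun f => f [tuple]
  | j'.+1 => fun f =>
      (\int[dx R]_(x in B)
         lebesgue_power B (fun s : j'.-tuple _ => f [tuple of x :: s]))%E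
  end.

Definition L2s B (j : nat) (f : j.-tuple (R * R) -> R) : Prop :=
  [/\ forall s t : j.-tuple (R * R), in_power B s -> perm_eq s t -> f s = f t,
      measurable_fun (in_power B (j := j)) f &
      (lebesgue_power B (fun s => (f s ^+ 2)%:E) < +oo)%E].

(* Integral of f against N(dx_1)...N(dx_j) over tuples of pairwise distinct
   points of B. *)
Definition multN B (j : nat) (f : j.-tuple (R * R) -> R) w : R :=
  \sum_(s \in [set s : j.-tuple (R * R) |
                 uniq s /\ in_power (w `&` B) s]) f s.

(* Integral of f against (N(dx_1)-dx_1)...(N(dx_j)-dx_j) over tuples of
   pairwise distinct points of B, avoiding the previously chosen points p.
   The Lebesgue part need not avoid p, which is a null set. It is only used
   for B = [0,T] x [0,M], where square integrable functions are integrable. *)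
Fixpoint multNtilde_avoiding B w (j : nat) :
    seq (R * R) -> (j.-tuple (R * R) -> R) -> R :=
  match j with
  | 0 => fun _ f => f [tuple]
  | j'.+1 => fun p f =>
      let inner x := multNtilde_avoiding B w (x :: p)
                       (fun s : j'.-tuple _ => f [tuple of x :: s]) in
      \sum_(x \in (w `&` B) `\` [set` p]) inner x
      - \int[dx R]_(x in B) inner x
  end.

Definition multNtilde B (j : nat) (f : j.-tuple (R * R) -> R) w : R :=
  multNtilde_avoiding B w [::] f.

Section expansions.
Variables (P : probability (config R) R) (T M : R).

Definition L2 (F : config R -> R) : Prop :=
  measurable_wrt FN_inf F /\ ('E_P[(fun w => F w ^+ 2)%R] < +oo)%E.

Definition L2_cvg (S : nat -> config R -> R) (F : config R -> R) : Prop :=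
  ('E_P[(fun w => (F w - S n w) ^+ 2)%R])%E @[n --> \oo] --> 0%E.

Definition L2TM (F : config R -> R) : Prop :=
  L2 F /\
  exists f : forall j, j.-tuple (R * R) -> R,
    (forall j, (0 < j)%N -> L2s (box T M) (f j)) /\
    L2_cvg (fun n w => fine ('E_P[F])%E +
      \sum_(1 <= j < n.+1) j`!%:R^-1 * multNtilde (box T M) (f j) w) F.

Definition pseudo_chaotic_expansion (F : config R -> R)
    (g : forall j, j.-tuple (R * R) -> R) : Prop :=
  [/\ L2TM F,
      forall j, (0 < j)%N -> L2s (box T M) (g j) &
      L2_cvg (fun n w =>
        \sum_(1 <= j < n.+1) j`!%:R^-1 * multN (box T M) (g j) w) F].

Definition LTM w : R := expR (M * T) * \1_[set w | N (box T M) w = 0%E] w.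

(* Ties between times, a null set, are broken by the second coordinate, so
   that c is symmetric everywhere. *)
Definition time_le : rel (R * R) :=
  fun x y => (x.1 < y.1) || ((x.1 == y.1) && (x.2 <= y.2)).

(* Only meaningful for 0 < k. *)
Definition c (lambda : R -> config R -> R) (k : nat)
    (x : k.-tuple (R * R)) : R :=
  let xs := sort time_le x in
  let xk := nth (0, 0) xs k.-1 in
  fine ('E_P[(fun w => LTM w *
    malliavin (take k.-1 xs)
      (\1_[set w' | xk.2 <= lambda xk.1 w']) w)%R])%E.

End expansions.
End point_process.

(* Main.v *)
(* Write B = [0,T] x [0,M] and W for the finite set of atoms in B. By the
   multivariate Mecke formula, almost surely H_T behaves well (it is a function
   Y of the atoms in B, and all counted atoms are in B) not only on the
   configuration itself but also, for almost every configuration without atoms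
   in B, after adding to it any subset of W. Since the intensity is not
   anticipating, the derivative of order k - 1 of the last indicator is the
   k-th order increment of Y, whence c(J) is the Moebius transform of Y at J,
   and Moebius inversion gives H_T = sum of c(J) over all J included in W. As
   |c(J)| <= 2^|J|, all partial sums are dominated by functions of the Poisson
   variable |W| with finite moments, and dominated convergence gives the
   pseudo-chaotic expansion. The chaos kernels are
   f_j = sum_l 1/l! \int c_{j+l}(., t) dt^l; expanding the compensated integrals,
   the partial sums become sums over J included in W of a truncation of
   sum_r (-1)^r/r! \int f_{|J|+r}(J, t) dt^r = c(J), dominated in the same
   way. *)
Require Import Defs.
From HB Require Import structures.
From mathcomp Require Import all_boot all_order all_algebra.
From mathcomp Require Import all_classical all_reals all_analysis.
From mathcomp Require Import measurable_realfun.
From mathcomp Require Import ring lra.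
Set Implicit Arguments.
Unset Strict Implicit.
Unset Printing Implicit Defensive.
Import Order.TTheory GRing.Theory Num.Theory.
Import numFieldNormedType.Exports.
Local Open Scope classical_set_scope.
Local Open Scope ring_scope.

(** * Sums over subsets of a finite set *)

(** The expectation defining [c] empties the box but keeps the randomness of N outside it, whereas
    H_T = Y is only known almost surely at the configuration itself. The obstacle is to have it at
    hybrid configurations, made of the outside of one sample and of box atoms of another. Mecke's
    formula is therefore used twice: for the indicator of the exceptional event, and then for the
    probability of reaching that event, seen as a function of the added tuple. All constants come
    from the bound 2^k on the coefficients: a derivative of order k - 1 of an indicator has 2^(k-1)
    terms of size at most 1, and [LTM] has mean 1. Summation over the subsets of W gives 3^|W|, and
    integrating out a point costs 2MT. The chaos part rests on the fact that the series exp(1) and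
    exp(-1) in the operation of integrating out one point are inverse to each other. Their
    truncations are compared through Cauchy products of partial exponential sums; tail bounds
    uniform in the points replace exchanges of limits with iterated integrals. *)

Section subsequence_sums.
Context {X : eqType} {V : nmodType}.
Implicit Types (e s : seq X) (phi psi : seq X -> V).

(* When [e] lists the atoms of a configuration in a bounded set, [injsum k e phi]
   is the integral of phi over k-tuples of distinct atoms, [subsumk e k phi] is
   1/k! times it for symmetric phi, [subsum e phi] is the sum of the latter
   over k, and [mobius s phi] is the alternating sum defining the Malliavin
   derivative of order [size s]. *)
Fixpoint subsum e phi : V :=
  if e is x :: e' then subsum e' phi + subsum e' (fun s => phi (x :: s))
  else phi [::].

Fixpoint subsumk e (k : nat) phi : V :=
  match e, k with
  | _, 0 => phi [::]
  | [::], _.+1 => 0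
  | x :: e', k'.+1 => subsumk e' k'.+1 phi + subsumk e' k' (fun s => phi (x :: s))
  end.

Fixpoint injsum (k : nat) e phi : V :=
  if k is k'.+1 then
    \sum_(x <- e) injsum k' [seq y <- e | y != x] (fun s => phi (x :: s))
  else phi [::].

Lemma subsum_ext e phi psi :
  (forall s, subseq s e -> phi s = psi s) -> subsum e phi = subsum e psi.
Proof.
elim: e phi psi => [|x e IH] phi psi H /=; first exact: H.
congr (_ + _); apply: IH => s se; apply: H.
  exact: subseq_trans se (subseq_cons _ _).
by rewrite /= eqxx.
Qed.

Lemma subsumk0 e phi : subsumk e 0 phi = phi [::]. Proof. by case: e. Qed.

Lemma subsumk_ext e k phi psi :
  (forall s, subseq s e -> size s = k -> phi s = psi s) ->
  subsumk e k phi = subsumk e k psi.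
Proof.
elim: e k phi psi => [|x e IH] [|k] phi psi H //=; try exact: H.
congr (_ + _); apply: IH => s se sk; apply: H => //.
- exact: subseq_trans se (subseq_cons _ _).
- by rewrite /= eqxx.
- by rewrite /= sk.
Qed.

Lemma subsumk_gt e k phi : (size e < k)%N -> subsumk e k phi = 0.
Proof.
elim: e k phi => [|x e IH] [|k] phi //= ek.
by rewrite !IH ?addr0// ltnW.
Qed.

Lemma sum_subsumk e n phi : (size e < n)%N ->
  \sum_(0 <= k < n) subsumk e k phi = subsum e phi.
Proof.
elim: e n phi => [|x e IH] [|n] phi //= en.
  by rewrite big_nat_recl//= big1 ?addr0.
rewrite big_nat_recl//= big_split/= addrA -(IH n.+1) ?(ltnW en)//.
by rewrite big_nat_recl//= subsumk0 IH.
Qed.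

Lemma injsum_perm k e e' phi : perm_eq e e' -> injsum k e phi = injsum k e' phi.
Proof.
elim: k e e' phi => [//|k IH] e e' phi ee' /=.
rewrite (perm_big _ ee')/=; apply: eq_bigr => x _; apply: IH.
exact: perm_filter.
Qed.

Lemma injsum_ext k e phi psi :
  (forall s, size s = k -> uniq s -> {subset s <= e} -> phi s = psi s) ->
  injsum k e phi = injsum k e psi.
Proof.
elim: k e phi psi => [|k IH] e phi psi H /=; first by apply: H.
rewrite big_seq [RHS]big_seq; apply: eq_bigr => x xe; apply: IH => s sk us se.
apply: H => /=; first by rewrite sk.
- rewrite us andbT; apply/negP => /se; rewrite mem_filter eqxx//.
- move=> y; rewrite inE => /predU1P[->//|/se]; by rewrite mem_filter => /andP[].
Qed.

Definition symseq (U : Type) (phi : seq X -> U) :=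
  forall s t, perm_eq s t -> phi s = phi t.

Lemma symseq_cons (U : Type) (phi : seq X -> U) x :
  symseq phi -> symseq (fun s => phi (x :: s)).
Proof. by move=> H s t st; apply: H; rewrite perm_cons. Qed.

(** A tuple of distinct entries either avoids x or contains it in exactly one of k + 1 places;
    symmetry of [phi] brings x to the front, hence the factor k + 1. *)
Lemma injsum_cons k x e phi : symseq phi -> uniq (x :: e) ->
  injsum k.+1 (x :: e) phi = injsum k.+1 e phi + injsum k e (fun s => phi (x :: s)) *+ k.+1.
Proof.
elim: k x e phi => [|k IH] x e phi sphi /= /andP[xe ue].
  by rewrite big_cons/= addrC.
rewrite [LHS]/= big_cons/= eqxx/=.
have -> : [seq y <- e | y != x] = e.
  by apply/all_filterP/allP => y ye; apply: contraNneq xe => <-.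
have -> : \sum_(y <- e) injsum k.+1 (if x != y then x :: [seq z <- e | z != y]
                    else [seq z <- e | z != y]) (fun s => phi (y :: s)) =
   \sum_(y <- e) (injsum k.+1 [seq z <- e | z != y] (fun s => phi (y :: s)) +
                  injsum k [seq z <- e | z != y] (fun s => phi (x :: y :: s)) *+ k.+1).
  rewrite big_seq [RHS]big_seq; apply: eq_bigr => y ye.
  have -> : x != y by apply: contraNneq xe => ->.
  rewrite IH; last 2 first.
  - exact: symseq_cons.
  - by rewrite /= filter_uniq// mem_filter (negbTE xe) andbF.
  congr (_ + _ *+ _); apply: injsum_ext => s _ _ _; apply: sphi.
  by rewrite -cat1s -[x :: y :: s]cat1s -[y :: s]cat1s -[x :: s]cat1s perm_catCA.
by rewrite big_split/= addrCA sumrMnl [in RHS]mulrS.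
Qed.

(** Each subset of size k has k! orderings with the same value. In the induction on [e], the term
    containing x picks up (k + 1) times k!. *)
Lemma injsum_subsumk k e phi : symseq phi -> uniq e -> injsum k e phi = subsumk e k phi *+ k`!.
Proof.
elim: e k phi => [|x e IH] [|k] phi sphi ue //.
- by rewrite /= big_nil mul0rn.
- have ue' : uniq e by case/andP: ue.
  rewrite injsum_cons// IH// IH//; last exact: symseq_cons.
  rewrite -[subsumk (x :: e) _ _]/(subsumk e k.+1 phi + subsumk e k (fun s => phi (x :: s))).
  by rewrite mulrnDl -mulrnA mulnC -factS.
Qed.

End subsequence_sums.

Section moebius.
Context {X : eqType} {V : zmodType}.
Implicit Types (e s : seq X) (phi psi : seq X -> V).

Fixpoint mobius s phi : V :=
  if s is x :: s' then mobius s' (fun t => phi (x :: t)) - mobius s' phi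
  else phi [::].

Lemma mobius_ext s phi psi :
  (forall t, subseq t s -> phi t = psi t) -> mobius s phi = mobius s psi.
Proof.
elim: s phi psi => [|x e IH] phi psi H /=; first exact: H.
congr (_ - _); apply: IH => s se; apply: H.
  by rewrite /= eqxx.
exact: subseq_trans se (subseq_cons _ _).
Qed.

Lemma mobius_rcons s x phi :
  mobius (rcons s x) phi = mobius s (fun t => phi (rcons t x)) - mobius s phi.
Proof.
elim: s phi => [|y s IH] phi //=; rewrite !IH/=.
by rewrite !opprB addrACA [RHS]addrACA; congr (_ + _); rewrite addrC.
Qed.

Lemma subsumB e phi psi : subsum e (fun s => phi s - psi s) = subsum e phi - subsum e psi.
Proof.
by elim: e phi psi => [|x e IH] phi psi//=; rewrite !IH opprD addrACA.
Qed.

(** Moebius inversion: by induction the subsets of [x :: e] without x sum to [phi e] and those with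
    x to [phi (x :: e) - phi e], so the total telescopes. *)
Lemma subsum_mobius e phi : subsum e (fun s => mobius s phi) = phi e.
Proof.
elim: e phi => [|x e IH] phi //=.
by rewrite (subsumB e) !IH addrC subrK.
Qed.

End moebius.

Section real_bounds.
Context {X : eqType} {R : realFieldType}.
Implicit Types (e s : seq X) (phi psi : seq X -> R).

Lemma mobius_bound s phi C : (forall t, `|phi t| <= C) ->
  `|mobius s phi| <= 2 ^+ size s * C.
Proof.
elim: s phi => [|x s IH] phi H /=; first by rewrite expr0 mul1r.
apply: (le_trans (ler_normB _ _)).
by rewrite exprS -mulrA mulr_natl mulr2n; apply: lerD; apply: IH.
Qed.

Lemma ler_norm_subsumk e k phi psi : (forall s, `|phi s| <= psi s) ->
  `|subsumk e k phi| <= subsumk e k psi.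
Proof.
elim: e k phi psi => [|x e IH] [|k] phi psi H //=; first by rewrite normr0.
by apply: (le_trans (ler_normD _ _)); apply: lerD; apply: IH.
Qed.

Lemma ler_norm_subsum e phi psi : (forall s, `|phi s| <= psi s) ->
  `|subsum e phi| <= subsum e psi.
Proof.
elim: e phi psi => [|x e IH] phi psi H //=.
by apply: (le_trans (ler_normD _ _)); apply: lerD; apply: IH.
Qed.

Lemma subsumk_scale e k (a : R) phi : subsumk e k (fun s => a * phi s) = a * subsumk e k phi.
Proof.
elim: e k phi => [|x e IH] [|k] phi //=; first by rewrite mulr0.
by rewrite !IH mulrDr.
Qed.

Lemma subsum_scale e (a : R) phi : subsum e (fun s => a * phi s) = a * subsum e phi.
Proof. by elim: e phi => [|x e IH] phi //=; rewrite !IH mulrDr. Qed.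

(** The binomial theorem; with q = 2 it is the origin of the constant 3 in the bounds below. *)
Lemma subsum_pow e (q : R) : subsum e (fun s => q ^+ size s) = (1 + q) ^+ size e.
Proof.
elim: e => [|x e IH] //=.
under [X in _ + X]subsum_ext do rewrite exprS.
by rewrite subsum_scale IH exprS mulrDl mul1r.
Qed.

Lemma sum_subsumk_le e n phi : (forall s, 0 <= phi s) ->
  \sum_(0 <= k < n) subsumk e k phi <= subsum e phi.
Proof.
(* Continuing the sum past [n + size e] makes it exhaust all subsets and adds nonnegative terms
   only. *)
move=> phi0; rewrite -(@sum_subsumk _ _ e (n + size e).+1) ?ltnS ?leq_addl//.
rewrite [leRHS](big_cat_nat (n := n))//= ?lerDl; last first.
  by rewrite ltnW// ltnS leq_addr.
apply: sumr_ge0 => k _.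
have : `|subsumk e k (fun=> 0 : R)| <= subsumk e k phi.
  by apply: ler_norm_subsumk => s; rewrite normr0.
exact: le_trans.
Qed.

End real_bounds.

(** * Configurations and the sigma-algebra of counts *)

Section configurations.
Context {R : realType}.
Local Notation X := (R * R)%type.
Implicit Types (A K D : set X) (w : config R) (x : X).

Lemma time_le_total : total (@time_le R).
Proof.
move=> x y; rewrite /time_le; case: (ltgtP x.1 y.1) => //= _.
exact: le_total.
Qed.

Lemma time_le_trans : transitive (@time_le R).
Proof.
move=> y x z; rewrite /time_le.
move=> /orP[xy|/andP[/eqP xy xy2]] /orP[yz|/andP[/eqP yz yz2]].
- by rewrite (lt_trans xy yz).
- by rewrite -yz xy.
- by rewrite xy yz.
- by rewrite xy yz eqxx (le_trans xy2 yz2) orbT.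
Qed.

Lemma time_le_anti : antisymmetric (@time_le R).
Proof.
move=> [x1 x2] [y1 y2]; rewrite /time_le/=.
case: (ltgtP x1 y1) => //= ->; rewrite -eq_le => /eqP -> //.
Qed.

Lemma in_box (T M : R) x : box T M x <->
  (0 <= x.1 <= T) /\ (0 <= x.2 <= M).
Proof. by rewrite /box/=; split => -[]/=; rewrite !in_itv. Qed.

(** Integer boxes keep exhaustions countable; boundedness in this sense includes lying in the
    quadrant [XX]. *)
Definition bnd A := exists n : nat, A `<=` box n%:R n%:R.

Lemma bnd_sub A D : A `<=` D -> bnd D -> bnd A.
Proof. by move=> AD [n Dn]; exists n => x /AD /Dn. Qed.

Lemma bnd_box (T M : R) : bnd (box T M).
Proof.
exists (Num.trunc (Num.max T M)).+1 => x /in_box[/andP[x0 xT] /andP[y0 yM]].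
have h : Num.max T M <= (Num.trunc (Num.max T M)).+1%:R.
  by apply/ltW/truncnS_gt.
by apply/in_box; rewrite x0 y0 (le_trans xT)// ?(le_trans yM)//
   (le_trans _ h)// le_max lexx ?orbT.
Qed.

Lemma bnd_XX A : bnd A -> A `<=` XX.
Proof.
move=> [n An] x /An /in_box[/andP[x0 _] /andP[y0 _]].
by split; rewrite /= in_itv/= andbT.
Qed.

Lemma compact_box (T M : R) : compact (box T M).
Proof. by apply: compact_setX; apply: segment_compact. Qed.

Lemma finite_config w A : bnd A -> finite_set ((w : set _) `&` A).
Proof.
move=> [n An]; have [_ + _ _] := configP w => /(_ _ (@compact_box n%:R n%:R)).
by apply: sub_finite_set; apply: setIS.
Qed.

(** The order by time matters: subsequences of [pts] are then time-ordered, as [coef_mobius]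
    requires of the points at which a coefficient is evaluated. *)
Definition pts A w : seq X := sort (@time_le R) (finmap.enum_fset (fset_set ((w : set _) `&` A))).

Lemma mem_pts A w x : bnd A -> x \in pts A w <-> (w : set _) x /\ A x.
Proof.
move=> bA; rewrite mem_sort (in_fset_set (A := w `&` A)); last exact: finite_config.
by rewrite inE.
Qed.

Lemma uniq_pts A w : uniq (pts A w).
Proof. by rewrite sort_uniq finmap.fset_uniq. Qed.

Lemma sorted_pts A w : sorted (@time_le R) (pts A w).
Proof. exact/sort_sorted/time_le_total. Qed.

Lemma pts_perm A w s : bnd A -> uniq s ->
  (forall x, x \in s <-> (w : set _) x /\ A x) -> perm_eq (pts A w) s.
Proof.
move=> bA us H; apply: uniq_perm => //; first exact: uniq_pts.
by move=> x; apply/idP/idP => [/(mem_pts _ _ bA)/H|/H/(mem_pts _ _ bA)].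
Qed.

Definition cnt A w : nat := size (pts A w).

Lemma N_cnt A w : bnd A -> N A w = (cnt A w)%:R%:E.
Proof.
move=> bA; rewrite /N /counting; case: asboolP => [_|]; last first.
  by have := finite_config w bA.
by rewrite /cnt size_sort.
Qed.

Lemma cnt_perm A w s : bnd A -> uniq s ->
  (forall x, x \in s <-> (w : set _) x /\ A x) -> cnt A w = size s.
Proof. by move=> bA us H; apply/perm_size/pts_perm. Qed.

Lemma cnt_pts K A w : bnd K -> A `<=` K ->
  cnt A w = count (fun x => `[< A x >]) (pts K w).
Proof.
move=> bK AK; have bA := bnd_sub AK bK.
rewrite -size_filter; apply: cnt_perm => //.
  by rewrite filter_uniq// uniq_pts.
move=> x; rewrite mem_filter; split.
  by move=> /andP[/asboolP Ax /(mem_pts _ _ bK)[]].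
by move=> [wx Ax]; apply/andP; split; [exact/asboolP|apply/mem_pts=> //; split=> //; exact: AK].
Qed.

End configurations.

Section counting_sigma_algebra.
Context {R : realType}.
Local Notation X := (R * R)%type.
Implicit Types (A K D : set X) (w : config R) (x : X).

(** With arbitrary finite index types, the intersection of two cylinders is a cylinder over the sum
    of the index types, so that [gens] is a pi-system. *)
Definition cyl (I : finType) (D : I -> set X) (b : I -> nat) : set (config R) :=
  [set w | forall i, cnt (D i) w = b i].

Definition gens : set_system (config R) :=
  [set E | exists (I : finType) (D : I -> set X) (b : I -> nat),
    (forall i, measurable (D i) /\ bnd (D i)) /\ E = cyl D b].

(* Configurations with the sigma-algebra generated by the numbers of points in
   bounded sets. It is contained in the vague sigma-algebra, but only this
   one makes the maps [add_points] measurable by counting points. *)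
Definition cfg := g_sigma_algebraType gens.
HB.instance Definition _ := Measurable.on cfg.

Lemma gensI : setI_closed gens.
Proof.
move=> _ _ [I [D [b [mD ->]]]] [J [D' [b' [mD' ->]]]].
exists (I + J)%type,
  (fun k => match k with inl i => D i | inr j => D' j end),
  (fun k => match k with inl i => b i | inr j => b' j end); split.
  by case.
apply/seteqP; split => [w [H1 H2] [i|j]//=|w H].
by split => i; [exact: (H (inl i))|exact: (H (inr i))].
Qed.

Lemma gensT : gens setT.
Proof.
exists void, (fun=> set0), (fun=> 0%N); split; first by case.
by apply/seteqP; split => // w _ [].
Qed.

Lemma measurable_cnt_eq A k : measurable A -> bnd A ->
  measurable ([set w | cnt A w = k] : set cfg).
Proof.
move=> mA bA; apply: sub_sigma_algebra.
exists unit, (fun=> A), (fun=> k); split=> //.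
by apply/seteqP; split=> [w H []//|w /(_ tt)].
Qed.

Lemma measurable_cnt A d (T : measurableType d) (f : nat -> T) :
  measurable A -> bnd A ->
  measurable_fun setT (fun w : cfg => f (cnt A w)).
Proof.
move=> mA bA _ Y mY; rewrite setTI.
have -> : (fun w : cfg => f (cnt A w)) @^-1` Y =
   \bigcup_(k in [set k | Y (f k)]) [set w | cnt A w = k].
  by apply/seteqP; split=> [w /= H|w [k /= H ->]//]; exists (cnt A w).
by apply: bigcup_measurable => k _; exact: measurable_cnt_eq.
Qed.

Lemma measurable_fun_cfg d (T : measurableType d) (f : T -> cfg) :
  (forall A k, measurable A -> bnd A -> measurable [set t | cnt A (f t) = k]) ->
  measurable_fun setT f.
Proof.
move=> H; apply: (@measurability _ _ _ cfg _ _ gens) => //.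
move=> _ [_ [I [D [b [mD ->]]]] <-]; rewrite setTI.
have -> : f @^-1` cyl D b = \bigcap_(i in [set` I]) [set t | cnt (D i) (f t) = b i].
  by apply/seteqP; split=> t Ht i; [move=> _|]; exact: Ht.
apply: fin_bigcap_measurable; first exact: finite_finset.
by move=> i _; apply: H; apply mD.
Qed.

Section counting_kernel.
Context d (Z : measurableType d) (K : set X) (mK : measurable K) (bK : bnd K).
Variables (W : Z -> cfg) (mW : measurable_fun setT W).

(** The counting measure of the atoms in K as a finite sum of Dirac masses: sums over atoms become
    integrals against a kernel depending on the parameter z. *)
Definition cntm (z : Z) : set X -> \bar R :=
  msum (fun i => \d_(nth (0, 0) (pts K (W z)) i)) (size (pts K (W z))).

HB.instance Definition _ z := Measure.on (cntm z).

Lemma integral_cntm z (f : X -> \bar R) :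
  measurable_fun setT f -> (forall x, 0 <= f x)%E ->
  (\int[cntm z]_x f x = \sum_(x <- pts K (W z)) f x)%E.
Proof.
move=> mf f0; rewrite ge0_integral_measure_sum//.
rewrite (big_nth (0, 0)) big_mkord; apply: eq_bigr => i _.
by rewrite integral_dirac// diracT mul1e.
Qed.

Lemma cntmE z A : measurable A -> cntm z A = (cnt (K `&` A) (W z))%:R%:E.
Proof.
move=> mA; rewrite (cnt_pts (K := K))//.
rewrite /cntm /msum/= -(big_mkord xpredT (fun i => \d_(nth (0, 0) (pts K (W z)) i) A)).
rewrite -(big_nth (0, 0) xpredT (fun x => \d_x A)).
have : {subset pts K (W z) <= [pred x | `[< K x >]]}.
  by move=> x /(mem_pts _ _ bK)[_ Kx]; apply/asboolP.
elim: (pts K (W z)) => [|x s IH] sK; first by rewrite big_nil.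
rewrite big_cons IH/=; last by move=> y ys; apply: sK; rewrite inE ys orbT.
rewrite diracE natrD EFinD; congr (_ + _)%E; congr (_%:R%:E); congr nat_of_bool.
apply/idP/asboolP; first by rewrite inE => Ax; split=> //; apply/asboolP/sK; rewrite inE eqxx.
by rewrite inE => -[].
Qed.

End counting_kernel.

Section counting_kernel_measurable.
Import HBNNSimple.
Context d (Z : measurableType d) (K : set X) (mK : measurable K) (bK : bnd K).
Variables (W : Z -> cfg) (mW : measurable_fun setT W).

Let kern z : {measure set X -> \bar R} := cntm K W z.

Let kern_measurable U : measurable U -> measurable_fun setT (kern ^~ U).
Proof.
move=> mU; have -> : kern ^~ U = (fun z => (cnt (K `&` U) (W z))%:R%:E).
  by apply/funext => z; exact: cntmE.
apply: (@measurableT_comp _ _ _ _ _ _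
  (fun w : cfg => (cnt (K `&` U) w)%:R%:E) _ W) => //.
have bKU : bnd (K `&` U) by apply: bnd_sub bK; exact: subIsetl.
exact: (measurable_cnt (fun k => k%:R%:E) (measurableI _ _ mK mU) bKU).
Qed.

HB.instance Definition _ := isKernel.Build _ _ _ _ _ kern kern_measurable.

(** The sum is the integral of a section against the kernel of counts; approximation by simple
    functions reduces its measurability to that of the kernel masses of sections of measurable
    sets. *)
Lemma measurable_sum_pts (f : Z -> X -> \bar R) :
  (forall z x, (0 <= f z x)%E) ->
  measurable_fun [set: Z * X] (fun p => f p.1 p.2) ->
  measurable_fun setT (fun z => \sum_(x <- pts K (W z)) f z x)%E.
Proof.
move=> f0 mf.
pose g := fun p : Z * X => f p.1 p.2.
have -> : (fun z => \sum_(x <- pts K (W z)) f z x)%E =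
  (fun z => \int[kern z]_x g (z, x))%E.
  apply/funext => z; rewrite integral_cntm//; last by move=> x; exact: f0.
  exact: (measurableT_comp mf (measurable_pair1 z)).
pose k_ := nnsfun_approx measurableT mf.
have := @measurable_fun_xsection_integral _ _ Z X R g kern k_.
apply.
- by move=> a b ab; exact/nd_nnsfun_approx.
- by move=> z; apply: cvg_nnsfun_approx.
move=> n r; have := @measurable_prod_subset_xsection_kernel _ _ Z X R kern setT measurableT.
move=> H; have /H{}H : forall z, exists M : R, forall A : set X, measurable A ->
    (mrestr (kern z) measurableT A < M%:E)%E.
  (* Each measure of the kernel is finite: no set has more mass than the number of atoms in K, and
     the successor makes the bound strict. *)
  move=> z; exists (cnt K (W z)).+1%:R => A mA.
  rewrite /mrestr setIT /kern [X in (X < _)%E]cntmE// lte_fin ltr_nat ltnS.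
  by rewrite (cnt_pts (K := K))// count_size.
have mk : measurable (k_ n @^-1` [set r]) by exact: measurable_funPTI.
have [_] := H _ mk; congr (measurable_fun _ _); apply/funext => z.
by rewrite /mrestr setIT.
Qed.

End counting_kernel_measurable.

End counting_sigma_algebra.

(** * Adding points to a configuration *)

Section adding_points.
Context {R : realType}.
Local Notation X := (R * R)%type.
Implicit Types (A K D : set X) (w : config R) (x : X) (s : seq X).

Lemma config_eq w (w' : config R) : atoms w = atoms w' -> w = w'.
Proof.
case: w w' => [a ha] [b hb] /= ab; subst b; congr Config.
exact: Prop_irrelevance.
Qed.

Lemma is_config_sub A D : A `<=` D -> is_config D -> is_config A.
Proof.
move=> AD [D1 D2 D3 D4]; split.
- exact: subset_trans D1.
- by move=> K /D2; apply: sub_finite_set; apply: setSI.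
- by move=> x /AD /D3.
- by move=> x y /AD Dx /AD Dy; exact: D4.
Qed.

Lemma atoms_add_points w A : is_config ((w : set _) `|` A) ->
  atoms (add_points w A) = (w : set _) `|` A.
Proof. by rewrite /add_points; case: pselect. Qed.

Lemma add_points_default w A : ~ is_config ((w : set _) `|` A) ->
  add_points w A = w.
Proof. by rewrite /add_points; case: pselect. Qed.

Lemma bnd_bigbox n : bnd (box n%:R n%:R : set X).
Proof. by exists n. Qed.

Lemma in_bigbox x : XX x -> exists n : nat, box n%:R n%:R x.
Proof.
move=> [/=]; rewrite !in_itv/= !andbT => x0 y0.
have [n] := bnd_box x.1 x.2 => /(_ x) H.
by exists n; apply: H; apply/in_box; rewrite x0 y0 !lexx.
Qed.

Definition addable w x := `[< is_config ((w : set _) `|` [set x]) >].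

(** A conflict of times is looked for in one integer box at a time: each test runs over a finite
    list, so that addability becomes a countable intersection of measurable events. *)
Definition clash n w x : bool :=
  has (fun y => (y.1 == x.1) && (y != x)) (pts (box n%:R n%:R) w).

Lemma addableP w x : addable w x <->
  [/\ 0 < x.1, 0 <= x.2 & forall n, ~~ clash n w x].
Proof.
split=> [/asboolP[C1 C2 C3 C4]|[x1 x2 H]]; last apply/asboolP.
- split=> [||n].
  + by apply: C3; right.
  + by have [_ ] : XX x := C1 x (or_intror erefl); rewrite /= in_itv/= andbT.
  + apply/hasP => -[y /(mem_pts _ _ (bnd_bigbox n))[wy _] /andP[/eqP yx /eqP yNx]].
    by apply: yNx; apply: C4 => //; [left|right].
have {}H y : (w : set _) y -> y.1 = x.1 -> y = x.
  move=> wy yx; have [wX _ _ _] := configP w; have [n yn] := in_bigbox (wX _ wy).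
  apply/eqP; apply: contraNT (H n) => nyx; apply/hasP; exists y.
    by apply/(mem_pts _ _ (bnd_bigbox n)).
  by rewrite yx eqxx.
have [W1 W2 W3 W4] := configP w; split.
- move=> y [/W1//|->]; split; by rewrite /= in_itv/= andbT// ltW.
- move=> K cK; rewrite setIUl finite_setU; split; first exact: W2.
  by apply: sub_finite_set (finite_set1 x) => y [].
- by move=> y [/W3//|->].
- move=> y z [wy|->] [wz|->] //; first exact: W4.
  + exact: H.
  + by move=> /esym /(H _ wz).
Qed.

Fixpoint addable_seq w s : bool :=
  if s is x :: s' then addable w x && addable_seq (add_points w [set x]) s' else true.

Definition adds w s : config R := foldl (fun w x => add_points w [set x]) w s.

Lemma set_cons x s : [set` x :: s] = [set x] `|` [set` s].
Proof.
apply/seteqP; split=> y /=; rewrite inE.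
  by move=> /predU1P[->|]; [left|right].
by move=> [->|ys]; rewrite ?eqxx// ys orbT.
Qed.

Lemma addable_seqP w s : addable_seq w s <-> is_config ((w : set _) `|` [set` s]).
Proof.
elim: s w => [|x s IH] w /=.
  by rewrite set_nil setU0; split=> // _; exact: configP.
rewrite set_cons setUA; split.
  by move=> /andP[/asboolP wx /IH]; rewrite atoms_add_points.
move=> H; have wx : is_config ((w : set _) `|` [set x]).
  by apply: is_config_sub H; exact: subsetUl.
by apply/andP; split; [exact/asboolP|apply/IH; rewrite atoms_add_points].
Qed.

Lemma atoms_adds w s : addable_seq w s -> atoms (adds w s) = (w : set _) `|` [set` s].
Proof.
elim: s w => [|x s IH] w /=; first by rewrite set_nil setU0.
move=> /andP[/asboolP wx /IH]; rewrite /adds/= => ->.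
by rewrite atoms_add_points// set_cons setUA.
Qed.

(** Adding a set of points is all or nothing, whereas [adds] skips single offending points; the two
    agree when every successive addition is admissible. Measurability thus reduces to additions of
    one point. *)
Lemma add_pointsE w s : add_points w [set` s] = if addable_seq w s then adds w s else w.
Proof.
case: ifPn => [H|/negP H].
  apply: config_eq; rewrite atoms_adds// atoms_add_points//; exact/addable_seqP.
by apply: add_points_default => /addable_seqP.
Qed.

Lemma addable_seq_sub w s t : {subset t <= s} -> addable_seq w s -> addable_seq w t.
Proof.
move=> ts /addable_seqP H; apply/addable_seqP; apply: is_config_sub H.
by apply: setUS => x /= /ts.
Qed.

Lemma cnt_add A w x : bnd A -> cnt A (add_points w [set x]) =
  (cnt A w + [&& addable w x, `[< A x >] & ~~ has (pred1 x) (pts A w)])%N.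
Proof.
move=> bA; case: (boolP (addable w x)) => [/asboolP|/asboolP] wx /=; last first.
  by rewrite add_points_default// addn0.
case: asboolP => Ax /=; last first.
  rewrite addn0; apply: cnt_perm => //; first exact: uniq_pts.
  move=> y; rewrite atoms_add_points//; split=> [/(mem_pts _ _ bA)[]|].
    by split=> //; left.
  by move=> [[wy|->]//] Ay; exact/(mem_pts _ _ bA).
have [xw|xw] := boolP (has (pred1 x) (pts A w)).
  rewrite addn0; apply: cnt_perm => //; first exact: uniq_pts.
  move=> y; rewrite atoms_add_points//; split=> [/(mem_pts _ _ bA)[]|].
    by split=> //; left.
  move=> [[wy|->]] Ay; first exact/(mem_pts _ _ bA).
  by move: xw => /hasP[z + /eqP <-].
rewrite addn1; apply: (cnt_perm (s := x :: pts A w)) => //.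
  rewrite /= uniq_pts andbT; apply: contraNN xw => xw; apply/hasP; exists x => //=.
move=> y; rewrite atoms_add_points// inE; split.
  by move=> /predU1P[->|/(mem_pts _ _ bA)[wy Ay]]; split=> //; [right|left].
move=> [[wy|->] Ay]; last by rewrite eqxx.
by apply/orP; right; exact/(mem_pts _ _ bA).
Qed.

End adding_points.

Lemma measurable_eq_point {R : realType} d (Z : measurableType d) (x y : Z -> R * R) :
  measurable_fun setT x -> measurable_fun setT y ->
  measurable_fun setT (fun z => x z == y z).
Proof.
move=> mx my.
have -> : (fun z => x z == y z) =
    (fun z => ((x z).1 == (y z).1) && ((x z).2 == (y z).2)).
  by apply/funext => z; rewrite -pair_eqE.
by apply: measurable_and; apply: measurable_fun_eqr;
  try exact: (measurableT_comp measurable_fst);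
  exact: (measurableT_comp measurable_snd).
Qed.

Section adding_points_measurable.
Context {R : realType}.
Local Notation X := (R * R)%type.
Context d (Z : measurableType d).
Implicit Types (W : Z -> @cfg R).

Lemma measurable_box (T M : R) : measurable (box T M).
Proof. by apply: measurableX; exact: measurable_itv. Qed.

Lemma measurable_bool_set (b : Z -> bool) : measurable_fun setT b ->
  measurable [set z | b z].
Proof.
move=> mb; have := mb measurableT [set true]; by rewrite setTI; apply.
Qed.

Lemma measurable_bool_asbool (Q : Z -> Prop) : measurable [set z | Q z] ->
  measurable_fun setT (fun z => `[< Q z >]).
Proof.
move=> mQ; apply: (measurable_fun_bool true); rewrite setTI.
suff -> : (fun z => `[< Q z >]) @^-1` [set true] = [set z | Q z] by [].
by apply/seteqP; split=> z /= => [/asboolP|? ]; [|apply/asboolP].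
Qed.

Lemma measurable_natbool (b : Z -> bool) : measurable_fun setT b ->
  measurable_fun setT (fun z => ((b z)%:R : R)%:E).
Proof.
move=> mb; have -> : (fun z => ((b z)%:R : R)%:E) = (fun z => if b z then 1%E else 0%E).
  by apply/funext => z; case: (b z).
by apply: measurable_fun_ifT => //; exact: measurable_cst.
Qed.

(** No listed atom passes the test exactly when the sum of the indicators vanishes, which reduces
    the claim to sums over atoms. *)
Lemma measurable_has (K : set X) W (b : Z -> X -> bool) :
  measurable K -> bnd K -> measurable_fun setT W ->
  measurable_fun [set: Z * X] (fun p => b p.1 p.2) ->
  measurable_fun setT (fun z => has (b z) (pts K (W z))).
Proof.
move=> mK bK mW mb.
have H := @measurable_sum_pts R d Z K mK bK W mW (fun z x => ((b z x)%:R)%:E)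
  (fun z x => ltac:(by rewrite lee_fin)).
apply: (measurable_fun_bool false); rewrite setTI.
have -> : (fun z => has (b z) (pts K (W z))) @^-1` [set false] =
   (fun z => \sum_(x <- pts K (W z)) ((b z x)%:R : R)%:E)%E @^-1` [set 0%E].
  apply/seteqP; split=> z /=.
    move=> /negbT /hasPn h; rewrite big_seq big1// => x /h.
    by move=> /negbTE ->.
  move=> h; apply/negbTE/hasPn => x xz; apply/negP => bx.
  have : (1 <= \sum_(x <- pts K (W z)) ((b z x)%:R : R)%:E)%E.
    by rewrite (perm_big _ (perm_to_rem xz))/= big_cons bx leeDl// sume_ge0.
  by rewrite h leNgt lte01.
rewrite -[X in measurable X]setTI; apply: H => //.
have -> : (fun p : Z * X => ((b p.1 p.2)%:R : R)%:E) =
  (fun p => if b p.1 p.2 then 1%E else 0%E).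
  by apply/funext => p; case: (b _ _).
by apply: measurable_fun_ifT => //; exact: measurable_cst.
Qed.

Lemma measurable_addable W (x : Z -> X) : measurable_fun setT W -> measurable_fun setT x ->
  measurable_fun setT (fun z => addable (W z) (x z)).
Proof.
move=> mW mx.
have m1 : measurable_fun setT (fun z => (x z).1) by exact: (measurableT_comp measurable_fst).
have m2 : measurable_fun setT (fun z => (x z).2) by exact: (measurableT_comp measurable_snd).
have mc n : measurable_fun setT (fun z => clash n (W z) (x z)).
  apply: (@measurable_has _ W (fun z y => (y.1 == (x z).1) && (y != x z))) => //.
  - exact: measurable_box.
  - exact: bnd_bigbox.
  - apply: measurable_and.
      apply: measurable_fun_eqr.
        exact: (measurableT_comp measurable_fst measurable_snd).
      exact: (measurableT_comp m1 measurable_fst).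
    apply: measurable_neg; apply: measurable_eq_point.
      exact: measurable_snd.
    exact: (measurableT_comp mx measurable_fst).
apply: (measurable_fun_bool true); rewrite setTI.
have -> : (fun z => addable (W z) (x z)) @^-1` [set true] =
   [set z | (0 < (x z).1) && (0 <= (x z).2)] `&`
   \bigcap_n [set z | ~~ clash n (W z) (x z)].
  apply/seteqP; split=> z /=.
    by move/addableP => [-> -> h]; split=> // n _; exact: h.
  by move=> [/andP[h1 h2] h3]; apply/addableP; split=> // n; exact: h3.
apply: measurableI.
  apply/measurable_bool_set/measurable_and.
    by apply: measurable_fun_ltr => //; exact: measurable_cst.
  by apply: measurable_fun_ler => //; exact: measurable_cst.
by apply: bigcapT_measurable => n; apply/measurable_bool_set/measurable_neg.
Qed.

Lemma measurable_cntW A k W : measurable A -> bnd A -> measurable_fun setT W ->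
  measurable [set z | cnt A (W z) = k].
Proof.
move=> mA bA mW; rewrite -[X in measurable X]setTI.
by apply: (mW measurableT [set w | cnt A w = k]); exact: measurable_cnt_eq.
Qed.

(** Only counts have to be measurable, and by [cnt_add] each of them increases by a measurable
    boolean. *)
Lemma measurable_addp W (x : Z -> X) : measurable_fun setT W ->
  measurable_fun setT x ->
  measurable_fun setT (fun z => add_points (W z) [set x z] : cfg).
Proof.
move=> mW mx; apply: measurable_fun_cfg => A k mA bA.
pose b z := [&& addable (W z) (x z), `[< A (x z) >] &
   ~~ has (pred1 (x z)) (pts A (W z))].
have mb : measurable_fun setT b.
  apply: measurable_and; first exact: measurable_addable.
  apply: measurable_and.
    apply: measurable_bool_asbool; rewrite -[X in measurable X]setTI.
    exact: mx.
  apply: measurable_neg.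
  apply: (@measurable_has _ W (fun z v => pred1 (x z) v)) => //.
  apply: measurable_eq_point; first exact: measurable_snd.
  exact: (measurableT_comp mx measurable_fst).
have -> : [set t | cnt A (add_points (W t) [set x t]) = k] =
   ([set z | b z] `&` [set z | (cnt A (W z)).+1 = k]) `|`
   ([set z | ~~ b z] `&` [set z | cnt A (W z) = k]).
  have cb z : cnt A (add_points (W z) [set x z]) = (cnt A (W z) + b z)%N.
    by rewrite cnt_add.
  apply/seteqP; split=> z /=; rewrite cb.
    by case bz : (b z); rewrite ?addn1 ?addn0 => ck; [left|right].
  by case bz : (b z); rewrite ?addn1 ?addn0; case=> -[].
apply: measurableU; apply: measurableI.
- exact: measurable_bool_set.
- case: k => [|k].
    rewrite (_ : [set _ | _] = set0); first exact: measurable0.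
    by rewrite -subset0 => z.
  rewrite (_ : [set _ | _] = [set z | cnt A (W z) = k]); last first.
    by apply/seteqP; split=> z /= => [[]|->].
  exact: measurable_cntW.
- exact/measurable_bool_set/measurable_neg.
- exact: measurable_cntW.
Qed.

End adding_points_measurable.

Definition ev {X Z : Type} (s : seq (Z -> X)) (z : Z) : seq X :=
  [seq x z | x <- s].

Section adding_sequences_measurable.
Context {R : realType}.
Local Notation X := (R * R)%type.
Context d (Z : measurableType d).
Implicit Types (W : Z -> @cfg R) (s : seq (Z -> X)).

Definition mfuns s := forall x, List.In x s -> measurable_fun setT x.

Lemma measurable_addable_seq W s : measurable_fun setT W -> mfuns s ->
  measurable_fun setT (fun z => addable_seq (W z) (ev s z)).
Proof.
elim: s W => [|x s IH] W mW ms /=; first exact: measurable_cst.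
have mx : measurable_fun setT x by apply: ms; left.
apply: measurable_and; first exact: measurable_addable.
apply: (IH (fun z => add_points (W z) [set x z])); first exact: measurable_addp.
by move=> y ys; apply: ms; right.
Qed.

Lemma measurable_adds W s : measurable_fun setT W -> mfuns s ->
  measurable_fun setT (fun z => adds (W z) (ev s z) : cfg).
Proof.
elim: s W => [|x s IH] W mW ms //=.
have mx : measurable_fun setT x by apply: ms; left.
apply: (IH (fun z => add_points (W z) [set x z])); first exact: measurable_addp.
by move=> y ys; apply: ms; right.
Qed.

Lemma measurable_add_points W s : measurable_fun setT W -> mfuns s ->
  measurable_fun setT (fun z => add_points (W z) [set` ev s z] : cfg).
Proof.
move=> mW ms; under eq_fun do rewrite add_pointsE.
apply: measurable_fun_ifT => //; first exact: measurable_addable_seq.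
exact: measurable_adds.
Qed.

End adding_sequences_measurable.

(** * The Mecke formula *)

Section functional_unique.
Import HBNNSimple.
Local Open Scope ereal_scope.
Context d (T : measurableType d) (R : realType).
Implicit Types (f g : T -> \bar R) (L : (T -> \bar R) -> \bar R).

Definition nnmeas f := (forall t, 0 <= f t) /\ measurable_fun setT f.

(** The features of integration that a monotone class argument uses. Both sides of the Mecke formula
    have them without being written as integrals against a single measure. *)
Record ge0_functional L := {
  gef_ge0 : forall f, nnmeas f -> 0 <= L f;
  gef_add : forall f g, nnmeas f -> nnmeas g -> L (fun t => f t + g t) = L f + L g;
  gef_scale : forall (k : R) f, (0 <= k)%R -> nnmeas f ->
    L (fun t => k%:E * f t) = k%:E * L f;
  gef_lim : forall (F : nat -> T -> \bar R), (forall n, nnmeas (F n)) ->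
    (forall t, nondecreasing_seq (F ^~ t)) ->
    L (fun t => limn (F ^~ t)) = limn (fun n => L (F n)) }.

Definition ind (E : set T) (t : T) : \bar R := (\1_E t)%:E.

Lemma nnmeas_ind E : measurable E -> nnmeas (ind E).
Proof.
move=> mE; split=> [t|]; first by rewrite lee_fin.
exact/measurable_EFinP/measurable_indic.
Qed.

Lemma nnmeas_scale (k : R) f : (0 <= k)%R -> nnmeas f -> nnmeas (fun t => k%:E * f t).
Proof.
move=> k0 [f0 mf]; split=> [t|]; first by rewrite mule_ge0// lee_fin.
exact: measurable_funeM.
Qed.

Lemma nnmeas_sum (I : Type) (r : seq I) (F : I -> T -> \bar R) :
  (forall i, nnmeas (F i)) -> nnmeas (fun t => \sum_(i <- r) F i t).
Proof.
move=> H; split=> [t|]; first by apply: sume_ge0 => i _; apply H.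
by apply: emeasurable_sum => i _; apply H.
Qed.

Lemma functional_ind L1 L2 : ge0_functional L1 -> ge0_functional L2 ->
  (forall E, measurable E -> L1 (ind E) = L2 (ind E)) ->
  forall f, nnmeas f -> L1 f = L2 f.
Proof.
move=> l1 l2 H f [f0 mf].
pose F := nnsfun_approx measurableT mf.
have Fn n : nnmeas (fun t => (F n t)%:E).
  by split=> [t|]; [rewrite lee_fin|exact/measurable_EFinP].
have -> : f = (fun t => limn (fun n => (F n t)%:E)).
  apply/funext => t; apply/esym/cvg_lim => //.
  by apply: cvg_nnsfun_approx => //.
have nd t : nondecreasing_seq (fun n => (F n t)%:E).
  by move=> a b ab; rewrite lee_fin; exact/lefP/nd_nnsfun_approx.
rewrite (gef_lim l1)// (gef_lim l2)//.
congr (limn _); apply/funext => n.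
set h := F n.
have -> : (fun t => (h t)%:E) =
  (fun t => \sum_(r <- finmap.enum_fset (fset_set (range h)))
      (`|r|%R%:E * ind (h @^-1` [set r]) t)).
  apply/funext => t; rewrite fimfunE -fsumEFin// fsbig_finite//.
  rewrite big_seq [RHS]big_seq; apply: eq_bigr => r.
  rewrite in_fset_set// inE => -[t' _ <-].
  by rewrite EFinM ger0_norm.
elim: (finmap.enum_fset _) => [|r s IH].
  under eq_fun do rewrite big_nil.
  have -> : (fun=> 0) = (fun t => 0%R%:E * ind setT t).
    by apply/funext => t; rewrite mul0e.
  by rewrite (gef_scale l1)// ?(gef_scale l2)// ?mul0e//; exact: nnmeas_ind.
under eq_fun do rewrite big_cons.
have mi r' : nnmeas (fun t => `|r'|%R%:E * ind (h @^-1` [set r']) t).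
  by apply: nnmeas_scale => //; apply: nnmeas_ind; exact: measurable_funPTI.
rewrite (gef_add l1) ?(gef_add l2)//; [|exact: nnmeas_sum..].
rewrite IH (gef_scale l1)// ?(gef_scale l2)// ?H//;
  try (apply: nnmeas_ind); exact: measurable_funPTI.
Qed.

(** Monotone class argument: the sets whose indicators get equal values form a lambda-system
    containing the pi-system [G]. Finiteness of [L1 (cst 1)] allows the subtraction needed for
    proper differences. *)
Lemma functional_unique L1 L2 (G : set_system T) :
  ge0_functional L1 -> ge0_functional L2 ->
  measurable = <<s G >> -> setI_closed G -> G setT ->
  L1 (cst 1) < +oo ->
  (forall E, G E -> L1 (ind E) = L2 (ind E)) ->
  forall f, nnmeas f -> L1 f = L2 f.
Proof.
move=> l1 l2 mG GI GT L1oo H; apply: functional_ind => // E.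
have indT : ind setT = cst 1 by apply/funext => t; rewrite /ind indicT.
have Lle E' : measurable E' -> L1 (ind E') < +oo.
  move=> mE'; apply: le_lt_trans L1oo.
  rewrite -indT; have -> : ind setT = (fun t => ind E' t + ind (~` E') t).
    apply/funext => t; rewrite /ind -EFinD indicT !indicE in_setC.
    by case: (t \in E'); rewrite ?addr0 ?add0r.
  have mC := measurableC mE'.
  rewrite (gef_add l1); [|exact: nnmeas_ind..].
  by rewrite leeDl// (gef_ge0 l1)//; exact: nnmeas_ind.
pose D := [set E | measurable E /\ L1 (ind E) = L2 (ind E)].
suff : measurable `<=` D by move=> /[apply] -[].
have GD : G `<=` D.
  by move=> A GA; split; [rewrite mG; exact: sub_sigma_algebra|exact: H].
rewrite mG; apply: lambda_system_subset => //; split => //.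
- exact: GD.
- move=> A B BA [mA eA] [mB eB]; have mAB := measurableD mA mB.
  split=> //.
  have E1 : ind A = (fun t => ind B t + ind (A `\` B) t).
    apply/funext => t; rewrite /ind -EFinD; congr (_%:E).
    rewrite !indicE in_setD; case: (boolP (t \in B)) => tB; last by rewrite andbT add0r.
    by rewrite andbF addr0; move: tB; rewrite !inE => /BA tA; rewrite mem_set.
  move: eA; rewrite E1 (gef_add l1); [|exact: nnmeas_ind..].
  rewrite (gef_add l2); [|exact: nnmeas_ind..].
  rewrite eB => /eqP; rewrite addeC [in X in _ == X]addeC.
  have fB : L2 (ind B) \is a fin_num.
    by rewrite -eB ge0_fin_numE ?Lle// (gef_ge0 l1)//; exact: nnmeas_ind.
  move=> /eqP e; have := congr1 (fun x => x - L2 (ind B)) e.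
  by rewrite !addeK.
- move=> F ndF FD.
  have mF n : measurable (F n) by have [] := FD n.
  split; first exact: bigcupT_measurable.
  have E1 : ind (\bigcup_n F n) = (fun t => limn (fun n => ind (F n) t)).
    apply/funext => t; apply/esym/cvg_lim => //.
    rewrite /ind.
    have [[n _ Fnt]|nt] := pselect ((\bigcup_n F n) t).
      rewrite [X in _ --> (X)%:E](_ : _ = 1%R); last first.
        by rewrite indicE mem_set//; exists n.
      apply: cvg_near_cst; near=> m.
      rewrite indicE mem_set//; have : (n <= m)%N by near: m; exact: nbhs_infty_ge.
      by move=> /ndF/subsetPset; apply.
    rewrite [X in _ --> (X)%:E](_ : _ = 0%R); last by rewrite indicE memNset.
    apply: cvg_near_cst; near=> m; rewrite indicE memNset// => Fmt.
    by apply: nt; exists m.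
  have nd t : nondecreasing_seq (fun n => ind (F n) t).
    move=> a b ab; rewrite lee_fin !indicE ler_nat.
    case: (boolP (t \in F a)) => //; rewrite inE => Fa.
    by rewrite mem_set//; move: t Fa; apply/subsetPset/ndF.
  rewrite E1 (gef_lim l1)//; last by move=> n; exact: nnmeas_ind.
  rewrite (gef_lim l2)//; last by move=> n; exact: nnmeas_ind.
  by congr (limn _); apply/funext => n; have [] := FD n.
Unshelve. all: by end_near. Qed.

End functional_unique.
Arguments ind {d T R} E t.

(** Provides the rectangles on which the two sides of the Mecke formula will be compared. *)
Lemma measurable_bnd_cfg_prod {R : realType} d (Z : measurableType d) :
  @measurable _ (Z * @cfg R)%type =
  <<s [set E | exists A B, [/\ measurable A, gens B & E = A `*` B] ] >>.
Proof.
set G := [set E | _].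
have sG : sigma_algebra setT <<s G>> by exact: smallest_sigma_algebra.
have G1 (A : set Z) : measurable A -> <<s G>> (A `*` (setT : set cfg)).
  move=> mA; apply: sub_sigma_algebra; exists A, setT; split=> //; exact: gensT.
apply/seteqP; split; last first.
  apply: smallest_sub; first exact: smallest_sigma_algebra.
  move=> _ [A [B [mA gB ->]]]; apply: measurableX => //.
  exact: sub_sigma_algebra.
apply: smallest_sub => // E [[A mA <-]|[B mB <-]].
  by rewrite setTI -[fst @^-1` A]/([set x | A x.1]) (_ : [set _ | _] = A `*` setT);
    [exact: G1|apply/seteqP; split=> x // -[]].
rewrite setTI.
(* Good sets principle in the second factor: these sets form a sigma-algebra that contains
   [gens]. *)
pose H := [set B : set cfg | <<s G>> ((snd : Z * cfg -> cfg) @^-1` B)].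
suff : <<s gens>> `<=` H by apply.
apply: smallest_sub; last first.
  move=> C gC; apply: sub_sigma_algebra; exists setT, C; split=> //.
  by apply/seteqP; split=> x // -[].
have [s0 sC sU] := sG; split.
- by rewrite /H/= preimage_set0.
- by move=> C; rewrite /H/= => /sC; rewrite !setTD preimage_setC.
- by move=> F HF; rewrite /H/= preimage_bigcup; exact: sU.
Qed.

Section poisson_facts.
Context {R : realType} (P : probability (config R) R).
Hypothesis poissonP : poisson_random_measure P.
Local Notation X := (R * R)%type.
Implicit Types (A D : set X) (w : config R).

Lemma measurable_cnt_vague A k : measurable A -> bnd A ->
  measurable [set w : config R | cnt A w = k].
Proof.
move=> mA bA; have [mN _ _ _] := poissonP.
have := mN A mA (bnd_XX bA) measurableT [set k%:R%:E] (emeasurable_set1 _).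
rewrite setTI; congr (measurable _); apply/seteqP; split=> w /=.
  by rewrite N_cnt// => -[/eqP]; rewrite eqr_nat => /eqP.
by rewrite N_cnt// => ->.
Qed.

Lemma measurable_idc : measurable_fun setT (id : config R -> cfg).
Proof. by apply: measurable_fun_cfg => A k mA bA; exact: measurable_cnt_vague. Qed.

Lemma measurable_vague d (T : measurableType d) (f : cfg -> T) :
  measurable_fun setT f -> measurable_fun setT (f : config R -> T).
Proof. by move=> mf; exact: (measurableT_comp mf measurable_idc). Qed.

Lemma measurable_vague_prod d d' (Z : measurableType d') (T : measurableType d)
    (f : Z * cfg -> T) :
  measurable_fun setT f -> measurable_fun setT (f : Z * config R -> T).
Proof.
move=> mf.
have : measurable_fun setT (fun p : Z * config R => (p.1, p.2 : cfg)).
  apply: measurable_fun_pair; first exact: measurable_fst.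
  exact: (measurableT_comp measurable_idc measurable_snd).
move=> /(measurableT_comp mf); congr (measurable_fun _ _).
by apply/funext => -[].
Qed.

Lemma dx_box (T M : R) : 0 <= T -> 0 <= M -> dx R (box T M) = (T * M)%:E.
Proof.
move=> T0 M0; rewrite product_measure1E//; [|exact: measurable_itv..].
have Hi (a : R) : 0 <= a -> lebesgue_measure (`[0, a]%classic : set R) = a%:E.
  move=> a0; rewrite lebesgue_measure_itv/= lte_fin sube0.
  by case: ltgtP a0 => // <-.
by rewrite EFinM; congr (_ * _)%E; exact: Hi.
Qed.

Lemma dx_vline (a : R) (S : set R) : measurable S -> dx R (`[a, a] `*` S) = 0%E.
Proof.
move=> mS; rewrite product_measure1E//.
have H0 : lebesgue_measure (`[a, a]%classic : set R) = 0%E.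
  by rewrite lebesgue_measure_itv/= ltxx.
by rewrite [X in (X * _)%E](_ : _ = 0%E)// mul0e.
Qed.

Lemma dx_fin A : measurable A -> bnd A -> (dx R A < +oo)%E.
Proof.
move=> mA [n An]; apply: (@le_lt_trans _ _ (dx R (box n%:R n%:R))).
  by apply: le_measure; rewrite ?inE//; exact: measurable_box.
by rewrite dx_box// ltry.
Qed.

Definition poiss (r : R) (k : nat) : R := r ^+ k / k`!%:R * expR (- r).

Lemma P_cnt A k : measurable A -> bnd A ->
  P [set w | cnt A w = k] = (poiss (fine (dx R A)) k)%:E.
Proof.
move=> mA bA; have [_ /(_ A k mA (bnd_XX bA) (dx_fin mA bA)) H _ _] := poissonP.
rewrite -H; congr (P _); apply/seteqP; split=> w /=.
  by rewrite N_cnt// => ->.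
by rewrite N_cnt// => -[/eqP]; rewrite eqr_nat => /eqP.
Qed.

Lemma P_cyl (I : finType) (D : I -> set X) (b : I -> nat) :
  (forall i, measurable (D i) /\ bnd (D i)) ->
  (forall i j, i != j -> D i `&` D j = set0) ->
  P (cyl D b) = (\prod_i poiss (fine (dx R (D i))) (b i))%:E.
Proof.
move=> mD tD; have [_ _ _ /(_ #|I| (D \o enum_val)
  (fun i => [set (b (enum_val i))%:R%:E])) H] := poissonP.
have -> : cyl D b = \bigcap_(i in [set: 'I_#|I|])
     (N (D (enum_val i)) @^-1` [set (b (enum_val i))%:R%:E]).
  apply/seteqP; split=> w /= Hw i.
    by move=> _; rewrite /= N_cnt ?Hw//; apply mD.
  have := Hw (enum_rank i) Logic.I; rewrite /= enum_rankK N_cnt; last by apply mD.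
  by move=> -[/eqP]; rewrite eqr_nat => /eqP.
rewrite H; last 3 first.
- by move=> i; have [? ?] := mD (enum_val i); split=> //; exact: bnd_XX.
- by move=> i j ij; apply: tD; rewrite (inj_eq enum_val_inj).
- by move=> i; exact: emeasurable_set1.
have prodE (F : I -> R) : (\prod_i F i)%:E = (\prod_i (F i)%:E)%E.
  by apply: (big_ind2 (fun x y => x%:E = y)) => // x1 x2 y1 y2 <- <-.
rewrite prodE.
rewrite [RHS](reindex (enum_val : 'I_#|I| -> I))/=; last first.
  by exists enum_rank => i _; rewrite ?enum_valK ?enum_rankK.
apply: eq_bigr => i _; have [mi bi] := mD (enum_val i).
rewrite -P_cnt//; congr (P _); apply/seteqP; split=> w /=.
  by rewrite N_cnt// => -[/eqP]; rewrite eqr_nat => /eqP.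
by rewrite N_cnt// => ->.
Qed.

Definition fresh w (x : X) := forall y, (w : set _) y -> y.1 != x.1.

(** The vertical line through x has area 0, so each of its bounded pieces is almost surely free of
    atoms, and countably many pieces cover its part in the quadrant. *)
Lemma ae_fresh (x : X) : {ae P, forall w, fresh w x}.
Proof.
pose L n : set X := `[x.1, x.1] `*` `[0, n%:R] `&` box n%:R n%:R.
have mI n : measurable (`[x.1, x.1] `*` `[0, n%:R] : set X).
  by apply: measurableX; exact: measurable_itv.
have mL n : measurable (L n) by apply: measurableI => //; exact: measurable_box.
have bL n : bnd (L n) by exists n => y [].
have L0 n : dx R (L n) = 0%E.
  apply/eqP; rewrite eq_le measure_ge0 andbT.
  apply: (@le_trans _ _ (dx R (`[x.1, x.1] `*` `[0, n%:R]))).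
    by apply: le_measure; rewrite ?inE; [exact: mL|exact: mI|exact: subIsetl].
  by rewrite dx_vline//; exact: measurable_itv.
have : P.-negligible (\bigcup_n (~` [set w | cnt (L n) w = 0%N])).
  apply: negligible_bigcup => n; exists (~` [set w | cnt (L n) w = 0%N]); split=> //.
    by apply: measurableC; exact: measurable_cnt_vague.
  apply: (etrans (probability_setC P (measurable_cnt_vague 0%N (mL n) (bL n)))).
  by rewrite P_cnt// L0/= /poiss expr0 fact0 divr1 oppr0 expR0 mul1r subee.
apply: negligibleS => w /existsNP[y /not_implyP[wy /negP]]; rewrite negbK => /eqP yx.
have [wX _ _ _] := configP w; have [n yn] := in_bigbox (wX _ wy).
exists n => // c0.
have : y \in pts (L n) w.
  apply/(mem_pts _ _ (bL n)); split=> //; split=> //; split; last by have [] := yn.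
  by rewrite /= in_itv/= yx lexx.
by move: c0; rewrite /= /cnt => /size0nil ->.
Qed.

Lemma fresh_addable w x : 0 < x.1 -> 0 <= x.2 -> fresh w x -> addable w x.
Proof.
move=> x1 x2 wx; apply/addableP; split=> // n; apply/hasPn => y.
by move=> /(mem_pts _ _ (bnd_bigbox n))[/wx/negbTE -> _].
Qed.

Lemma fresh_cnt A w x : bnd A -> 0 < x.1 -> 0 <= x.2 -> fresh w x ->
  cnt A (add_points w [set x]) = (cnt A w + `[< A x >])%N.
Proof.
move=> bA x1 x2 wx; rewrite cnt_add// fresh_addable//=.
case: asboolP => //= Ax; rewrite (_ : has _ _ = false)//.
by apply/negbTE/hasPn => y /(mem_pts _ _ bA)[/wx yx _] /=; apply: contraNneq yx => ->.
Qed.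

End poisson_facts.

Section gef_series.
Local Open Scope ereal_scope.
Context d (T : measurableType d) (R : realType).
Variables (L : (T -> \bar R) -> \bar R) (l : ge0_functional L).

Lemma gef0 : L (fun=> 0) = 0.
Proof.
have -> : (fun=> 0) = (fun t => 0%R%:E * ind setT t) :> (T -> \bar R).
  by apply/funext => t; rewrite mul0e.
by rewrite (gef_scale l)// ?mul0e//; exact: nnmeas_ind.
Qed.

Lemma gef_sum (I : Type) (r : seq I) (Q : pred I) (F : I -> T -> \bar R) :
  (forall i, nnmeas (F i)) ->
  L (fun t => \sum_(i <- r | Q i) F i t) = \sum_(i <- r | Q i) L (F i).
Proof.
move=> nF; elim: r => [|i r IH].
  by rewrite big_nil -[RHS]gef0; congr L; apply/funext => t; rewrite big_nil.
rewrite big_cons -IH; case: ifPn => Qi.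
  rewrite -(gef_add l)//; last first.
    have := @nnmeas_sum _ T R _ [seq i <- r | Q i] F nF.
    by under eq_fun do rewrite big_filter.
  by congr L; apply/funext => t; rewrite big_cons Qi.
by congr L; apply/funext => t; rewrite big_cons (negbTE Qi).
Qed.

Lemma gef_series (F : nat -> T -> \bar R) :
  (forall i, nnmeas (F i)) ->
  L (fun t => \sum_(i <oo) F i t) = \sum_(i <oo) L (F i).
Proof.
move=> nF; rewrite (gef_lim l).
- by congr (limn _); apply/funext => n; rewrite gef_sum.
- by move=> n; exact: nnmeas_sum.
- move=> t m n mn; apply: lee_sum_nneg_natr => // k _ _.
  by apply nF.
Qed.

End gef_series.

Section mecke.
Context {R : realType} (P : probability (config R) R).
Hypothesis poissonP : poisson_random_measure P.
Local Notation X := (R * R)%type.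
Variables (B : set X) (mB : measurable B) (bB : bnd B).
Hypothesis Bpos : forall x, B x -> 0 < x.1.

Local Open Scope ereal_scope.
Implicit Types (Phi : X * @cfg R -> \bar R).

(* Both sides of the Mecke formula are additive, homogeneous and monotonically
   continuous in [Phi], so that it is enough to compare them on the rectangles
   generating the product sigma-algebra. *)
Definition mecke_lhs Phi := \int[P]_w \sum_(x <- pts B w) Phi (x, w).

Definition mecke_rhs Phi :=
  \int[dx R]_(x in B) \int[P]_w Phi (x, add_points w [set x]).

Lemma measurable_mecke_lhs Phi : nnmeas Phi ->
  measurable_fun setT (fun w : config R => \sum_(x <- pts B w) Phi (x, w)).
Proof.
move=> [P0 mP].
apply: (measurable_vague poissonP (f := fun w => \sum_(x <- pts B w) Phi (x, w))).
apply: (measurable_sum_pts mB bB (@measurable_id _ _ setT)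
  (f := fun w x => Phi (x, w))) => //.
apply: (measurableT_comp mP).
by apply: measurable_fun_pair; [exact: measurable_snd|exact: measurable_fst].
Qed.

Lemma measurable_shift Phi : nnmeas Phi ->
  measurable_fun setT
   (fun p : X * config R => Phi (p.1, add_points p.2 [set p.1])).
Proof.
move=> [P0 mP].
apply: (measurable_vague_prod poissonP
  (f := fun p : X * cfg => Phi (p.1, add_points p.2 [set p.1]))).
apply: (measurableT_comp mP).
apply: measurable_fun_pair; first exact: measurable_fst.
by apply: measurable_addp; [exact: measurable_snd|exact: measurable_fst].
Qed.

Lemma measurable_mecke_rhs Phi : nnmeas Phi ->
  measurable_fun setT (fun x => \int[P]_w Phi (x, add_points w [set x])).
Proof.
move=> nP; apply: (@measurable_fun_fubini_tonelli_F _ _ X (config R) R P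
  (fun p => Phi (p.1, add_points p.2 [set p.1]))).
  exact: measurable_shift.
by move=> p; apply nP.
Qed.

Lemma gef_mecke_lhs : ge0_functional mecke_lhs.
Proof.
split.
- move=> f [f0 _]; apply: integral_ge0 => w _; exact: sume_ge0.
- move=> f g nf ng; rewrite /mecke_lhs -ge0_integralD//.
  + by apply: eq_integral => w _; rewrite big_split.
  + by move=> w _; apply: sume_ge0 => x _; apply nf.
  + exact: measurable_mecke_lhs.
  + by move=> w _; apply: sume_ge0 => x _; apply ng.
  + exact: measurable_mecke_lhs.
- move=> k f k0 nf; rewrite /mecke_lhs -ge0_integralZl//.
  + by apply: eq_integral => w _; rewrite ge0_sume_distrr// => x _; apply nf.
  + exact: measurable_mecke_lhs.
  + by move=> w _; apply: sume_ge0 => x _; apply nf.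
- move=> F nF ndF; rewrite /mecke_lhs -monotone_convergence//.
  + apply: eq_integral => w _.
    have H f : nnmeas f -> \sum_(x <- pts B w) f (x, w : cfg) =
        \int[cntm B id (w : cfg)]_x f (x, w : cfg).
      move=> [f0 mf]; rewrite integral_cntm//.
      exact: (measurableT_comp mf (measurable_pair2 _)).
    have nlim : nnmeas (fun t => limn (F ^~ t)).
      split=> [t|].
        apply: lime_ge; first exact: ereal_nondecreasing_is_cvgn.
        by apply: nearW => n; apply nF.
      apply: (emeasurable_fun_cvg F) => [n|t _]; first by apply nF.
      exact: ereal_nondecreasing_is_cvgn.
    rewrite (H _ nlim) monotone_convergence//.
    * by congr (limn _); apply/funext => n; rewrite H.
    * move=> n; apply: (measurableT_comp (proj2 (nF n)) (measurable_pair2 _)).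
    * by move=> n x _; apply nF.
  + by move=> n; exact: measurable_mecke_lhs.
  + by move=> n w _; apply: sume_ge0 => x _; apply nF.
  + by move=> w _ m n mn; apply: lee_sum => x _; exact: (ndF (x, w : cfg)).
Qed.

Lemma gef_mecke_rhs : ge0_functional mecke_rhs.
Proof.
have R0 (f : X * @cfg R -> \bar R) x : nnmeas f -> 0 <= \int[P]_w f (x, add_points w [set x]).
  by move=> nf; apply: integral_ge0 => w _; apply nf.
have ms (f : X * @cfg R -> \bar R) x : nnmeas f -> measurable_fun setT
    (fun w : config R => f (x, add_points w [set x])).
  move=> nf; exact: (measurableT_comp (measurable_shift nf) (measurable_pair1 x)).
have mR (f : X * @cfg R -> \bar R) : nnmeas f -> measurable_fun B
    (fun x => \int[P]_w f (x, add_points w [set x])).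
  by move=> nf; apply: measurable_funTS; exact: measurable_mecke_rhs.
split.
- by move=> f nf; apply: integral_ge0 => x _; exact: R0.
- move=> f g nf ng; rewrite /mecke_rhs -ge0_integralD//;
    try (by move=> x _; exact: R0); try exact: mR.
  apply: eq_integral => x _; rewrite -ge0_integralD//;
    try exact: ms; by move=> w _; first [apply nf|apply ng].
- move=> k f k0 nf; rewrite /mecke_rhs -ge0_integralZl//;
    try (by move=> x _; exact: R0); try exact: mR.
  apply: eq_integral => x _; rewrite -ge0_integralZl//;
    try exact: ms; by move=> w _; apply nf.
- move=> F nF ndF; rewrite /mecke_rhs -monotone_convergence//;
    try (by move=> n x _; exact: R0); try (by move=> n; exact: mR).
  + apply: eq_integral => x _; rewrite -monotone_convergence//.
    * by move=> n; exact: ms.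
    * by move=> n w _; apply nF.
  + move=> x _ m n mn; apply: ge0_le_integral => //.
    * by move=> w _; apply nF.
    * exact: ms.
    * exact: ms.
    * by move=> w _; exact: (ndF (x, add_points w [set x] : cfg) m n mn).
Qed.

End mecke.

Lemma ind_setX {R : realType} d1 d2 (T1 : measurableType d1)
    (T2 : measurableType d2) (A : set T1) (C : set T2) x w :
  (ind (A `*` C) (x, w) = (\1_A x)%:E * (\1_C w)%:E :> \bar R)%E.
Proof. by rewrite /ind !indicE in_setX -EFinM -natrM mulnb. Qed.

Section mecke_formula.
Context {R : realType} (P : probability (config R) R).
Hypothesis poissonP : poisson_random_measure P.
Local Notation X := (R * R)%type.
Variables (B : set X) (mB : measurable B) (bB : bnd B).
Hypothesis Bpos : forall x, B x -> 0 < x.1.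

(** The identity n p(n) = r p(n - 1) of Poisson weights at the coordinate [i0], with n = k + 1; the
    other factors are common to both sides. *)
Lemma fine_prod_poiss (I : finType) (r : I -> R) (v : I -> nat) (i0 : I) k :
  v i0 = k.+1 ->
  (v i0)%:R * \prod_i poiss (r i) (v i) =
  r i0 * \prod_i poiss (r i) (if i == i0 then k else v i).
Proof.
move=> vk; rewrite (bigD1 i0)//= [in RHS](bigD1 i0)//= eqxx vk.
rewrite [in RHS](eq_bigr (fun i => poiss (r i) (v i))); last first.
  by move=> i /negbTE ->.
rewrite !mulrA; congr (_ * _); rewrite /poiss factS natrM exprS.
have k0 : k.+1%:R != 0 :> R by rewrite pnatr_eq0.
have f0 : k`!%:R != 0 :> R by rewrite pnatr_eq0 -lt0n fact_gt0.
move: k0 f0; move: (k.+1%:R : R) (k`!%:R : R) => b a b0 a0.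
by field; rewrite a0 b0.
Qed.

Local Open Scope ereal_scope.

Lemma measurable_cyl (I : finType) (D : I -> set X) (v : I -> nat) :
  (forall i, measurable (D i) /\ bnd (D i)) ->
  measurable (cyl D v : set (@cfg R)).
Proof. by move=> mD; apply: sub_sigma_algebra; exists I, D, v. Qed.

Lemma measurable_cyl_vague (I : finType) (D : I -> set X) (v : I -> nat) :
  (forall i, measurable (D i) /\ bnd (D i)) ->
  measurable (cyl D v : set (config R)).
Proof.
move=> mD; rewrite -[X in measurable X]setTI.
exact: (measurable_idc poissonP measurableT (measurable_cyl v mD)).
Qed.

(** Left side: on the cylinder exactly [v i0] atoms lie in [D i0]. Right side: since the sets are
    disjoint, adding a fresh point of [D i0] raises that single count by one, so the event becomes
    the cylinder with [v i0] lowered by one. The two Poisson probabilities are related by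
    [fine_prod_poiss]. *)
Lemma mecke_disj (I : finType) (D : I -> set X) (v : I -> nat) (i0 : I) :
  (forall i, measurable (D i) /\ bnd (D i)) ->
  (forall i j, i != j -> D i `&` D j = set0) ->
  D i0 `<=` B ->
  let E := ind (D i0 `*` (cyl D v : set cfg)) in mecke_lhs P B E = mecke_rhs P B E.
Proof.
move=> mD tD DB E; have [mi bi] := mD i0.
have -> : mecke_lhs P B E = (v i0)%:R%:E * P (cyl D v).
  rewrite /mecke_lhs (eq_integral (fun w => (v i0)%:R%:E * (\1_(cyl D v) w)%:E)).
    rewrite ge0_integralZl_EFin//; last first.
      apply/measurable_EFinP/measurable_indic; exact: measurable_cyl_vague.
    by rewrite integral_indic ?setIT//; exact: measurable_cyl_vague.
  move=> w _; rewrite /E.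
  under eq_bigr do rewrite ind_setX.
  rewrite -ge0_sume_distrl; last by move=> x _; rewrite lee_fin.
  rewrite [in RHS]indicE; case: (boolP (w \in cyl D v)) => [|wD]; last first.
    by rewrite indicE (negbTE wD) !mule0.
  rewrite inE => wD; rewrite indicE mem_set//= !mule1 -(wD i0).
  rewrite (cnt_pts w bB DB); elim: (pts B w) => [|x s IH]; first by rewrite big_nil.
  rewrite big_cons IH/= natrD EFinD; congr (_ + _)%E.
(* Probability that adding a point of [D i0] produces the cylinder; it is 0 when [v i0] is 0,
   because the added point itself is counted. *)
pose kap : R := if v i0 is k.+1 then
  fine (P (cyl D (fun i => if i == i0 then k else v i))) else 0%R.
have -> : mecke_rhs P B E = kap%:E * dx R (D i0).
  have k0 : (0 <= kap)%R by rewrite /kap; case: (v i0) => // k; rewrite fine_ge0.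
  transitivity (\int[dx R]_(x in B) (kap%:E * (\1_(D i0) x)%:E)); last first.
    rewrite ge0_integralZl_EFin//; last exact/measurable_EFinP/measurable_indic.
    by rewrite integral_indic// setIidl.
  apply: eq_integral => x /[!inE] Bx; rewrite /E.
  have x1 := Bpos Bx; have [_ x2] := bnd_XX bB Bx.
  rewrite /= in_itv/= andbT in x2.
  under eq_integral do rewrite ind_setX.
  rewrite [in RHS]indicE; case: (boolP (x \in D i0)) => xD; last first.
    by rewrite indicE (negbTE xD) mule0; under eq_integral do rewrite mul0e;
       rewrite integral0.
  rewrite indicE xD mule1; under eq_integral do rewrite mul1e.
  rewrite inE in xD.
  have fc w : fresh w x -> (add_points w [set x] \in cyl D v) =
     if v i0 is k.+1 then w \in cyl D (fun i => if i == i0 then k else v i)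
     else false.
    move=> fw; have c1 i : cnt (D i) (add_points w [set x]) = (cnt (D i) w + (i == i0))%N.
      rewrite fresh_cnt//; last by apply mD.
      congr (_ + nat_of_bool _)%N; apply/asboolP/eqP => [xi|->//].
      apply/eqP; apply: contraPT (xi) => ii0 xi'.
      by have := tD _ _ ii0; rewrite -subset0 => /(_ x); apply.
    apply/idP/idP.
      rewrite inE => h; have := h i0; rewrite c1 eqxx addn1.
      case: (v i0) => // k [ck]; rewrite inE => i.
      by case: eqP => [->//|/eqP ii0]; have := h i; rewrite c1 (negbTE ii0) addn0.
    case vk : (v i0) => [//|k]; rewrite !inE => h i; have := h i; rewrite c1.
    by case: eqP => [-> ->|_ ->]; rewrite ?addn1 ?addn0.
  have mA : measurable_fun setT (fun w : config R => (\1_(cyl D v : set cfg) (add_points w [set x] : cfg))%:E : \bar R).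
    have := measurable_shift poissonP (nnmeas_ind R (measurableX measurableT (measurable_cyl v mD))).
    move=> /measurableT_comp /(_ (measurable_pair1 x)); congr (measurable_fun _ _).
    by apply/funext => w; rewrite /= ind_setX indicT mul1e.
  rewrite /kap; case vk : (v i0) => [|k]; rewrite vk in fc.
    rewrite (ge0_ae_eq_integral (g := cst 0))// ?integral0//.
    have [N [mN N0 sN]] := ae_fresh poissonP x; exists N; split=> //.
    apply: subset_trans sN => w /= H fw; apply: H => _.
    by rewrite indicE fc.
  set Ck := cyl D (fun i => if _ then _ else _); have mC : measurable (Ck : set (config R)) by exact: measurable_cyl_vague.
  rewrite (ge0_ae_eq_integral (g := fun w => (\1_Ck w)%:E))//.
- rewrite integral_indic// setIT fineK//; exact: fin_num_measure.
  - exact/measurable_EFinP/measurable_indic.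
  have [N [mN N0 sN]] := ae_fresh poissonP x; exists N; split=> //.
  apply: subset_trans sN => w /= H fw; apply: H => _.
  by rewrite !indicE fc.
rewrite (P_cyl poissonP)// /kap; case vk : (v i0) => [|k]; first by rewrite !mul0e.
rewrite (P_cyl poissonP)//=.
rewrite -[in RHS](fineK (x := dx R (D i0))); last first.
  by rewrite ge0_fin_numE//; exact: dx_fin.
by rewrite -!EFinM -vk; congr (_%:E); rewrite (fine_prod_poiss _ vk) mulrC.
Qed.

End mecke_formula.

Section mecke_general.
Context {R : realType} (P : probability (config R) R).
Hypothesis poissonP : poisson_random_measure P.
Local Notation X := (R * R)%type.

Lemma nneseries1 (n0 : nat) (f : nat -> \bar R) :
  (forall n, n != n0 -> f n = 0%E) -> (\sum_(n <oo) f n = f n0)%E.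
Proof.
move=> H; apply/cvg_lim => //; apply: cvg_near_cst; near=> N.
rewrite big_mkord; have nN : (n0 < N)%N by near: N; exact: nbhs_infty_gt.
rewrite (bigD1 (Ordinal nN))//= big1 ?adde0// => i ii0; apply: H.
by apply: contraNneq ii0 => i0; apply/eqP/val_inj.
Unshelve. all: by end_near. Qed.

Lemma bnd_fin (J : finType) (D : J -> set X) : (forall j, bnd (D j)) ->
  exists n : nat, forall j, D j `<=` box n%:R n%:R.
Proof.
move=> /choice[f Hf]; exists (\max_j f j) => j x /Hf.
move=> /in_box[/andP[x0 xT] /andP[y0 yM]].
have h : (f j)%:R <= (\max_j f j)%:R :> R by rewrite ler_nat leq_bigmax.
by apply/in_box; rewrite x0 y0 (le_trans xT)// (le_trans yM).
Qed.

Section atoms.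
Variables (J : finType) (D : J -> set X) (n : nat).
Hypothesis mD : forall j, measurable (D j).
Hypothesis Dn : forall j, D j `<=` box n%:R n%:R.

(* The sets D j are cut into the disjoint atoms of the algebra they generate:
   for disjoint sets the numbers of points are independent Poisson variables
   and the Mecke formula reduces to (k+1) p(k+1) = r p(k). *)
Definition lab (x : X) : {set J} := [set j | `[< D j x >]].

Definition atom (e : {set J}) : set X :=
  box n%:R n%:R `&` [set x | lab x = e].

Lemma measurable_atom e : measurable (atom e) /\ bnd (atom e).
Proof.
split; last by exists n => x [].
apply: measurableI; first exact: measurable_box.
have -> : [set x | lab x = e] =
    \bigcap_(j in [set` J]) (if j \in e then D j else ~` D j).
  apply/seteqP; split=> x /=.
    by move=> <- j _; rewrite inE; case: asboolP.
  move=> H; apply/setP => j; have := H j isT; rewrite inE.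
  by case: (j \in e) => h; apply/asboolP.
apply: fin_bigcap_measurable; first exact: finite_finset.
by move=> j _; case: ifP => _ //; exact: measurableC.
Qed.

Lemma atom_disj e e' : e != e' -> atom e `&` atom e' = set0.
Proof.
move=> ee; rewrite -subset0 => x [[_ xe] [_ xe']].
by move: ee; rewrite -xe -xe' eqxx.
Qed.

Lemma atom_sum j x : (`[< D j x >] = \sum_(e : {set J} | j \in e) `[< atom e x >] :> nat)%N.
Proof.
case: asboolP => Dx.
  rewrite (bigD1 (lab x))/=; last by rewrite inE; apply/asboolP.
  rewrite big1 ?addn0; last first.
    by move=> e /andP[_ ee]; case: asboolP => // -[_ xe]; rewrite -xe eqxx in ee.
  by case: asboolP => // -[]; split=> //; exact: Dn Dx.
rewrite big1// => e je; case: asboolP => // -[_ xe]; exfalso.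
by move: je; rewrite -xe inE => /asboolP.
Qed.

Lemma cnt_atoms j (w : config R) :
  cnt (D j) w = (\sum_(e : {set J} | j \in e) cnt (atom e) w)%N.
Proof.
rewrite (cnt_pts w (bnd_bigbox n) (@Dn j)).
under eq_bigr => e _ do rewrite (cnt_pts w (bnd_bigbox n) (@subIsetl _ _ _)).
elim: (pts _ w) => [|x s IH] /=; first by rewrite big1.
by rewrite big_split/= -IH -atom_sum.
Qed.

End atoms.

Variables (B : set X) (mB : measurable B) (bB : bnd B).
Hypothesis Bpos : forall x, B x -> 0 < x.1.
Local Open Scope ereal_scope.

Lemma mecke_lhs_ext (f g : X * @cfg R -> \bar R) :
  (forall x w, B x -> f (x, w) = g (x, w)) -> mecke_lhs P B f = mecke_lhs P B g.
Proof.
move=> H; apply: eq_integral => w _; rewrite big_seq [RHS]big_seq.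
by apply: eq_bigr => x /(mem_pts _ _ bB)[_ /H].
Qed.

Lemma mecke_rhs_ext (f g : X * @cfg R -> \bar R) :
  (forall x w, B x -> f (x, w) = g (x, w)) -> mecke_rhs P B f = mecke_rhs P B g.
Proof.
move=> H; apply: eq_integral => x /[!inE] Bx.
by apply: eq_integral => w _; rewrite H.
Qed.

(** The sets [D0 i] and the intersection of C and B, labelled [None], are cut into atoms. The
    cylinder is the disjoint union of atom cylinders over the count vectors v with [psi v], and C
    inside B is the union of the atoms whose label contains [None]; on each piece [mecke_disj]
    applies. *)
Lemma mecke_rect (C : set X) (I : finType) (D0 : I -> set X) (b : I -> nat) :
  measurable C -> (forall i, measurable (D0 i) /\ bnd (D0 i)) ->
  let E := ind (C `*` (cyl D0 b : set cfg)) in mecke_lhs P B E = mecke_rhs P B E.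
Proof.
move=> mC mD0 E.
pose J := option I.
pose D (j : J) := if j is Some i then D0 i else C `&` B.
have mD j : measurable (D j).
  by case: j => [i|]; [apply mD0|exact: measurableI].
have bD j : bnd (D j).
  by case: j => [i|]; [apply mD0|apply: bnd_sub bB; exact: subIsetr].
have [n Dn] := bnd_fin bD.
have mA e : measurable (atom D n e) /\ bnd (atom D n e) by exact: measurable_atom.
have lL := gef_mecke_lhs poissonP mB bB; have lR := gef_mecke_rhs poissonP mB.
pose V (w : @cfg R) : {ffun {set J} -> nat} := [ffun e => cnt (atom D n e) w].
pose psi (v : {ffun {set J} -> nat}) := [forall i, \sum_(e : {set J} | Some i \in e) v e == b i]%N.
have EV w : cyl D0 b w <-> psi (V w).
  have H i : cnt (D0 i) w = (\sum_(e : {set J} | Some i \in e) V w e)%N.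
    rewrite -[D0 i]/(D (Some i)) (cnt_atoms Dn).
    by apply: eq_bigr => e _; rewrite ffunE.
  split=> [Hw|/forallP Hw i]; last by apply/eqP; rewrite H.
  by apply/forallP => i; rewrite -H Hw.
(* Count vectors are indexed by integers to form a series; the test [pickle v == k] ensures that a
   vector is used at one index only. *)
pose F k : set cfg := if unpickle k is Some v then
  (if (pickle (v : {ffun {set J} -> nat}) == k) && psi v then cyl (atom D n) v else set0) else set0.
have mF k : measurable (F k).
  rewrite /F; case: (unpickle k) => // v; case: ifP => // _.
  exact: measurable_cyl.
have VF w k : (w \in F k) = (k == pickle (V w)) && psi (V w).
  apply/idP/idP.
    rewrite inE /F; case: (unpickle k) => // v; case: ifP => // /andP[/eqP vk pv] wv.
    have -> : V w = v by apply/ffunP => e; rewrite ffunE wv.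
    by rewrite vk eqxx pv.
  move=> /andP[/eqP -> pv]; rewrite inE /F pickleK eqxx pv /=.
  by move=> e; rewrite ffunE.
pose T (e : {set J}) (k : nat) : X * @cfg R -> \bar R := ind (atom D n e `*` F k).
have nT e k : nnmeas (T e k).
  by apply: nnmeas_ind; apply: measurableX => //; apply mA.
pose E' (p : X * @cfg R) := \sum_(e : {set J} | None \in e) \sum_(k <oo) T e k p.
have EE' x w : B x -> E (x, w) = E' (x, w).
  move=> Bx; rewrite /E' /E ind_setX.
  under eq_bigr => e _.
    rewrite (nneseries1 (n0 := pickle (V w))); last first.
      by move=> k kV; rewrite /T ind_setX [X in _ * X%:E]indicE VF (negbTE kV) mule0.
    rewrite /T ind_setX [X in _ * X%:E]indicE VF eqxx/=.
    over.
  rewrite -ge0_sume_distrl; last by move=> e _; rewrite lee_fin.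
  rewrite [X in _ * X%:E = _]indicE (_ : (w \in _) = psi (V w)); last first.
    by apply/idP/idP; rewrite ?inE => /EV.
  congr (_ * _); under eq_bigr do rewrite indicE.
  rewrite sumEFin -natr_sum; congr (_%:R%:E).
  transitivity (nat_of_bool `[< D None x >]).
    congr nat_of_bool; apply/idP/asboolP; [by rewrite inE|by case=> Cx _; rewrite inE].
  rewrite (atom_sum Dn); apply: eq_bigr => e _.
  by congr nat_of_bool; apply/asboolP/idP; rewrite inE.
rewrite (mecke_lhs_ext EE') (mecke_rhs_ext EE') /E'.
have nS e : nnmeas (fun p => \sum_(k <oo) T e k p).
  split=> [p|]; first by apply: nneseries_ge0 => k _ _; apply nT.
  by apply: ge0_emeasurable_sum => [k p _ _|k _]; apply nT.
rewrite (gef_sum lL)// (gef_sum lR)//; apply: eq_bigr => e eN.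
rewrite (gef_series lL)// (gef_series lR)//; apply: eq_eseriesr => k _.
have E0 : mecke_lhs P B (ind set0) = mecke_rhs P B (ind set0).
  have -> : ind set0 = (fun=> 0) :> (X * @cfg R -> \bar R).
    by apply/funext => p; rewrite /ind indic0.
  by rewrite (gef0 lL) (gef0 lR).
rewrite /T /F; case: (unpickle k) => [v|]; last by rewrite setX0.
case: ifP => _; last by rewrite setX0.
apply: mecke_disj => //.
- by move=> i j; exact: atom_disj.
- move=> x [_ xe]; move: eN; rewrite -xe inE => /asboolP[].
  done.
Qed.

End mecke_general.

Section mecke_theorem.
Context {R : realType} (P : probability (config R) R).
Hypothesis poissonP : poisson_random_measure P.
Local Notation X := (R * R)%type.
Local Open Scope ereal_scope.

Lemma mecke_pos (B : set X) (Phi : X * @cfg R -> \bar R) :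
  measurable B -> bnd B -> (forall x, B x -> (0 < x.1)%R) -> nnmeas Phi ->
  mecke_lhs P B Phi = mecke_rhs P B Phi.
Proof.
move=> mB bB Bpos.
have rect C G : measurable C -> gens G ->
    mecke_lhs P B (ind (C `*` (G : set cfg))) = mecke_rhs P B (ind (C `*` (G : set cfg))).
  by move=> mC [I [D [b [mD ->]]]]; exact: mecke_rect.
apply: (functional_unique (gef_mecke_lhs poissonP mB bB) (gef_mecke_rhs poissonP mB)
  (@measurable_bnd_cfg_prod R _ X)).
- move=> _ _ [A [G [mA gG ->]]] [A' [G' [mA' gG' ->]]].
  exists (A `&` A'), (G `&` G'); split; [exact: measurableI|exact: gensI|].
  by rewrite setXI.
- by exists setT, setT; split=> //; [exact: gensT|rewrite setXTT].
(* Finite total mass: by the case of rectangles the mean number of atoms in B equals the area of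
   B. *)
- have -> : cst 1 = ind (setT `*` (setT : set cfg)) :> (X * @cfg R -> \bar R).
    by apply/funext => p; rewrite setXTT /ind indicT.
  rewrite rect//; last exact: gensT.
  rewrite /mecke_rhs; under eq_integral do rewrite setXTT.
  rewrite (_ : \int[dx R]_(x in B) _ = dx R B); first exact: dx_fin.
  rewrite -[RHS]mul1e -integral_cst//; apply: eq_integral => x _.
  transitivity (\int[P]_w cst 1 w).
    by apply: eq_integral => w _; rewrite /ind indicT.
  by rewrite integral_cst// mul1e; exact: probability_setT.
- by move=> _ [A [G [mA gG ->]]]; exact: rect.
Qed.

(** The segment at time 0 is removed from the box: it has area 0 and contains no atom, since atoms
    have positive times. All remaining times are positive, as required of points to be added. *)
Lemma mecke (T M : R) (Phi : X * @cfg R -> \bar R) : nnmeas Phi ->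
  \int[P]_w \sum_(x <- pts (box T M) w) Phi (x, w) =
  \int[dx R]_(x in box T M) \int[P]_w Phi (x, add_points w [set x]).
Proof.
move=> nP; pose N0 : set X := `[0%R, 0%R] `*` `[0%R, M].
have mN : measurable N0 by apply: measurableX; exact: measurable_itv.
have mB0 : measurable (box T M `\` N0).
  by apply: measurableD => //; exact: measurable_box.
have N00 : dx R N0 = 0 by apply: dx_vline; exact: measurable_itv.
transitivity (mecke_rhs P (box T M `\` N0) Phi); last first.
  apply/esym/ge0_negligible_integral => //.
  - exact: measurable_box.
  - by apply: measurable_funTS; exact: measurable_mecke_rhs.
  - by move=> x _; apply: integral_ge0 => w _; apply nP.
have Bpos x : (box T M `\` N0) x -> (0 < x.1)%R.
  move=> [/in_box[/andP[x0 _] y0]] xN; rewrite lt_neqAle x0 andbT eq_sym.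
  apply/eqP => x10; apply: xN; split; rewrite /= in_itv/=; last by [].
  by rewrite x10 lexx.
have := mecke_pos mB0 (bnd_sub (@subDsetl _ _ _) (bnd_box T M)) Bpos nP.
move=> <-; apply: eq_integral => w _; rewrite /pts.
congr (\sum_(x <- sort _ (finmap.enum_fset (fset_set _))) _).
apply/seteqP; split=> x [wx Bx]; split=> //; last by case: Bx.
split=> // -[/=]; rewrite in_itv/= => /andP[_ x0] _.
by have [_ _ /(_ _ wx)] := configP w; rewrite ltNge x0.
Qed.

End mecke_theorem.

(** * Measurability of functions of finite sequences and the multivariate formula *)

Section measurable_seq_functions.
Context {R : realType}.
Local Notation X := (R * R)%type.

(* Measurability of a function of sequences, for all lengths at once: it is
   tested along sequences of measurable maps, which avoids casts between tuple
   types. *)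
Definition mseq d (Z : measurableType d) d' (U : measurableType d')
    (phi : Z -> seq X -> U) :=
  forall d1 (Z1 : measurableType d1) (g : Z1 -> Z) (s : seq (Z1 -> X)),
  measurable_fun setT g -> mfuns s ->
  measurable_fun setT (fun z => phi (g z) (ev s z)).

Lemma ev_comp (Z Z1 : Type) (g : Z1 -> Z) (s : seq (Z -> X)) z :
  ev [seq x \o g | x <- s] z = ev s (g z).
Proof. by rewrite /ev -map_comp. Qed.

Lemma mfuns_comp d (Z : measurableType d) d1 (Z1 : measurableType d1)
    (g : Z1 -> Z) (s : seq (Z -> X)) :
  measurable_fun setT g -> mfuns s -> mfuns [seq x \o g | x <- s].
Proof.
move=> mg; elim: s => [|x s IH] ms // y [<-|ys].
  by apply: measurableT_comp => //; apply: ms; left.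
by apply: IH ys => u us; apply: ms; right.
Qed.

Lemma mfuns_cons d (Z : measurableType d) (x : Z -> X) (s : seq (Z -> X)) :
  measurable_fun setT x -> mfuns s -> mfuns (x :: s).
Proof. by move=> mx ms y [<-//|]; exact: ms. Qed.

Lemma mfuns_nil d (Z : measurableType d) : mfuns ([::] : seq (Z -> X)).
Proof. by []. Qed.

Lemma mseq_cons d (Z : measurableType d) d' (U : measurableType d')
    (phi : Z -> seq X -> U) :
  mseq phi -> mseq (fun (p : Z * X) s => phi p.1 (p.2 :: s)).
Proof.
move=> mphi d1 Z1 g s mg ms.
have := mphi _ Z1 (fst \o g) ((snd \o g) :: s).
apply; first exact: (measurableT_comp measurable_fst mg).
by apply: mfuns_cons => //; exact: (measurableT_comp measurable_snd mg).
Qed.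

Lemma mseq_comp d (Z : measurableType d) d2 (Z2 : measurableType d2)
    d' (U : measurableType d') (phi : Z -> seq X -> U) (h : Z2 -> Z) :
  measurable_fun setT h -> mseq phi -> mseq (fun z s => phi (h z) s).
Proof.
move=> mh mphi d1 Z1 g s mg ms.
exact: (mphi _ Z1 (h \o g) s (measurableT_comp mh mg) ms).
Qed.

Lemma mseq_tuple d (Z : measurableType d) d' (U : measurableType d')
    (phi : Z -> seq X -> U) k : mseq phi ->
  measurable_fun [set: Z * k.-tuple X] (fun p => phi p.1 p.2).
Proof.
move=> mphi.
pose s : seq (Z * k.-tuple X -> X) := [seq (fun p => tnth p.2 i) | i <- enum 'I_k].
have es p : ev s p = p.2 by rewrite /ev /s -map_comp map_tnth_enum.
under eq_fun do rewrite -es.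
apply: (mphi _ _ fst s); first exact: measurable_fst.
rewrite /s; elim: (enum 'I_k) => [//|i e IH] /=.
apply: mfuns_cons => //.
exact: (measurableT_comp (measurable_tnth i) measurable_snd).
Qed.

Lemma measurable_notin d (Z : measurableType d) (x : Z -> X) (p : seq (Z -> X)) :
  measurable_fun setT x -> mfuns p ->
  measurable_fun setT (fun z => x z \notin ev p z).
Proof.
move=> mx; elim: p => [|y p IH] mp /=; first exact: measurable_cst.
under eq_fun do rewrite in_cons negb_or.
apply: measurable_and.
  by apply/measurable_neg/measurable_eq_point => //; apply: mp; left.
by apply: IH => u up; apply: mp; right.
Qed.

Lemma injsum_ge0 k (e : seq X) (phi : seq X -> \bar R) :
  (forall s, 0 <= phi s)%E -> (0 <= injsum k e phi)%E.
Proof.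
elim: k e phi => [//|k IH] e phi H /=; first exact: H.
by apply: sume_ge0 => x _; exact: IH.
Qed.

(** The induction on k needs two generalisations: [p] holds the points already chosen, which later
    sums avoid, and the parameter space grows from [Z] to [Z * X] because a chosen point becomes a
    parameter. *)
Lemma measurable_injsum k (B : set X) d (Z : measurableType d) (W : Z -> @cfg R)
    (p : seq (Z -> X)) (phi : Z -> seq X -> \bar R) :
  measurable B -> bnd B -> measurable_fun setT W -> mfuns p -> mseq phi ->
  (forall z s, 0 <= phi z s)%E ->
  measurable_fun setT
    (fun z => injsum k [seq y <- pts B (W z) | y \notin ev p z] (phi z)).
Proof.
move=> mB bB; elim: k d Z W p phi => [|k IH] d Z W p phi mW mp mphi phi0 /=.
  exact: (mphi _ Z id [::] (@measurable_id _ _ _) (@mfuns_nil _ _)).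
pose f z x := if x \notin ev p z then
  injsum k [seq y <- pts B (W z) | y \notin x :: ev p z] (fun s => phi z (x :: s))
  else 0%E.
have -> : (fun z => \sum_(x <- [seq y <- pts B (W z) | y \notin ev p z])
    injsum k [seq y <- [seq y <- pts B (W z) | y \notin ev p z] | y != x]
      (fun s => phi z (x :: s))) = (fun z => \sum_(x <- pts B (W z)) f z x)%E.
  apply/funext => z; rewrite big_filter big_mkcond/=; apply: eq_bigr => x _.
  rewrite /f; case: ifP => // _; congr injsum; rewrite -filter_predI.
  by apply: eq_filter => y /=; rewrite in_cons negb_or.
apply: measurable_sum_pts => //.
  by move=> z x; rewrite /f; case: ifP => // _; apply: injsum_ge0.
rewrite /f.
have m1 : measurable_fun setT (fst : Z * X -> Z) by exact: measurable_fst.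
have m2 : measurable_fun setT (snd : Z * X -> X) by exact: measurable_snd.
apply: measurable_fun_ifT.
- under eq_fun do rewrite -ev_comp.
  apply: measurable_notin => //; exact: mfuns_comp.
- under eq_fun do rewrite -ev_comp.
  apply: (IH _ _ (W \o fst) (snd :: [seq y \o fst | y <- p])
    (fun q s => phi q.1 (q.2 :: s))) => //.
  + exact: (measurableT_comp mW).
  + by apply: mfuns_cons => //; exact: mfuns_comp.
  + exact: mseq_cons.
- exact: measurable_cst.
Qed.

Lemma measurable_injsum_pts k (B : set X) (phi : @cfg R -> seq X -> \bar R) :
  measurable B -> bnd B -> mseq phi -> (forall w s, 0 <= phi w s)%E ->
  measurable_fun setT (fun w : @cfg R => injsum k (pts B w) (phi w)).
Proof.
move=> mB bB mphi phi0.
have := measurable_injsum k mB bB (@measurable_id _ (@cfg R) setT)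
  (@mfuns_nil _ (@cfg R)) mphi phi0.
by congr (measurable_fun _ _); apply/funext => w; congr injsum; rewrite filter_predT.
Qed.

Lemma mfuns_cst d (Z : measurableType d) (s : seq X) : mfuns [seq (cst x : Z -> X) | x <- s].
Proof.
elim: s => [|x s IH]; first exact: mfuns_nil.
by apply: mfuns_cons => //; exact: measurable_cst.
Qed.

Lemma ev_cst (Z : Type) (s : seq X) (z : Z) : ev [seq (cst x : Z -> X) | x <- s] z = s.
Proof. by rewrite /ev -map_comp map_id_in. Qed.

End measurable_seq_functions.

Section multivariate_mecke.
Context {R : realType} (P : probability (config R) R).
Hypothesis poissonP : poisson_random_measure P.
Local Notation X := (R * R)%type.
Variables (T M : R).
Local Notation B := (box T M).
Local Open Scope ereal_scope.

Fixpoint itinte (k : nat) (psi : seq X -> \bar R) : \bar R :=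
  if k is k'.+1 then \int[dx R]_(x in B) itinte k' (fun s => psi (x :: s))
  else psi [::].

Lemma itinte_power k (psi : seq X -> \bar R) :
  lebesgue_power B (fun s : k.-tuple X => psi s) = itinte k psi.
Proof.
elim: k psi => [//|k IH] psi /=; apply: eq_integral => x _.
by rewrite -IH.
Qed.

Lemma filter_fresh (w : config R) x : fresh w x ->
  perm_eq [seq y <- pts B (add_points w [set x]) | y != x] (pts B w).
Proof.
move=> fw; have bB := bnd_box T M.
apply: uniq_perm; [by rewrite filter_uniq// uniq_pts|exact: uniq_pts|].
move=> y; rewrite mem_filter; apply/idP/idP.
  move=> /andP[yx /(mem_pts _ _ bB)[wy By]]; apply/(mem_pts _ _ bB); split=> //.
  have [H|H] := pselect (is_config ((w : set _) `|` [set x])).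
    by move: wy; rewrite atoms_add_points// => -[//|/= yx']; rewrite yx' eqxx in yx.
  by rewrite add_points_default in wy.
move=> /(mem_pts _ _ bB)[wy By]; apply/andP; split.
  by apply: contraNneq (fw _ wy) => ->.
apply/(mem_pts _ _ bB); split=> //.
have [H|H] := pselect (is_config ((w : set _) `|` [set x])).
  by rewrite atoms_add_points//; left.
by rewrite add_points_default.
Qed.

(** One application of [mecke] per point. After a fresh x is added, the atoms other than x are the
    original ones, so the induction hypothesis applies to the shifted integrand. The first chosen
    point is added last, hence [rev]. *)
Lemma multi_mecke k (phi : seq X -> @cfg R -> \bar R) :
  mseq (fun w s => phi s w) -> (forall s w, 0 <= phi s w) ->
  \int[P]_w injsum k (pts B w) (fun s => phi s w) =
  itinte k (fun s => \int[P]_w phi s (adds w (rev s))).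
Proof.
have bB := bnd_box T M; have mB := measurable_box T M.
elim: k phi => [//|k IH] phi mphi phi0.
pose Phi (p : X * @cfg R) := injsum k [seq y <- pts B p.2 | y != p.1]
  (fun s => phi (p.1 :: s) p.2).
have m1 : measurable_fun setT (fst : X * @cfg R -> X) by exact: measurable_fst.
have m2 : measurable_fun setT (snd : X * @cfg R -> @cfg R) by exact: measurable_snd.
have nPhi : nnmeas Phi.
  split=> [p|]; first exact: injsum_ge0.
  have := @measurable_injsum R k B _ (X * @cfg R)%type snd [:: fst]
    (fun p s => phi (p.1 :: s) p.2) mB bB m2 (mfuns_cons m1 (@mfuns_nil _ _ _)).
  have -> : (fun z : X * @cfg R => injsum k [seq y <- pts B z.2 | y \notin ev [:: fst] z]
     (fun s => phi (z.1 :: s) z.2)) = Phi.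
    apply/funext => z; congr injsum; apply: eq_filter => y.
    by rewrite /ev/= inE.
  apply=> //.
  have := mseq_cons mphi => /(mseq_comp (h := fun p : X * @cfg R => (p.2, p.1))).
  by apply; exact: measurable_fun_pair.
rewrite /= -[LHS]/(\int[P]_w \sum_(x <- pts B w) Phi (x, w)) mecke//.
apply: eq_integral => x _; rewrite /Phi/=.
pose phi' (s : seq X) (w : @cfg R) := phi (x :: s) (add_points w [set x]).
have mphi' : mseq (fun w s => phi' s w).
  move=> d1 Z1 g s mg ms.
  have := mphi _ Z1 (fun z => add_points (g z) [set x]) (cst x :: s).
  apply; first by apply: measurable_addp => //; exact: measurable_cst.
  by apply: mfuns_cons => //; exact: measurable_cst.
transitivity (\int[P]_w injsum k (pts B w) (fun s => phi' s w)); last first.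
  have phi'0 s w : 0 <= phi' s w by exact: phi0.
  rewrite (IH phi' mphi' phi'0); congr itinte; apply/funext => s.
  by apply: eq_integral => w _; rewrite rev_cons /adds foldl_rcons.
have mTR : measurable_fun setT (fun w : @cfg R => injsum k (pts B w) (fun s => phi' s w)).
  apply: (measurable_injsum_pts k (phi := fun w s => phi' s w)) => // w s; exact: phi0.
apply: ge0_ae_eq_integral => //.
- have := measurable_shift poissonP nPhi.
  move=> /measurableT_comp /(_ (measurable_pair1 x)).
  by apply.
- exact: (measurable_vague poissonP mTR).
- by move=> w _; apply: injsum_ge0 => s; exact: phi0.
- by move=> w _; apply: injsum_ge0 => s; exact: phi0.
have [N [mN N0 sN]] := ae_fresh poissonP x; exists N; split=> //.
apply: subset_trans sN => w /= H fw; apply: H => _.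
by apply: injsum_perm; exact: filter_fresh.
Qed.

End multivariate_mecke.

(** * Predictability and the good event *)

Section filtration.
Context {R : realType}.
Local Notation X := (R * R)%type.
Implicit Types (A D : set X) (w : config R).

Lemma measurable_point (x : X) : measurable [set x].
Proof.
have -> : [set x] = `[x.1, x.1] `*` `[x.2, x.2].
  by rewrite !set_itv1; apply/seteqP; split=> [y ->|[y1 y2] [/= -> ->]]//; case: x.
by apply: measurableX; exact: measurable_itv.
Qed.

Lemma measurable_finite A : finite_set A -> measurable A.
Proof.
move=> fA.
have -> : A = \bigcup_(x in A) [set x].
  by apply/seteqP; split=> [x Ax|x [y Ay ->]//]; exists x.
by apply: fin_bigcup_measurable => // x _; exact: measurable_point.
Qed.

Lemma bigcup_bigbox : \bigcup_n box n%:R n%:R = (XX : set X).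
Proof.
apply/seteqP; split=> [x [n _]|x /in_bigbox[n xn]]; last by exists n.
exact: (bnd_XX (bnd_bigbox n)).
Qed.

Lemma box_nd : nondecreasing_seq (fun n => box n%:R n%:R : set X).
Proof.
move=> n m nm; apply/subsetPset => x /in_box[/andP[x0 xT] /andP[y0 yM]].
have h : n%:R <= m%:R :> R by rewrite ler_nat.
by apply/in_box; rewrite x0 y0 (le_trans xT)// (le_trans yM).
Qed.

Lemma N_lim A w : A `<=` XX ->
  (fun n => (cnt (A `&` box n%:R n%:R) w)%:R%:E) @ \oo --> N A w.
Proof.
move=> AX; pose F n := (w : set X) `&` (A `&` box n%:R n%:R).
have fF n : finite_set (F n).
  apply: finite_config; apply: (bnd_sub (@subIsetr _ _ _)).
  exact: bnd_bigbox.
have E1 : \bigcup_n F n = (w : set X) `&` A.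
  rewrite /F -setI_bigcupr -setI_bigcupr bigcup_bigbox.
  by rewrite (setIidl AX).
rewrite /N -E1.
have -> : (fun n => (cnt (A `&` box n%:R n%:R) w)%:R%:E) = (@counting _ R) \o F.
  apply/funext => n; rewrite -N_cnt//.
  by apply: (bnd_sub (@subIsetr _ _ _)); exact: bnd_bigbox.
apply: (@nondecreasing_cvg_mu _ X R counting).
- by move=> n; exact: measurable_finite.
- by apply: bigcupT_measurable => n; exact: measurable_finite.
- move=> n m nm; apply/subsetPset => x [wx [Ax xn]]; split=> //; split=> //.
  by move: xn; apply/subsetPset/box_nd.
Qed.

Lemma measurable_N A : measurable A -> A `<=` XX ->
  measurable_fun setT (N A : @cfg R -> \bar R).
Proof.
move=> mA AX; apply: (emeasurable_fun_cvg
  (fun n (w : @cfg R) => (cnt (A `&` box n%:R n%:R) w)%:R%:E)); last first.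
  by move=> w _; exact: N_lim.
move=> n; apply: (measurable_cnt (fun k => k%:R%:E)).
  by apply: measurableI => //; exact: measurable_box.
by apply: (bnd_sub (@subIsetr _ _ _)); exact: bnd_bigbox.
Qed.

Lemma sigma_of_cfg (C : set (config R -> \bar R)) :
  (forall f, C f -> measurable_fun setT (f : @cfg R -> \bar R)) ->
  sigma_of C `<=` (measurable : set (set (@cfg R))).
Proof.
move=> H; apply: smallest_sub; first exact: sigma_algebra_measurable.
move=> _ [f Cf [Y mY <-]]; exact: H.
Qed.

Lemma FN_cfg t : FN t `<=` (measurable : set (set (@cfg R))).
Proof.
apply: sigma_of_cfg => f [S [D [mS St mD Dp ->]]].
apply: measurable_N; first exact: measurableX.
move=> x [/= /St + /Dp]; rewrite /= !in_itv/= => /andP[x0 _]; rewrite andbT => x20.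
by split; rewrite /= in_itv/= andbT.
Qed.

Lemma FNTM_cfg (T M : R) : FNTM T M `<=` (measurable : set (set (@cfg R))).
Proof.
apply: sigma_of_cfg => f [A mA <-]; apply: measurable_N.
  by apply: measurableI => //; exact: measurable_box.
by apply: bnd_XX; apply: (bnd_sub (@subIsetr _ _ _)); exact: bnd_box.
Qed.

(** Turns the sigma-algebra [FN_inf] into a measurable type, so that general measurability results
    apply to it. *)
Let TF := g_sigma_algebraType (@FN_inf R).

Let TFE (E : set (config R)) : measurable (E : set TF) <-> FN_inf E.
Proof.
split; last exact: sub_sigma_algebra.
by apply: smallest_sub => //; exact: smallest_sigma_algebra.
Qed.

Let cntF n D (w : TF) : \bar R := (cnt (box n%:R n%:R `&` D) w)%:R%:E.

(** For rectangles the count generates part of the filtration; a lambda-system argument extends this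
    to all measurable D. Inside a fixed box counts are finite and can be subtracted for
    differences. *)
Let measurable_cntF n D : measurable D -> measurable_fun setT (cntF n D).
Proof.
pose H := [set D | measurable D /\ measurable_fun setT (cntF n D)].
suff : measurable `<=` H by move=> /[apply] -[].
have K1 : bnd (box n%:R n%:R : set X) by exact: bnd_bigbox.
have have mK : measurable (box n%:R n%:R : set X) by exact: measurable_box.
have Hrect (S D' : set R) : measurable S -> measurable D' -> H (S `*` D').
  move=> mS mD'; split; first exact: measurableX.
  have -> : cntF n (S `*` D') = N ((S `&` `[0, n%:R]) `*` (D' `&` `[0, n%:R])).
    apply/funext => w; rewrite /cntF -N_cnt; last first.
      by apply: (bnd_sub (@subIsetl _ _ _)).
    by rewrite /box -setXI ![`[0, _] `&` _]setIC.
  move=> _ Y mY; rewrite setTI; apply/TFE; apply: sub_sigma_algebra.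
  exists n%:R; first by rewrite /= in_itv/= andbT.
  apply: sub_sigma_algebra.
  exists (N ((S `&` `[0, n%:R]) `*` (D' `&` `[0, n%:R]))); last first.
    by exists Y => //; rewrite setTI.
  exists (S `&` `[0, n%:R]), (D' `&` `[0, n%:R]); split=> //.
  * by apply: measurableI => //; exact: measurable_itv.
  * by apply: measurableI => //; exact: measurable_itv.
  * by move=> x [_]; rewrite /= !in_itv/= => /andP[-> _].
rewrite measurable_prod_measurableType; apply: lambda_system_subset => //.
- move=> _ _ [A mA [A' mA' <-]] [C mC [C' mC' <-]].
  exists (A `&` C); first exact: measurableI.
  by exists (A' `&` C'); [exact: measurableI|rewrite setXI].
- split => //.
  + by rewrite -setXTT; exact: Hrect.
  + move=> A C CA [mA fA] [mC fC]; split; first exact: measurableD.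
    have -> : cntF n (A `\` C) = (fun w => cntF n A w - cntF n C w)%E.
      apply/funext => w; rewrite /cntF.
      rewrite -!(@cntmE R _ (@cfg R) _ K1 id w)//; last exact: measurableD.
      rewrite measureD//; last by rewrite [X in (X < _)%E]cntmE// ltry.
      by rewrite setIidr.
    exact: emeasurable_funB.
  + move=> F ndF HF; split.
      by apply: bigcupT_measurable => k; have [] := HF k.
    apply: (emeasurable_fun_cvg (fun k => cntF n (F k))).
      by move=> k; have [] := HF k.
    move=> w _; rewrite /cntF.
    rewrite -(@cntmE R _ (@cfg R) _ K1 id w)//; last first.
      by apply: bigcupT_measurable => k; have [] := HF k.
    have -> : (fun k => (cnt (box n%:R n%:R `&` F k) w)%:R%:E) =
        cntm (box n%:R n%:R) id (w : @cfg R) \o F.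
      by apply/funext => k; rewrite /= cntmE//; have [] := HF k.
    apply: nondecreasing_cvg_mu => //.
      by move=> k; have [] := HF k.
    by apply: bigcupT_measurable => k; have [] := HF k.
- by move=> _ [S mS [D' mD' <-]]; exact: Hrect.
Qed.

(** Events expressed through counts are known to the filtration; this yields the measurability that
    [L2] demands of H_T. *)
Lemma cfg_FN_inf : (measurable : set (set (@cfg R))) `<=` @FN_inf R.
Proof.
apply: smallest_sub; first exact: smallest_sigma_algebra.
move=> _ [I [D [b [mD ->]]]]; apply/TFE.
have -> : cyl D b = \bigcap_(i in [set` I]) [set w | cnt (D i) w = b i].
  by apply/seteqP; split=> w Hw i; [move=> _|]; exact: Hw.
apply: fin_bigcap_measurable; first exact: finite_finset.
move=> i _; have [mi [n Dn]] := mD i.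
have := measurable_cntF n mi measurableT (emeasurable_set1 (b i)%:R%:E).
rewrite setTI; congr (measurable _); apply/seteqP; split=> w; rewrite /cntF/= setIidr//.
  by move=> -[/eqP]; rewrite eqr_nat => /eqP.
by move=> ->.
Qed.

End filtration.

Section predictable.
Context {R : realType}.
Local Notation X := (R * R)%type.
Implicit Types (w : config R).

Lemma predictable_sets_measurable :
  @predictable_sets R `<=` (measurable : set (set (R * @cfg R))).
Proof.
have mT : measurable (time_domain : set (R * @cfg R)).
  by apply: measurableX => //; exact: measurable_itv.
apply: smallest_sub.
  split.
  - exact: measurable0.
  - by move=> D mD; exact: measurableD.
  - by move=> F HF; exact: bigcupT_measurable.
move=> D [[A AF <-]|[s [t [A [s0 st As ->]]]]].
  apply: measurableX; first by rewrite -set_itv1; exact: measurable_itv.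
  exact: FN_cfg AF.
apply: measurableX; first exact: measurable_itv.
exact: FN_cfg As.
Qed.

Definition agree_before (t : R) w w' :=
  forall x, x.1 < t -> (w : set _) x <-> (w' : set _) x.

Lemma FN_agree (s : R) (E : set (config R)) w w' : FN s E ->
  (forall x, x.1 <= s -> (w : set _) x <-> (w' : set _) x) -> E w <-> E w'.
Proof.
move=> + ww'; move: E.
suff : FN s `<=` [set E : set (config R) | E w <-> E w'] by [].
apply: smallest_sub.
  split.
  - by split.
  - by move=> E Eww; split=> -[? h]; split=> // /Eww.
  - by move=> F HF; split=> -[n _ /HF Fn]; exists n.
move=> _ [f [S [D [mS Ss mD _ ->]]] [Y mY <-]] /=.
have NN : N (S `*` D) w = N (S `*` D) w'.
  rewrite /N; congr counting; apply/seteqP; split=> x [wx [xS xD]]; split=> //.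
    by apply/ww' => //; have := Ss _ xS; rewrite /= in_itv/= => /andP[].
  by apply/ww' => //; have := Ss _ xS; rewrite /= in_itv/= => /andP[].
by split=> -[_ h]; split=> //; move: h; rewrite /= NN.
Qed.

(** An event of [FN s] sees the atoms up to s and enters a generator only at times t > s, so
    strictly earlier atoms decide. At time 0 there is nothing to see, all atoms having positive
    times. *)
Lemma predictable_sets_agree (D : set (R * config R)) t w w' :
  predictable_sets D -> agree_before t w w' -> D (t, w) <-> D (t, w').
Proof.
move=> + ww'; move: D.
suff : predictable_sets `<=` [set D : set (R * config R) | D (t, w) <-> D (t, w')] by [].
apply: smallest_sub.
  split.
  - by split.
  - by move=> E Eww; split=> -[h1 h]; (split; first by case: h1) => /Eww.
  - by move=> F HF; split=> -[n _ /HF Fn]; exists n.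
move=> D [[A AF <-]|[s [u [A [s0 su As ->]]]]].
  have H : A w <-> A w'.
    apply: FN_agree AF _ => x x0.
    have wX v : (v : config R) `<=` [set x | 0 < x.1] by have [_ _ h _] := configP v.
    by split=> /wX /=; rewrite ltNge x0.
  by split=> -[/= -> h]; split=> //; apply/H.
split=> -[/= tsu h]; split=> //.
  apply/(FN_agree As) => [x xs|]; last exact: h.
  by apply: iff_sym; apply: ww'; move: tsu; rewrite in_itv/= => /andP[st _]; exact: le_lt_trans xs st.
apply/(FN_agree As) => [x xs|]; last exact: h.
by apply: ww'; move: tsu; rewrite in_itv/= => /andP[st _]; exact: le_lt_trans xs st.
Qed.

Variable lambda : R -> config R -> R.
Hypothesis lambda_pred : predictable lambda.

(** The level set of [lambda] at its value [lambda t w'] is predictable, hence cannot separate [w]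
    from [w'] at time t. *)
Lemma predictable_agree t w w' : 0 <= t -> agree_before t w w' ->
  lambda t w = lambda t w'.
Proof.
move=> t0 ww'.
have [_] := predictable_sets_agree (lambda_pred (measurable_set1 (lambda t w'))) ww'.
case=> //; split; last by [].
by split; rewrite //= in_itv/= t0.
Qed.

(** Predictability constrains [lambda] at nonnegative times only; the guard makes [below] measurable
    on the whole plane. *)
Definition below (x : X) w := (0 <= x.1) && (x.2 <= lambda x.1 w).

Lemma measurable_below d (Z : measurableType d) (x : Z -> X) (W : Z -> @cfg R) :
  measurable_fun setT x -> measurable_fun setT W ->
  measurable_fun setT (fun z => below (x z) (W z)).
Proof.
move=> mx mW.
have mT : measurable (time_domain : set (R * @cfg R)).
  by apply: measurableX => //; exact: measurable_itv.
pose l (p : R * @cfg R) := if 0 <= p.1 then lambda p.1 p.2 else 0.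
have m1 : measurable_fun setT (fst : R * @cfg R -> R) by exact: measurable_fst.
have mb : measurable_fun setT (fun p : R * @cfg R => 0 <= p.1).
  by apply: measurable_fun_ler => //; exact: measurable_cst.
have ml : measurable_fun setT l.
  apply: measurable_fun_if => //.
  rewrite setTI (_ : _ @^-1` _ = time_domain); last first.
    by apply/seteqP; split=> -[t w]; rewrite /time_domain/= in_itv/= andbT; [split|case].
  move=> _ Y mY; apply: predictable_sets_measurable; exact: lambda_pred.
have mx1 : measurable_fun setT (fun z => (x z).1) by exact: (measurableT_comp measurable_fst).
have -> : (fun z => below (x z) (W z)) =
   (fun z => (0 <= (x z).1) && ((x z).2 <= l ((x z).1, W z))).
  by apply/funext => z; rewrite /below /l/=; case: ifP.
apply: measurable_and.
  by apply: measurable_fun_ler => //; exact: measurable_cst.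
apply: measurable_fun_ler; first exact: (measurableT_comp measurable_snd).
apply: (measurableT_comp ml); exact: measurable_fun_pair.
Qed.

Definition slab (T : R) n : set X := `]0, T] `*` `[0, n%:R].

Lemma measurable_slab T n : measurable (slab T n).
Proof. by apply: measurableX; exact: measurable_itv. Qed.

Lemma bnd_slab T n : bnd (slab T n).
Proof.
apply: bnd_sub (bnd_box T n%:R) => x [/=]; rewrite !in_itv/= => /andP[x0 xT] h.
by split; rewrite /= in_itv//= xT ltW.
Qed.

Lemma esum_pts (A : set X) w (f : X -> \bar R) : bnd A ->
  (forall x, (0 <= f x)%E) ->
  (\esum_(x in (w : set _) `&` A) f x = \sum_(x <- pts A w) f x)%E.
Proof.
move=> bA f0; rewrite esum_fset//; last exact: finite_config.
rewrite fsbig_finite/=; last exact: finite_config.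
by apply: perm_big; rewrite perm_sym perm_sort.
Qed.

(** The defining sum over an unbounded strip is a supremum over finite sets of atoms, each contained
    in some slab. The finite sums over slabs therefore increase to it, which gives the measurability
    of H_T. *)
Lemma counting_process_lim T w :
  (fun n => \sum_(x <- pts (slab T n) w) ((below x w)%:R : R)%:E)%E @ \oo -->
  intN (`]0, T] `*` `[0, +oo[)
    (fun x => (\1_[set y : X | y.2 <= lambda y.1 w] x)%:E) w.
Proof.
pose f (x : X) : \bar R := (\1_[set y : X | y.2 <= lambda y.1 w] x)%:E; rewrite -/f.
set A := `]0, T] `*` _.
have f0 x : (0 <= f x)%E by rewrite lee_fin.
have sA n : slab T n `<=` A.
  by move=> x [x1]; rewrite /= !in_itv/= => /andP[x2 _]; split; rewrite //= in_itv/= andbT.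
have E n : (\sum_(x <- pts (slab T n) w) ((below x w)%:R : R)%:E =
    \esum_(x in (w : set _) `&` slab T n) f x)%E.
  rewrite esum_pts//; last exact: bnd_slab.
  rewrite big_seq [RHS]big_seq; apply: eq_bigr => x.
  move=> /(mem_pts _ _ (bnd_slab T n))[_ [/=]]; rewrite in_itv/= => /andP[x0 _] _.
  rewrite /f indicE /below ltW//=; congr (_%:R%:E); congr nat_of_bool.
  by apply/idP/idP; rewrite inE.
have esub (S S' : set X) : S `<=` S' -> (\esum_(x in S) f x <= \esum_(x in S') f x)%E.
  by move=> SS'; apply: le_ereal_sup => _ [F [fF FS] <-]; exists F => //; split=> // x /FS /SS'.
have nd : nondecreasing_seq (fun n => \sum_(x <- pts (slab T n) w) ((below x w)%:R : R)%:E)%E.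
  move=> n m nm; rewrite !E; apply: esub => x [wx [x1 x2]]; split=> //; split=> //.
  move: x2; rewrite /= !in_itv/= => /andP[-> h]; rewrite (le_trans h)// ler_nat//.
have -> : intN A f w = ereal_sup (range (fun n => \sum_(x <- pts (slab T n) w) ((below x w)%:R : R)%:E)%E).
  apply/eqP; rewrite eq_le; apply/andP; split.
    apply: ub_ereal_sup => _ [F [fF FA] <-].
    have [n Fn] : exists n, F `<=` slab T n.
      move: (fF) => /finite_seqP[s sF].
      exists (\max_(x <- s) (Num.trunc x.2).+1)%N => x Fx; have [wx [x1]] := FA _ Fx.
      rewrite /= in_itv/= andbT => x2; split=> //; rewrite /= in_itv/= x2/=.
      apply: (@le_trans _ _ (Num.trunc x.2).+1%:R); first by apply/ltW/truncnS_gt.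
      rewrite ler_nat; apply: (@leq_bigmax_seq _ s xpredT (fun x => (Num.trunc x.2).+1)) => //.
      by move: Fx; rewrite sF.
    apply: (@le_trans _ _ (\esum_(x in (w : set _) `&` slab T n) f x)%E).
      apply: ereal_sup_ubound; exists F => //; split=> // x Fx; split; last exact: Fn.
      by have [] := FA _ Fx.
    by rewrite -E; apply: ereal_sup_ubound; exists n.
  apply: ub_ereal_sup => _ [n _ <-]; rewrite E; apply: esub; apply: setIS; exact: sA.
exact: ereal_nondecreasing_cvgn.
Qed.

End predictable.

(** Index sets are split according to whether they contain [ord0], the rest being lifted from one
    index less. With [ord0] the sign is unchanged, without it the sign flips: this is the recursion
    of [mobius]. *)
Lemma malliavinE {R : realType} (xs : seq (R * R)) (F : config R -> R) w :
  malliavin xs F w = mobius xs (fun s => F (add_points w [set` s])).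
Proof.
rewrite /malliavin; pose G A := F (add_points w A).
rewrite -[LHS]/(\sum_(J : {set 'I_(size xs)}) (-1) ^+ (size xs - #|J|) *
    G [set nth (0, 0) xs i | i in [set` J]]).
rewrite -[RHS]/(mobius xs (fun s => G [set` s])).
elim: xs G => [|x xs IH] G /=.
  rewrite (bigD1 finset.set0)//= big1 ?addr0; last first.
    by move=> J /eqP; case; apply/setP => -[].
  rewrite cards0 subnn expr0 mul1r; congr G.
  by apply/seteqP; split=> y //= -[[]].
pose lf (J : {set 'I_(size xs)}) := [set lift ord0 i | i in J]%SET.
have lfP J i : (lift ord0 i \in lf J) = (i \in J).
  by apply/imsetP/idP => [[j jJ /lift_inj ->//]|iJ]; exists i.
have lf0 J : (ord0 \in lf J) = false.
  by apply/negbTE/imsetP => -[j _] /eqP; rewrite (negbTE (neq_lift _ _)).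
have lfset J : [set nth (0, 0) (x :: xs) i | i in [set` lf J]] =
     [set nth (0, 0) xs i | i in [set` J]].
  apply/seteqP; split=> y /=.
    by move=> [i /imsetP[j jJ ->] <-]; exists j => //=; rewrite add1n.
  by move=> [i iJ <-]; exists (lift ord0 i); rewrite /= ?lfP// add1n.
have lfset1 J : [set nth (0, 0) (x :: xs) i | i in [set` (ord0 |: lf J)%SET]] =
     [set x] `|` [set nth (0, 0) xs i | i in [set` J]].
  rewrite -lfset; apply/seteqP; split=> y /=.
    move=> [i]; rewrite finset.in_setU1 => /predU1P[-> <-|iJ <-]; first by left.
    by right; exists i.
  move=> [->|[i iJ <-]]; first by exists ord0 => //; rewrite finset.in_setU1 eqxx.
  by exists i => //; rewrite finset.in_setU1 iJ orbT.
rewrite (bigID (fun J : {set 'I_(size xs).+1} => ord0 \in J))/=.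
rewrite (reindex_onto (fun J : {set 'I_(size xs)} => ord0 |: lf J)%SET
  (fun J => [set i | lift ord0 i \in J]%SET))/=; last first.
  move=> J J0; apply/setP => i; rewrite finset.in_setU1.
  have [<-|/unlift_some[j -> _]] := eqVneq ord0 i; first by rewrite J0.
  by rewrite lfP finset.in_set.
rewrite [X in _ + X](reindex_onto lf
  (fun J => [set i | lift ord0 i \in J]%SET))/=; last first.
  move=> J J0; apply/setP => i.
  have [<-|/unlift_some[j -> _]] := eqVneq ord0 i; first by rewrite lf0 (negbTE J0).
  by rewrite lfP finset.in_set.
congr (_ + _).
  rewrite [RHS](mobius_ext (psi := fun t => G ([set x] `|` [set` t]))); last first.
    by move=> t _; rewrite set_cons.
  rewrite -(IH (fun A => G ([set x] `|` A))).
  rewrite (eq_bigl xpredT); last first.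
    move=> J; rewrite finset.in_setU1 eqxx/=; apply/eqP/setP => i.
    by rewrite finset.in_set finset.in_setU1 lfP.
  apply: eq_bigr => J _; rewrite lfset1; congr (_ ^+ _ * _).
  by rewrite cardsU1 lf0/= card_imset//; exact: lift_inj.
rewrite -IH -sumrN (eq_bigl xpredT); last first.
  move=> J; rewrite lf0/=; apply/eqP/setP => i.
  by rewrite finset.in_set lfP.
apply: eq_bigr => J _; rewrite lfset card_imset; last exact: lift_inj.
rewrite subSn ?exprS ?mulN1r ?mulNr//.
by rewrite -[X in (_ <= X)%N]card_ord max_card.
Qed.

Section parametrized_measurability.
Context {R : realType}.
Local Notation X := (R * R)%type.

Lemma measurable_param_Rintegral d d' (Z : measurableType d)
    (Y : measurableType d') (mu : {sigma_finite_measure set Y -> \bar R})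
    (D : set Y) (f : Z -> Y -> R) : measurable D ->
  measurable_fun [set: Z * Y] (fun p => f p.1 p.2) ->
  measurable_fun setT (fun z => \int[mu]_(y in D) f z y).
Proof.
move=> mD mf.
pose h (p : Z * Y) : \bar R := (f p.1 p.2 * \1_D p.2)%:E.
have mh : measurable_fun setT h.
  apply/measurable_EFinP; apply: measurable_funM => //.
  apply: (measurableT_comp (measurable_indic mD)); exact: measurable_snd.
have -> : (fun z => \int[mu]_(y in D) f z y) = (fun z => fine
    (fubini_F mu (h^\+)%E z - fubini_F mu (h^\-)%E z)%E).
  apply/funext => z; rewrite /Rintegral integral_mkcond.
  rewrite integralE /fubini_F; congr fine; congr (_ - _)%E;
    apply: eq_integral => y _; rewrite ?funeposE ?funenegE /h/= patchE indicE;
    by case: ifP => _; rewrite ?mulr1 ?mulr0.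
apply: (measurableT_comp (fine_measurable measurableT)).
apply: emeasurable_funB.
  apply: measurable_fun_fubini_tonelli_F; first exact: measurable_funepos.
  by move=> p; exact: funepos_ge0.
apply: measurable_fun_fubini_tonelli_F; first exact: measurable_funeneg.
by move=> p; exact: funeneg_ge0.
Qed.

Lemma mseq_consx d (Z : measurableType d) d' (U : measurableType d')
    (phi : Z -> seq X -> U) (x : Z -> X) : measurable_fun setT x ->
  mseq phi -> mseq (fun z s => phi z (x z :: s)).
Proof.
move=> mx mphi.
have := mseq_cons mphi => /(mseq_comp (h := fun z => (z, x z))); apply.
exact: measurable_fun_pair.
Qed.

Lemma mseq_ev d (Z : measurableType d) d' (U : measurableType d')
    (phi : Z -> seq X -> U) s : mseq phi -> mfuns s ->
  measurable_fun setT (fun z => phi z (ev s z)).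
Proof. by move=> mphi; apply: mphi; exact: measurable_id. Qed.

Lemma measurable_mobius d (Z : measurableType d) (phi : Z -> seq X -> R)
    (s : seq (Z -> X)) : mseq phi -> mfuns s ->
  measurable_fun setT (fun z => mobius (ev s z) (phi z)).
Proof.
elim: s phi => [|x s IH] phi mphi ms /=.
  exact: (mseq_ev (s := [::]) mphi).
have mx : measurable_fun setT x by apply: ms; left.
have ms' : mfuns s by move=> y ys; apply: ms; right.
apply: measurable_funB; last exact: IH.
by apply: IH => //; exact: mseq_consx.
Qed.

(* Insertion sort has a structural recursion along which measurability
   propagates. *)
Fixpoint ins (x : X) (s : seq X) : seq X :=
  if s is y :: s' then if time_le x y then x :: s else y :: ins x s'
  else [:: x].

Fixpoint isort (s : seq X) : seq X :=
  if s is x :: s' then ins x (isort s') else [::].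

Lemma perm_ins x s : perm_eq (ins x s) (x :: s).
Proof.
elim: s => [//|y s IH] /=; case: ifP => // _.
rewrite -cat1s -[x :: _]cat1s; apply: (@perm_trans _ ([:: y] ++ x :: s)).
  by rewrite perm_cat2l.
by rewrite -(cat1s x s) perm_catCA.
Qed.

Lemma isortE s : isort s = sort (@time_le R) s.
Proof.
apply: (sorted_eq (@time_le_trans R) (@time_le_anti R)).
- elim: s => [//|x s IH] /=; move: (isort s) IH => {s}; elim=> [//|y s IH] /=.
  case: ifP => [xy ys|/negbT xy ys]; first by rewrite /= xy.
  have yx : time_le y x by case/orP: (time_le_total x y) => // h; rewrite h in xy.
  case: s ys IH => [_ _|z s /= /andP[yz zs] IH] /=; first by rewrite yx.
  by have := IH zs; case: ifP => _ /=; rewrite ?yx ?yz.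
- exact/sort_sorted/time_le_total.
- rewrite perm_sym perm_sort perm_sym.
  elim: s => [//|x s IH] /=; apply: (perm_trans (perm_ins _ _)).
  by rewrite perm_cons.
Qed.

Lemma measurable_time_le d (Z : measurableType d) (x y : Z -> X) :
  measurable_fun setT x -> measurable_fun setT y ->
  measurable_fun setT (fun z => time_le (x z) (y z)).
Proof.
move=> mx my; have m1 (u : Z -> X) : measurable_fun setT u -> measurable_fun setT (fun z => (u z).1).
  by move=> mu; exact: (measurableT_comp measurable_fst).
have m2 (u : Z -> X) : measurable_fun setT u -> measurable_fun setT (fun z => (u z).2).
  by move=> mu; exact: (measurableT_comp measurable_snd).
apply: measurable_or; first by apply: measurable_fun_ltr; exact: m1.
apply: measurable_and; first by apply: measurable_fun_eqr; exact: m1.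
by apply: measurable_fun_ler; exact: m2.
Qed.

Lemma measurable_ins d (Z : measurableType d) d' (U : measurableType d')
    (phi : Z -> seq X -> U) (x : Z -> X) (s : seq (Z -> X)) :
  mseq phi -> measurable_fun setT x -> mfuns s ->
  measurable_fun setT (fun z => phi z (ins (x z) (ev s z))).
Proof.
elim: s phi => [|y s IH] phi mphi mx ms /=.
  exact: (mseq_ev (s := [:: x]) mphi (mfuns_cons mx (@mfuns_nil _ _ _))).
have my : measurable_fun setT y by apply: ms; left.
have ms' : mfuns s by move=> u us; apply: ms; right.
have -> : (fun z => phi z (if time_le (x z) (y z) then [:: x z, y z & ev s z]
    else y z :: ins (x z) (ev s z))) =
  (fun z => if time_le (x z) (y z) then phi z (ev [:: x, y & s] z)
    else phi z (y z :: ins (x z) (ev s z))).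
  by apply/funext => z; case: ifP.
apply: measurable_fun_ifT; first exact: measurable_time_le.
  by apply: mseq_ev => //; apply: mfuns_cons.
by apply: (IH (fun z t => phi z (y z :: t))) => //; exact: mseq_consx.
Qed.

Lemma mseq_sort d (Z : measurableType d) d' (U : measurableType d')
    (phi : Z -> seq X -> U) :
  mseq phi -> mseq (fun z s => phi z (sort (@time_le R) s)).
Proof.
move=> mphi d1 Z1 g s mg.
have H : forall psi : Z1 -> seq X -> U, mseq psi -> mfuns s ->
    measurable_fun setT (fun z => psi z (isort (ev s z))).
  elim: s => [|x s IH] psi mpsi ms /=.
    exact: (mseq_ev (s := [::]) mpsi).
  have mx : measurable_fun setT x by apply: ms; left.
  have ms' : mfuns s by move=> u us; apply: ms; right.
  apply: (IH (fun z t => psi z (ins (x z) t))) => //.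
  move=> d2 Z2 h t mh mt.
  apply: (measurable_ins (phi := fun z => psi (h z)) (x := x \o h)) => //.
    exact: mseq_comp.
  exact: measurableT_comp.
move=> ms; under eq_fun do rewrite -isortE.
by apply: (H (fun z => phi (g z))) => //; exact: mseq_comp.
Qed.

End parametrized_measurability.

Section process_at_T.
Context {R : realType} (P : probability (config R) R).
Hypothesis poissonP : poisson_random_measure P.
Local Notation X := (R * R)%type.
Variables (T M : R).
Variable lambda : R -> config R -> R.
Hypothesis lambda_pred : predictable lambda.
Local Notation B := (box T M).
Implicit Types w : config R.

Lemma measurable_counting_process :
  measurable_fun setT (counting_process lambda T : @cfg R -> R).
Proof.
apply: (measurableT_comp (fine_measurable measurableT)).
apply: (emeasurable_fun_cvg (fun n (w : @cfg R) =>
  \sum_(x <- pts (slab T n) w) ((below lambda x w)%:R : R)%:E)%E); last first.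
  by move=> w _; exact: counting_process_lim.
move=> n; apply: (measurable_sum_pts (measurable_slab T n) (bnd_slab T n)
  (@measurable_id _ _ setT) (f := fun w x => ((below lambda x w)%:R : R)%:E)).
  by move=> w x; rewrite lee_fin.
apply: measurable_natbool; apply: measurable_below => //.
Qed.

(* The atoms counted by H_T lie in [0,T] x [0,M]. *)
Definition bounded_event : set (@cfg R) :=
  [set w : @cfg R | forall n, ~~ has (fun x => below lambda x w && (M < x.2)) (pts (slab T n) w)].

Lemma measurable_bounded_event : measurable bounded_event.
Proof.
have -> : bounded_event = \bigcap_n [set w : @cfg R | ~~ has (fun x => below lambda x w && (M < x.2)) (pts (slab T n) w)].
  by apply/seteqP; split=> w H n; [move=> _; exact: H|exact: H].
apply: bigcapT_measurable => n; apply/measurable_bool_set/measurable_neg.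
apply: (measurable_has (measurable_slab T n) (bnd_slab T n)
  (@measurable_id _ (@cfg R) setT) (b := fun (w : @cfg R) x => below lambda x w && (M < x.2))).
apply: measurable_and; first exact: measurable_below.
apply: measurable_fun_ltr; first exact: measurable_cst.
exact: (measurableT_comp measurable_snd measurable_snd).
Qed.

Lemma bounded_event_full :
  {ae P, forall w, forall t : R, 0 <= t -> lambda t w <= M} ->
  {ae P, forall w, bounded_event w}.
Proof.
apply: filterS => w Hw n; apply/hasPn => x _; rewrite negb_and -leNgt.
rewrite /below; case: (leP 0 x.1) => //= x0; rewrite -implybE.
by apply/implyP => /le_trans; apply; exact: Hw.
Qed.

Lemma counting_process_bounded w : bounded_event w ->
  counting_process lambda T w = (count (fun x => below lambda x w) (pts B w))%:R.
Proof.
move=> Aw; rewrite /counting_process.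
have L := @counting_process_lim _ lambda T w.
suff H : intN (`]0, T] `*` `[0, +oo[)
    (fun x => (\1_[set y : X | y.2 <= lambda y.1 w] x)%:E) w =
   (count (fun x => below lambda x w) (pts B w))%:R%:E.
  by rewrite H.
apply: (cvg_unique _ L) => //; apply: cvg_near_cst; near=> n.
have Mn : M <= n%:R by near: n; exact: nbhs_infty_ger.
have -> : (\sum_(x <- pts (slab T n) w) ((below lambda x w)%:R : R)%:E =
    (count (fun x => below lambda x w) (pts (slab T n) w))%:R%:E)%E.
  by rewrite sumEFin -natr_sum -sumn_count sumnE big_map.
congr (_%:R%:E); rewrite -!size_filter; apply: perm_size.
apply: uniq_perm; [by rewrite filter_uniq// uniq_pts|by rewrite filter_uniq// uniq_pts|].
move=> x; rewrite !mem_filter; case: (boolP (below lambda x w)) => //= bx.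
apply/idP/idP.
  move=> xs; have [wx [x1 x2]] := (mem_pts w x (bnd_slab T n)).1 xs.
  apply/(mem_pts w x (bnd_box T M)); split=> //; split.
    by move: x1; rewrite /= !in_itv/= => /andP[/ltW -> ->].
  move: x2; rewrite /= !in_itv/= => /andP[-> _] /=.
  by move: (Aw n) => /hasPn/(_ _ xs); rewrite bx/= -leNgt.
move=> /(mem_pts w x (bnd_box T M))[wx [x1 x2]].
apply/(mem_pts w x (bnd_slab T n)); split=> //; split.
  have [_ _ /(_ _ wx) x0 _] := configP w.
  by move: x1; rewrite /= !in_itv/= x0 => /andP[_ ->].
by move: x2; rewrite /= !in_itv/= => /andP[-> x2] /=; exact: le_trans x2 Mn.
Unshelve. all: by end_near. Qed.

Variable Y : config R -> R.
Hypothesis Y_NTM : measurable_wrt (FNTM T M) Y.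

Lemma FNTM_local (E : set (config R)) w w' : FNTM T M E ->
  (forall x, B x -> (w : set _) x <-> (w' : set _) x) -> E w <-> E w'.
Proof.
move=> + ww'; move: E.
suff : FNTM T M `<=` [set E : set (config R) | E w <-> E w'] by [].
apply: smallest_sub.
  split.
  - by split.
  - by move=> E Eww; split=> -[? h]; split=> // /Eww.
  - by move=> F HF; split=> -[n _ /HF Fn]; exists n.
move=> _ [f [A mA <-] [Z mZ <-]] /=.
have NN : NTM T M A w = NTM T M A w'.
  by rewrite /NTM /N; congr counting; apply/seteqP; split=> x [wx [xA xB]]; split=> //; exact/ww'.
by split=> -[_ h]; split=> //; move: h; rewrite /= NN.
Qed.

Lemma local_eq w w' : (forall x, B x -> (w : set _) x <-> (w' : set _) x) -> Y w = Y w'.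
Proof.
move=> ww'; have [_] := FNTM_local (Y_NTM (measurable_set1 (Y w'))) ww'.
by move=> H; exact: (H erefl).
Qed.

Lemma measurable_local : measurable_fun setT (Y : @cfg R -> R).
Proof. by move=> _ Z mZ; rewrite setTI; apply: FNTM_cfg; exact: Y_NTM. Qed.

(** Both conditions form one event that is measurable through counts, because it will be evaluated
    at configurations with added points. *)
Definition good : set (@cfg R) :=
  bounded_event `&` [set w | counting_process lambda T w == Y w].

Lemma measurable_good : measurable good.
Proof.
apply: measurableI; first exact: measurable_bounded_event.
apply: measurable_bool_set; apply: measurable_fun_eqr => //.
  exact: measurable_counting_process.
exact: measurable_local.
Qed.

Lemma good_full :
  {ae P, forall w, forall t : R, 0 <= t -> lambda t w <= M} ->
  {ae P, forall w, counting_process lambda T w = Y w} ->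
  P (~` good) = 0%E.
Proof.
move=> /bounded_event_full H1 H2.
have [N [mN N0 sN]] : {ae P, forall w, good w}.
  apply: (negligibleS _ (negligibleU H1 H2)) => w /= /not_andP[Aw|Hw]; [by left|right].
  by move=> h; apply: Hw; apply/eqP.
apply/eqP; rewrite eq_le measure_ge0 andbT -N0; apply: le_measure.
- rewrite inE; apply: measurableC.
  by have := measurable_idc poissonP measurableT measurable_good; rewrite setTI.
- by rewrite inE.
- by [].
Qed.

(** [Y] depends on the atoms in the box only, so it is read as a function of finite point sets,
    evaluated at the configuration with no other atom (the empty one if s is not admissible). *)
Definition local_value (s : seq X) : R := Y (add_points (Config (is_config0 R)) [set` s]).

Lemma local_valueE w s : pts B w = [::] -> addable_seq w s ->
  local_value s = Y (add_points w [set` s]).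
Proof.
move=> w0 ws; have B0 x : B x -> ~ (w : set _) x.
  by move=> Bx wx; have := (mem_pts w x (bnd_box T M)).2 (conj wx Bx); rewrite w0.
have ws' := (addable_seqP _ _).1 ws.
have s' : is_config ((Config (is_config0 R) : set _) `|` [set` s]).
  by apply: is_config_sub ws'; rewrite set0U; exact: subsetUr.
apply: local_eq => x Bx; rewrite !atoms_add_points// set0U.
by split=> [|[/(B0 _ Bx)//|//]]; right.
Qed.

Lemma pts_empty_add w s : pts B w = [::] -> addable_seq w s -> uniq s -> {in s, forall x, B x} ->
  perm_eq (pts B (add_points w [set` s])) s.
Proof.
move=> w0 ws us sB; have ws' := (addable_seqP _ _).1 ws.
apply: pts_perm => //; first exact: bnd_box.
move=> x; rewrite atoms_add_points//; split=> [xs|[[wx Bx|//]]].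
  by split; [right|exact: sB].
by have := (mem_pts w x (bnd_box T M)).2 (conj wx Bx); rewrite w0.
Qed.

(* A point added at the end does not influence lambda at earlier times. *)
Lemma increment w s x : pts B w = [::] -> addable_seq w (rcons s x) -> uniq (rcons s x) ->
  {in rcons s x, forall z, B z} -> {in s, forall z, z.1 < x.1} ->
  good (add_points w [set` s]) -> good (add_points w [set` rcons s x]) ->
  local_value (rcons s x) - local_value s = (below lambda x (add_points w [set` s]))%:R.
Proof.
move=> w0 ws us sB sx [A1 /eqP E1] [A2 /eqP E2].
have ss : {subset s <= rcons s x} by move=> z zs; rewrite mem_rcons inE zs orbT.
have us' : uniq s by move: us; rewrite rcons_uniq => /andP[].
have ws' := addable_seq_sub ss ws.
rewrite (local_valueE w0 ws) (local_valueE w0 ws') -E1 -E2 !counting_process_bounded//.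
set u := add_points w _ in A1 E1 *; set u' := add_points w _ in A2 E2 *.
rewrite (seq.permP (pts_empty_add w0 ws us sB)).
rewrite (seq.permP (pts_empty_add w0 ws' us' _)); last by move=> z /ss /sB.
(* Predictability involves strictly earlier atoms only, so x is invisible even at its own time
   [t = x.1]. *)
have uu' t : 0 <= t -> t <= x.1 -> lambda t u' = lambda t u.
  move=> t0 tx; apply: predictable_agree => // z zt.
  rewrite /u /u' !atoms_add_points; [|exact/addable_seqP..].
  split=> [[wz|/=]|[wz|zs]]; [by left| |by left|by right; exact: ss].
  rewrite mem_rcons inE => /predU1P[zx|zs]; last by right.
  by move: zt; rewrite zx ltNge tx.
have B0 z : B z -> 0 <= z.1 by move=> /in_box[/andP[]].
have -> : count (fun z => below lambda z u') (rcons s x) =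
   (count (fun z => below lambda z u) s + below lambda x u)%N.
  rewrite -cats1 count_cat /= addn0; congr (_ + nat_of_bool _)%N.
    apply: eq_in_count => z zs; rewrite /below uu'//; last exact/ltW/sx.
    by apply/B0/sB/ss.
  by rewrite /below uu'//; apply/B0/sB; rewrite mem_rcons inE eqxx.
by rewrite natrD addrC addKr.
Qed.

Lemma mobius_increment w s x : pts B w = [::] -> addable_seq w (rcons s x) -> uniq (rcons s x) ->
  {in rcons s x, forall z, B z} -> {in s, forall z, z.1 < x.1} ->
  (forall K, subseq K (rcons s x) -> good (add_points w [set` K])) ->
  mobius s (fun r => (below lambda x (add_points w [set` r]))%:R) =
  mobius (rcons s x) local_value.
Proof.
move=> w0 ws us sB sx HK; rewrite mobius_rcons.
have mobiusB (t : seq X) (f g : seq X -> R) : mobius t (fun r => f r - g r) = mobius t f - mobius t g.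
  elim: t f g => [//|z t IH] f g /=.
  by rewrite !IH !opprB addrACA [RHS]addrACA; congr (_ + _); rewrite addrC.
rewrite -mobiusB; apply: mobius_ext => r rs.
have rsx : subseq (rcons r x) (rcons s x) by rewrite -!cats1 cat_subseq.
have sub1 := mem_subseq rsx.
apply/esym/increment => //.
- exact: addable_seq_sub ws.
- exact: subseq_uniq us.
- by move=> z /sub1 /sB.
- by move=> z /(mem_subseq rs) /sx.
- by apply: HK; apply: subseq_trans rs (subseq_rcons _ _).
- exact: HK.
Qed.

End process_at_T.

Lemma injsum_eq0 {R : realType} {X : eqType} k (e : seq X) (phi : seq X -> \bar R) :
  (forall s, 0 <= phi s)%E -> injsum k e phi = 0%E ->
  forall s, size s = k -> uniq s -> {subset s <= e} -> phi s = 0%E.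
Proof.
elim: k e phi => [|k IH] e phi phi0 /= H s; first by move=> /size0nil ->.
case: s => // x s [sk] /= /andP[xs us] se.
have xe : x \in e by apply: se; rewrite inE eqxx.
have injsum0 k' e' (f : seq X -> \bar R) : (forall s, 0 <= f s)%E -> (0 <= injsum k' e' f)%E.
  elim: k' e' f => [//|k' IH'] e' f f0 /=; first exact: f0.
  by apply: sume_ge0 => y _; exact: IH'.
apply: (IH [seq y <- e | y != x] (fun s => phi (x :: s))) => //.
  move: H => /eqP; rewrite (perm_big _ (perm_to_rem xe))/= big_cons.
  rewrite padde_eq0; [|exact: injsum0|by apply: sume_ge0 => y _; exact: injsum0].
  by move=> /andP[/eqP].
move=> y ys; rewrite mem_filter se ?inE ?ys ?orbT// andbT.
by apply: contraNneq xs => <-.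
Qed.

Lemma measurable_natboolR {R : realType} d (Z : measurableType d) (b : Z -> bool) :
  measurable_fun setT b -> measurable_fun setT (fun z => (b z)%:R : R).
Proof.
move=> mb; have -> : (fun z => (b z)%:R : R) = (fun z => if b z then 1 else 0).
  by apply/funext => z; case: (b z).
by apply: measurable_fun_ifT => //; exact: measurable_cst.
Qed.

Lemma mfuns_take {R : realType} d (Z : measurableType d)
  (s : seq (Z -> R * R)) n : mfuns s -> mfuns (take n s).
Proof.
elim: s n => [|x s IH] n ms; first by case: n.
case: n => [|n] /=; first exact: mfuns_nil.
apply: mfuns_cons; first by apply: ms; left.
by apply: IH => u us; apply: ms; right.
Qed.

(** * The coefficients: measurability, symmetry and bounds *)

Section coefficients.
Context {R : realType} (P : probability (config R) R).
Hypothesis poissonP : poisson_random_measure P.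
Local Notation X := (R * R)%type.
Variables (T M : R).
Hypotheses (T_gt0 : 0 < T) (M_gt0 : 0 < M).
Variable lambda : R -> config R -> R.
Hypothesis lambda_pred : predictable lambda.
Local Notation B := (box T M).
Implicit Types w : config R.

Let mB : measurable B := measurable_box T M.
Let bB : bnd B := bnd_box T M.

Lemma LTME w : LTM T M w = expR (M * T) * (cnt B w == 0%N)%:R.
Proof.
rewrite /LTM indicE; congr (_ * _%:R); congr nat_of_bool.
apply/idP/eqP; rewrite inE /= N_cnt//; last by move=> ->.
by move=> [] /eqP; rewrite pnatr_eq0 => /eqP.
Qed.

Lemma measurable_LTM : measurable_fun setT (LTM T M : @cfg R -> R).
Proof.
have -> : (LTM T M : @cfg R -> R) = (fun w => expR (M * T) * (cnt B w == 0%N)%:R).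
  by apply/funext => w; rewrite LTME.
exact: (measurable_cnt (fun k => expR (M * T) * (k == 0%N)%:R)).
Qed.

Lemma LTM_ge0 w : 0 <= LTM T M w.
Proof. by rewrite LTME mulr_ge0// expR_ge0. Qed.

(** The box is empty with probability exp(-MT), so [LTM] is a probability density, that of
    conditioning on an empty box. *)
Lemma integral_LTM : (\int[P]_w (LTM T M w)%:E = 1)%E.
Proof.
transitivity (\int[P]_w ((expR (M * T))%:E * (\1_[set w : config R | cnt B w = 0%N] w)%:E))%E.
  apply: eq_integral => w _; rewrite LTME EFinM; congr (_ * _%:R%:E)%E; congr nat_of_bool.
  by apply/eqP/idP; rewrite inE.
have mE : measurable [set w : config R | cnt B w = 0%N] by exact: (measurable_cnt_vague poissonP 0%N mB bB).
rewrite ge0_integralZl_EFin//; last first.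
  by apply/measurable_EFinP; exact: measurable_indic.
rewrite integral_indic// setIT.
apply: (etrans (congr1 (mule _) (P_cnt poissonP 0%N mB bB))).
rewrite dx_box ?ltW//= /poiss.
by rewrite expr0 fact0 divr1 mul1r -EFinM -expRD mulrC subrr expR0.
Qed.

(** The random variable under the expectation in [c], for a list already in time order: the last
    point carries the indicator, the others the derivative. *)
Definition kern_coef (s : seq X) w : R :=
  LTM T M w * mobius (take (size s).-1 s)
    (fun r => (below lambda (last (0, 0) s) (add_points w [set` r]))%:R).

Definition all_box (s : seq X) : bool := all (fun x => `[< B x >]) s.

(* The coefficient c, extended by 0 to the empty sequence and outside the
   box. *)
Definition coef (s : seq X) : R :=
  if (s != [::]) && all_box s then \int[P]_w kern_coef (sort (@time_le R) s) w
  else 0.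

Lemma all_boxP s : all_box s <-> {in s, forall x, B x}.
Proof.
by split=> [/allP H x /H/asboolP|H]; [|apply/allP => x /H Bx; exact/asboolP].
Qed.

Lemma cE k (t : k.-tuple X) : (0 < k)%N -> in_power B t ->
  c P T M lambda t = coef t.
Proof.
move=> k0 tB.
have tB' : {in (t : seq X), forall x, B x}.
  by move=> x /tnthP[i ->]; exact: tB.
rewrite /coef (all_boxP _).2// andbT -size_eq0 size_tuple -lt0n k0.
rewrite /c /Rintegral unlock; congr fine; apply: eq_integral => w _.
congr (_%:E); rewrite /kern_coef size_sort size_tuple malliavinE; congr (_ * _).
have st : size (sort (@time_le R) t) = k by rewrite size_sort size_tuple.
rewrite -(nth_last (0, 0) (sort _ _)) st.
set xk := nth _ _ _.
have xk0 : 0 <= xk.1.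
  have : xk \in (t : seq X) by rewrite -(mem_sort (@time_le R)) mem_nth// st prednK.
  by move=> /tB' /in_box[/andP[]].
apply: mobius_ext => r _; rewrite indicE /below xk0; congr (_%:R); congr nat_of_bool.
by apply/idP/idP; rewrite inE.
Qed.

Lemma mseq_kern_coef d (Z : measurableType d) (W : Z -> @cfg R) :
  measurable_fun setT W -> mseq (fun z s => kern_coef s (W z)).
Proof.
move=> mW d1 Z1 g s mg ms; rewrite /kern_coef.
have mWg : measurable_fun setT (W \o g) by exact: measurableT_comp.
apply: measurable_funM; first exact: (measurableT_comp measurable_LTM mWg).
have -> : (fun z => mobius (take (size (ev s z)).-1 (ev s z))
    (fun r => (below lambda (last (0, 0) (ev s z)) (add_points (W (g z)) [set` r]))%:R : R)) =
  (fun z => mobius (ev (take (size s).-1 s) z)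
    (fun r => (below lambda (last (cst (0, 0)) s z) (add_points (W (g z)) [set` r]))%:R)).
  by apply/funext => z; rewrite /ev size_map map_take (last_map (fun x => x z)).
have ml : measurable_fun setT (last (cst (0, 0)) s).
  case: s ms => [|x s] ms /=; first exact: measurable_cst.
  elim: s x ms => [|y s IH] x ms /=; first by apply: ms; left.
  by apply: IH => u us; apply: ms; right.
apply: measurable_mobius.
  move=> d2 Z2 h t mh mt.
  have := measurable_below lambda_pred (x := last (cst (0, 0)) s \o h)
    (W := fun z => add_points (W (g (h z))) [set` ev t z]).
  move=> /(_ (measurableT_comp ml mh)) H.
  have mb : measurable_fun setT (fun z => below lambda ((last (cst (0, 0)) s \o h) z)
     (add_points (W (g (h z))) [set` ev t z])).
    apply: H; apply: (measurable_add_points (W := fun z => W (g (h z)))) => //.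
    exact: (measurableT_comp mWg mh).
  exact: measurable_natboolR.
exact: mfuns_take.
Qed.

End coefficients.

Section coefficients_identity.
Context {R : realType} (P : probability (config R) R).
Hypothesis poissonP : poisson_random_measure P.
Local Notation X := (R * R)%type.
Variables (T M : R).
Hypotheses (T_gt0 : 0 < T) (M_gt0 : 0 < M).
Variable lambda : R -> config R -> R.
Hypothesis lambda_pred : predictable lambda.
Local Notation B := (box T M).
Implicit Types w : config R.
Local Notation kc := (kern_coef T M lambda).
Local Notation cf := (coef P T M lambda).

Let mB : measurable B := measurable_box T M.
Let bB : bnd B := bnd_box T M.

Lemma measurable_kern_coef s : measurable_fun setT (kc s : @cfg R -> R).
Proof.
have := @mseq_kern_coef R T M lambda lambda_pred _ (@cfg R) id (@measurable_id _ _ _)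
  _ (@cfg R) id [seq cst x | x <- s] (@measurable_id _ _ _).
have -> : (fun z : @cfg R => kern_coef T M lambda (ev [seq cst x | x <- s] z) z) = kc s.
  by apply/funext => w; rewrite ev_cst.
by apply; exact: mfuns_cst.
Qed.

(** For a list of length k > 0 the derivative is an alternating sum of 2^(k-1) indicators; the
    weaker bound 2^k spares a separate case for the empty list. *)
Lemma kern_coef_le s w : `|kc s w| <= 2 ^+ size s * LTM T M w.
Proof.
rewrite normrM ger0_norm ?LTM_ge0// mulrC ler_wpM2r ?LTM_ge0//.
apply: (le_trans (mobius_bound (C := 1) _ _)).
  by move=> r; case: below; rewrite ?normr1 ?normr0.
rewrite mulr1 ler_weXn2l ?ler1n// size_take; case: ltnP => // _.
by rewrite leq_pred.
Qed.

Lemma integrable_LTM (k : R) : 0 <= k ->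
  P.-integrable setT (EFin \o (fun w => k * LTM T M w)).
Proof.
move=> k0; apply/integrableP; split.
  apply/measurable_EFinP/measurable_funM => //.
  exact: (measurable_vague poissonP (measurable_LTM T M)).
under eq_integral do rewrite /= ger0_norm ?mulr_ge0 ?LTM_ge0// EFinM.
rewrite ge0_integralZl_EFin//.
- by rewrite integral_LTM// mule1 ltry.
- by move=> w _; rewrite lee_fin LTM_ge0.
- apply/measurable_EFinP.
  exact: (measurable_vague poissonP (measurable_LTM T M)).
Qed.

Lemma integrable_kern_coef s : P.-integrable setT (EFin \o kc s).
Proof.
have := @integrable_LTM (2 ^+ size s) (exprn_ge0 _ (ler0n _ _)).
apply: le_integrable => //.
  by apply/measurable_EFinP; exact: (measurable_vague poissonP (measurable_kern_coef s)).
move=> w _; rewrite lee_fin; apply: (le_trans (kern_coef_le s w)).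
exact: ler_norm.
Qed.

Lemma Rintegral_LTM (k : R) : 0 <= k -> \int[P]_w (k * LTM T M w) = k.
Proof.
move=> k0; rewrite /Rintegral; under eq_integral do rewrite EFinM.
rewrite ge0_integralZl_EFin//.
- by rewrite integral_LTM// mule1.
- by move=> w _; rewrite lee_fin LTM_ge0.
- apply/measurable_EFinP.
  exact: (measurable_vague poissonP (measurable_LTM T M)).
Qed.

Lemma coef_le s : `|cf s| <= 2 ^+ size s.
Proof.
rewrite /coef; case: ifP => _; last by rewrite normr0 exprn_ge0.
apply: (le_trans (le_normr_Rintegral _ _)) => //; first exact: integrable_kern_coef.
have k0 : 0 <= 2 ^+ size s :> R by rewrite exprn_ge0.
rewrite -[leRHS](Rintegral_LTM k0); apply: le_Rintegral => //.
- have := integrable_norm (integrable_kern_coef (sort (@time_le R) s)).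
  by [].
- exact: integrable_LTM.
- by move=> w _; have := kern_coef_le (sort (@time_le R) s) w; rewrite size_sort.
Qed.

Lemma symseq_coef : symseq cf.
Proof.
move=> s t st; rewrite /coef; congr (if _ && _ then _ else _).
- by rewrite -!size_eq0 (perm_size st).
- by rewrite /all_box (perm_all _ st).
have -> // : sort (@time_le R) s = sort (@time_le R) t.
by apply/perm_sortP => //; [exact: time_le_total|exact: time_le_trans|exact: time_le_anti].
Qed.

Lemma measurable_all_box d (Z : measurableType d) (s : seq (Z -> X)) : mfuns s ->
  measurable_fun setT (fun z => all_box T M (ev s z)).
Proof.
elim: s => [|x s IH] ms /=; first exact: measurable_cst.
apply: measurable_and; last by apply: IH => u us; apply: ms; right.
have mx : measurable_fun setT x by apply: ms; left.
by apply: measurable_bool_asbool; rewrite -[X in measurable X]setTI; exact: mx.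
Qed.

Lemma mseq_coef d (Z : measurableType d) : mseq (fun (_ : Z) s => cf s).
Proof.
move=> d1 Z1 g s mg ms; rewrite /coef.
have e0 z : (ev s z != [::]) = (s != [::]) by case: (s).
under eq_fun do rewrite e0.
apply: measurable_fun_ifT; last exact: measurable_cst.
  by apply: measurable_and; [exact: measurable_cst|exact: measurable_all_box].
apply: (mseq_ev (phi := fun z s => \int[P]_w kc (sort (@time_le R) s) w)) => //.
apply: (mseq_sort (phi := fun z s => \int[P]_w kc s w)).
move=> d2 Z2 h t mh mt.
apply: measurable_param_Rintegral => //.
apply: (measurable_vague_prod poissonP
  (f := fun p : Z2 * @cfg R => kc (ev t p.1) p.2)).
have := @mseq_kern_coef R T M lambda lambda_pred _ (Z2 * @cfg R)%type snd measurable_snd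
  _ (Z2 * @cfg R)%type id [seq x \o fst | x <- t] (@measurable_id _ _ _).
have -> : (fun z : Z2 * @cfg R => kern_coef T M lambda (ev [seq x \o fst | x <- t] z) z.2) =
   (fun p => kc (ev t p.1) p.2).
  by apply/funext => p; rewrite ev_comp.
by apply; apply: mfuns_comp => //; exact: measurable_fst.
Qed.

End coefficients_identity.

Lemma mfuns_rev {R : realType} d (Z : measurableType d)
  (s : seq (Z -> R * R)) : mfuns s -> mfuns (rev s).
Proof.
rewrite /rev; have : mfuns ([::] : seq (Z -> R * R)) by exact: mfuns_nil.
elim: s [::] => [//|x s IH] t mt ms /=; apply: IH.
  by apply: mfuns_cons => //; apply: ms; left.
by move=> u us; apply: ms; right.
Qed.

(** * Transfer of the almost sure event to added points *)

Section almost_sure_identity.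
Context {R : realType} (P : probability (config R) R).
Hypothesis poissonP : poisson_random_measure P.
Local Notation X := (R * R)%type.
Variables (T M : R).
Hypotheses (T_gt0 : 0 < T) (M_gt0 : 0 < M).
Variable lambda : R -> config R -> R.
Hypothesis lambda_pred : predictable lambda.
Variable Y : config R -> R.
Hypothesis Y_NTM : measurable_wrt (FNTM T M) Y.
Hypothesis good0 : P (~` good T M lambda Y) = 0%E.
Local Notation B := (box T M).
Implicit Types w : config R.
Local Notation kc := (kern_coef T M lambda).
Local Notation cf := (coef P T M lambda).
Local Notation good := (good T M lambda Y).

Let mB : measurable B := measurable_box T M.
Let bB : bnd B := bnd_box T M.

Let mbad : measurable (~` good : set (@cfg R)).
Proof. by apply: measurableC; exact: measurable_good. Qed.

Let mbad_vague : measurable (~` good : set (config R)).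
Proof. by rewrite -[X in measurable X]setTI; exact: (measurable_idc poissonP measurableT mbad). Qed.

(* Probability that adding the points of s leaves the almost sure event. *)
Definition bad_prob (s : seq X) : \bar R :=
  (\int[P]_w ind (~` good : set cfg) (adds w (rev s)))%E.

Lemma mseq_bad d (Z : measurableType d) (W : Z -> @cfg R) :
  measurable_fun setT W ->
  mseq (fun z s => ind (~` good : set cfg) (adds (W z) (rev s)) : \bar R).
Proof.
move=> mW d1 Z1 g s mg ms.
apply: (measurableT_comp (proj2 (nnmeas_ind R mbad))).
have -> : (fun z => adds (W (g z)) (rev (ev s z)) : cfg) =
    (fun z => adds (W (g z)) (ev (rev s) z)).
  by apply/funext => z; rewrite /ev map_rev.
apply: (measurable_adds (W := fun z => W (g z))).
  exact: (measurableT_comp mW mg).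
exact: mfuns_rev.
Qed.

Lemma bad_prob_ge0 s : (0 <= bad_prob s)%E.
Proof. by apply: integral_ge0 => w _; rewrite lee_fin. Qed.

Lemma mseq_bad_prob d (Z : measurableType d) : mseq (fun (_ : Z) s => bad_prob s).
Proof.
move=> d1 Z1 g s mg ms; rewrite /bad_prob.
apply: (@measurable_fun_fubini_tonelli_F _ _ Z1 (config R) R P
  (fun p => ind (~` good : set cfg) (adds p.2 (rev (ev s p.1))))); last first.
  by move=> p; rewrite lee_fin.
apply: (measurable_vague_prod poissonP
  (f := fun p : Z1 * @cfg R => ind (~` good : set cfg) (adds p.2 (rev (ev s p.1))))).
have := @mseq_bad _ (Z1 * @cfg R)%type snd measurable_snd _ _ id
  [seq x \o fst | x <- s] (@measurable_id _ _ _).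
have -> : (fun z : Z1 * @cfg R => ind (~` good : set cfg) (adds z.2 (rev (ev [seq x \o fst | x <- s] z))) : \bar R) =
   (fun p => ind (~` good : set cfg) (adds p.2 (rev (ev s p.1)))).
  by apply/funext => p; rewrite ev_comp.
by apply; apply: mfuns_comp => //; exact: measurable_fst.
Qed.

(** Mecke's formula for the indicator of the exceptional event, an integrand that ignores the chosen
    tuple: the sum over tuples of atoms is almost surely a sum of zeros. *)
Lemma itinte_bad_prob k : itinte T M k bad_prob = 0%E.
Proof.
have := @multi_mecke R P poissonP T M k (fun _ w => ind (~` good : set cfg) w).
have m0 : mseq (fun (w : @cfg R) (_ : seq X) => ind (~` good : set cfg) w : \bar R).
  move=> d1 Z1 g s mg ms; exact: (measurableT_comp (proj2 (nnmeas_ind R mbad)) mg).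
move=> /(_ m0 (fun _ _ => ltac:(by rewrite lee_fin))) <-.
have mTR : measurable_fun setT (fun w : @cfg R => injsum k (pts B w)
    (fun=> ind (~` good : set cfg) w : \bar R)).
  apply: (measurable_injsum_pts k (phi := fun w _ => ind (~` good : set cfg) w)) => // w s.
  by rewrite lee_fin.
rewrite (ge0_ae_eq_integral (g := cst 0%E))// ?integral0//.
- exact: (measurable_vague poissonP mTR).
- by move=> w _; apply: injsum_ge0 => s; rewrite lee_fin.
exists (~` good); split=> // w /= H gw; apply: H => _.
have injsum0 k' (e : seq X) : injsum k' e (fun=> 0%E : \bar R) = 0%E.
  by elim: k' e => [//|k' IH] e /=; rewrite big1.
rewrite -[RHS](injsum0 k (pts B w)); congr injsum; apply/funext => s.
by rewrite /ind indicE memNset.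
Qed.

(** Mecke's formula again, now for [bad_prob] as a function of the tuple alone: its sum over
    k-tuples of atoms is nonnegative with mean [itinte T M k bad_prob], which is 0, so almost surely
    every term vanishes. *)
Lemma ae_bad_prob : {ae P, forall w, forall s, uniq s -> {subset s <= pts B w} ->
  bad_prob s = 0%E}.
Proof.
have H k : {ae P, forall w, injsum k (pts B w) bad_prob = 0%E}.
  have mTR : measurable_fun setT (fun w : @cfg R => injsum k (pts B w) bad_prob).
    apply: (measurable_injsum_pts k (phi := fun _ s => bad_prob s)) => //.
      exact: mseq_bad_prob.
    by move=> w s; exact: bad_prob_ge0.
  have := @multi_mecke R P poissonP T M k (fun s _ => bad_prob s) (@mseq_bad_prob _ _)
    (fun s _ => bad_prob_ge0 s).
  have -> : (fun s => \int[P]__ bad_prob s)%E = bad_prob.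
    apply/funext => s; rewrite (_ : (\int[P]__ bad_prob s)%E = (\int[P]_w cst (bad_prob s) w)%E)//.
    rewrite integral_cst//; apply: (etrans (congr1 (mule _) (probability_setT P))).
    by rewrite mule1.
  rewrite itinte_bad_prob => H0.
  have := (ae_eq_integral_abs P measurableT (measurable_vague poissonP mTR)).1.
  rewrite /ae_eq; case.
    rewrite -[RHS]H0; apply: eq_integral => w _.
    by rewrite gee0_abs// injsum_ge0// => s; exact: bad_prob_ge0.
  move=> N [mN N0 sN]; exists N; split=> //.
  apply: subset_trans sN => w /= h1 h2; apply: h1; exact: h2.
have : P.-negligible (\bigcup_k ~` [set w | injsum k (pts B w) bad_prob = 0%E]).
  by apply: negligible_bigcup => k; exact: H.
apply: negligibleS => w /= h; apply: contrapT => h2; apply: h => s us sw.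
apply: (injsum_eq0 (k := size s) (e := pts B w)) => //; first exact: bad_prob_ge0.
by apply: contrapT => h3; apply: h2; exists (size s).
Qed.

End almost_sure_identity.

(** * Pseudo-chaotic expansion *)

Section coefficient_difference.
Context {R : realType} (P : probability (config R) R).
Hypothesis poissonP : poisson_random_measure P.
Local Notation X := (R * R)%type.
Variables (T M : R).
Hypotheses (T_gt0 : 0 < T) (M_gt0 : 0 < M).
Variable lambda : R -> config R -> R.
Hypothesis lambda_pred : predictable lambda.
Variable Y : config R -> R.
Hypothesis Y_NTM : measurable_wrt (FNTM T M) Y.
Hypothesis good0 : P (~` good T M lambda Y) = 0%E.
Local Notation B := (box T M).
Implicit Types w : config R.
Local Notation kc := (kern_coef T M lambda).
Local Notation cf := (coef P T M lambda).
Local Notation good := (good T M lambda Y).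

Let mB : measurable B := measurable_box T M.
Let bB : bnd B := bnd_box T M.

(** The points of [s] come from the single configuration [w'], hence have distinct times, and
    freshness excludes conflicts with [w]. *)
Lemma addable_seq_fresh w w' (s : seq X) : (forall x, x \in s -> (w' : set _) x) ->
  (forall x, x \in s -> fresh w x) -> addable_seq w s.
Proof.
move=> sw' sw; apply/addable_seqP.
have [W1 W2 W3 W4] := configP w; have [V1 V2 V3 V4] := configP w'.
split.
- by move=> x [/W1//|/= /sw' /V1].
- move=> K cK; rewrite setIUl finite_setU; split; first exact: W2.
  by apply: sub_finite_set (finite_seq s) => x [].
- by move=> x [/W3//|/= /sw' /V3].
- move=> x y [wx|/= xs] [wy|/= ys] xy; first exact: W4.
  + by have := sw _ ys _ wx; rewrite xy eqxx.
  + by have := sw _ xs _ wy; rewrite xy eqxx.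
  + by apply: V4 => //; exact: sw'.
Qed.

Lemma ae_good_adds (K : seq X) :
  bad_prob P T M lambda Y (rev K) = 0%E -> {ae P, forall w, good (adds w K)}.
Proof.
move=> H.
have mf : measurable_fun setT (fun w : @cfg R => adds w K : cfg).
  have := @measurable_adds R _ (@cfg R) id [seq cst x | x <- K] (@measurable_id _ _ _).
  have -> : (fun z : @cfg R => adds z (ev [seq cst x | x <- K] z) : cfg) = (fun w => adds w K : cfg).
    by apply/funext => w; rewrite ev_cst.
  by apply; exact: mfuns_cst.
have mE : measurable ([set w | ~ good (adds w K)] : set (config R)).
  have := measurable_vague poissonP mf measurableT
    (measurableC (measurable_good lambda_pred Y_NTM)).
  by rewrite setTI.
exists [set w | ~ good (adds w K)]; split=> //.
apply: etrans H; rewrite /bad_prob revK.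
transitivity (\int[P]_w (\1_[set w | ~ good (adds w K)] w)%:E)%E.
  by rewrite integral_indic// setIT.
by apply: eq_integral => w _; rewrite /ind !indicE; congr (_%:R%:E); congr nat_of_bool;
  apply/idP/idP; rewrite !inE.
Qed.

(* On N(B) = 0, the process sees only the added points, so that the derivative
   of order k - 1 of the indicator is an increment of the local functional. *)
Lemma coef_mobius w' (J : seq X) : J != [::] -> uniq J -> sorted (@time_le R) J ->
  (forall x, x \in J -> (w' : set _) x /\ B x) ->
  (forall K, subseq K J -> bad_prob P T M lambda Y (rev K) = 0%E) ->
  cf J = mobius J (local_value Y).
Proof.
move=> J0 uJ sJ Jw HK.
have JB : {in J, forall x, B x} by move=> x /Jw[].
have -> : cf J = \int[P]_w kc J w.
  rewrite /coef J0 (all_boxP _ _ _).2//=; congr (Rintegral P setT _).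
  apply/funext => w; congr kern_coef.
  apply: sorted_sort => //; exact: time_le_trans.
suff ae1 : {ae P, forall w, kc J w = mobius J (local_value Y) * LTM T M w}.
  have mk := measurable_vague poissonP (measurable_kern_coef T M lambda_pred J).
  transitivity (\int[P]_w (mobius J (local_value Y) * LTM T M w)).
    rewrite /Rintegral; congr fine; apply: ae_eq_integral => //.
    - exact/measurable_EFinP.
    - apply/measurable_EFinP/measurable_funM => //.
      exact: (measurable_vague poissonP (measurable_LTM T M)).
    case: ae1 => N [mN N0 sN]; exists N; split=> //.
    apply: subset_trans sN => w /= h1 h2; apply: h1 => _; by rewrite h2.
  rewrite RintegralZl//; last first.
    have := integrable_LTM poissonP T_gt0 M_gt0 ler01.
    by congr (integrable _ _ _); apply/funext => w /=; rewrite mul1r.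
  have := Rintegral_LTM poissonP T_gt0 M_gt0 ler01.
  under eq_Rintegral do rewrite mul1r.
  by move=> ->; rewrite mulr1.
have fr : {ae P, forall w, forall x, x \in J -> fresh w x}.
  have : P.-negligible (\bigcup_i ~` [set w | fresh w (nth (0, 0) J i)]).
    by apply: negligible_bigcup => i; exact: ae_fresh.
  apply: negligibleS => w /= h; apply: contrapT => h2; apply: h => x xJ.
  apply: contrapT => h3; apply: h2; exists (index x J) => //=.
  by rewrite nth_index.
have gd : {ae P, forall w, forall K, subseq K J -> good (adds w K)}.
  (* Subsequences are coded by masks and masks by integers, to stay with a countable union; integers
     that code nothing give the empty mask, whose subsequence is also covered by [HK]. *)
  have : P.-negligible (\bigcup_i ~` [set w | good (adds w (mask (odflt [::] (unpickle i : option (seq bool))) J))]).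
    apply: negligible_bigcup => i; apply: ae_good_adds; apply: HK; exact: mask_subseq.
  apply: negligibleS => w /= h; apply: contrapT => h2; apply: h => K /subseqP[m _ ->].
  apply: contrapT => h3; apply: h2; exists (pickle (m : seq bool)) => // h4.
  apply: h3; have e : odflt [::] (unpickle (pickle (m : seq bool))) = m by rewrite pickleK.
  by rewrite -e.
apply: (negligibleS _ (negligibleU fr gd)) => w /= h.
apply: contrapT => h2; apply: h.
have {h2}[fw gw] : (forall x, x \in J -> fresh w x) /\ (forall K, subseq K J -> good (adds w K)).
  by split; apply: contrapT => h3; apply: h2; [left|right].
have ow : addable_seq w J by apply: (@addable_seq_fresh w w') => // x /Jw[].
rewrite /kern_coef mulrC LTME.
have [c0|c0] := eqVneq (cnt B w) 0%N; last by rewrite !mulr0.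
congr (_ * _).
have w0 : pts B w = [::] by exact: size0nil.
case/lastP: J J0 uJ sJ {HK} Jw JB fr gd fw gw ow => [//|s x] _ uJ sJ Jw JB _ _ fw gw ow.
rewrite last_rcons size_rcons -cats1 take_size_cat// cats1.
apply: (mobius_increment (M := M) lambda_pred Y_NTM) => //.
(* Sortedness allows equal times; a tie is excluded because both points are atoms of [w'], whose
   times are distinct. *)
- move=> z zs.
  move: sJ; rewrite (sorted_pairwise (@time_le_trans R)) pairwise_rcons.
  move=> /andP[/allP/(_ _ zs) + _]; rewrite /time_le => /orP[//|/andP[/eqP zx _]].
  have [_ _ _ inj] := configP w'.
  have xJ : x \in rcons s x by rewrite mem_rcons inE eqxx.
  have zJ : z \in rcons s x by rewrite mem_rcons inE zs orbT.
  have zx' := inj _ _ (Jw _ zJ).1 (Jw _ xJ).1 zx.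
  by move: uJ; rewrite rcons_uniq -zx' zs.
- move=> K KJ; rewrite add_pointsE (addable_seq_sub (mem_subseq KJ) ow); exact: gw.
Qed.

End coefficient_difference.

(** * Domination by functions of a Poisson count *)

Section domination.
Context {R : realType} (P : probability (config R) R).
Hypothesis poissonP : poisson_random_measure P.
Local Notation X := (R * R)%type.
Variables (B : set X) (mB : measurable B) (bB : bnd B).

(** The integral of a nonnegative function is a supremum over the simple functions below it, so
    monotonicity holds without measurability. Approximation errors can thus be bounded as they
    stand. *)
Lemma ge0_le_integral_nonmeas d (Z : measurableType d)
    (mu : {measure set Z -> \bar R}) (f h : Z -> \bar R) :
  (forall z, 0 <= f z)%E -> (forall z, f z <= h z)%E ->
  (\int[mu]_z f z <= \int[mu]_z h z)%E.
Proof.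
move=> f0 fh; have h0 z : (0 <= h z)%E by exact: le_trans (fh z).
rewrite !ge0_integralTE//; apply: le_ereal_sup => _ [g gf <-].
by exists g => //= z; exact: le_trans (fh z).
Qed.

Lemma ae_ge0_le_integral_nonmeas d (Z : measurableType d)
    (mu : {measure set Z -> \bar R}) (f h : Z -> \bar R) :
  (forall z, 0 <= f z)%E -> (forall z, 0 <= h z)%E -> measurable_fun setT h ->
  {ae mu, forall z, (f z <= h z)%E} ->
  (\int[mu]_z f z <= \int[mu]_z h z)%E.
Proof.
move=> f0 h0 mh [N [mN N0 sN]].
(* Raised to infinity on the exceptional null set, the bound holds everywhere and keeps its
   integral. *)
pose h' z := if z \in N then +oo%E else h z.
apply: (@le_trans _ _ (\int[mu]_z h' z)%E).
  apply: ge0_le_integral_nonmeas => // z; rewrite /h'; case: ifPn => [_|zN].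
    exact: leey.
  by apply: contrapT => H; move: zN; rewrite notin_setE; apply; exact: sN.
rewrite le_eqVlt; apply/orP; left; apply/eqP.
have mN' : measurable_fun setT (fun z => z \in N).
  have -> : (fun z => z \in N) = (fun z => `[< N z >]).
    by apply/funext => z; apply/idP/asboolP; rewrite inE.
  exact: measurable_bool_asbool.
apply: ge0_ae_eq_integral => //.
- by apply: measurable_fun_ifT.
- by move=> z _; rewrite /h'; case: ifP.
exists N; split=> // z /= H; apply: contrapT => zN; apply: H => _.
by rewrite /h' memNset.
Qed.

Definition exppart (n : nat) (x : R) : R := \sum_(0 <= k < n) x ^+ k / k`!%:R.

Lemma exppart_cvg (x : R) : exppart ^~ x @ \oo --> expR x.
Proof. exact: (@is_cvg_series_exp_coeff R x). Qed.

Lemma exppart_le (x : R) n : 0 <= x -> exppart n x <= expR x.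
Proof.
move=> x0; rewrite -(cvg_lim _ (@exppart_cvg x))//.
apply: nondecreasing_cvgn_le; last by apply/cvg_ex; exists (expR x); exact: (@exppart_cvg x).
apply/nondecreasing_seqP => k; rewrite /exppart big_nat_recr//= lerDl.
by rewrite mulr_ge0 ?invr_ge0 ?exprn_ge0.
Qed.

Lemma exppart_ge0 (x : R) n : 0 <= x -> 0 <= exppart n x.
Proof.
by move=> x0; apply: sumr_ge0 => k _; rewrite mulr_ge0 ?invr_ge0 ?exprn_ge0.
Qed.

Lemma measurable_cnt_real (f : nat -> R) :
  measurable_fun setT (fun w : config R => f (cnt B w)).
Proof. exact: (measurable_vague poissonP (measurable_cnt f mB bB)). Qed.

(** Summation over the value of the count gives the series of exp(a r) times exp(-r), where r is the
    area of B. *)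
Lemma exp_moment (a : R) : 0 <= a ->
  (\int[P]_w (a ^+ cnt B w)%:E < +oo)%E.
Proof.
move=> a0; pose F k := [set w : config R | cnt B w = k].
have mF k : measurable (F k) by exact: (measurable_cnt_vague poissonP k mB bB).
have FT : \bigcup_k F k = setT by apply/seteqP; split=> // w _; exists (cnt B w).
rewrite -FT ge0_integral_bigcup//; last 3 first.
- rewrite FT; apply/measurable_EFinP; exact: (measurable_cnt_real (fun k => a ^+ k)).
- by move=> w _; rewrite lee_fin exprn_ge0.
- by move=> i j _ _ [w [<- <-]].
set r := fine (dx R B).
have E k : (\int[P]_(x in F k) (a ^+ cnt B x)%:E = ((a * r) ^+ k / k`!%:R * expR (- r))%:E)%E.
  rewrite (eq_integral (cst (a ^+ k)%:E)); last by move=> w; rewrite inE => ->.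
  rewrite integral_cst//; apply: (etrans (congr1 (mule _) (P_cnt poissonP k mB bB))).
  by rewrite -EFinM /poiss exprMn; congr (_%:E); rewrite !mulrA.
have r0 : 0 <= r by rewrite fine_ge0.
under eq_eseriesr do rewrite E.
apply: (@le_lt_trans _ _ (expR (a * r) * expR (- r))%:E); last by rewrite ltry.
apply: lime_le.
  by apply: is_cvg_nneseries => k _ _; rewrite lee_fin !mulr_ge0 ?invr_ge0 ?exprn_ge0 ?mulr_ge0 ?expR_ge0.
apply: nearW => n; rewrite sumEFin lee_fin -mulr_suml.
by rewrite ler_wpM2r ?expR_ge0//; apply: exppart_le; rewrite mulr_ge0.
Qed.

(** The bound [g n k] tends to 0 for each value k of the count and grows at most geometrically in k,
    uniformly in n. Its square is dominated by a multiple of q^2 to the power of the count, which is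
    integrable by [exp_moment]. *)
Lemma L2_dominated (Xn : nat -> config R -> R) (g : nat -> nat -> R) (C q : R) :
  0 <= q -> (forall n k, 0 <= g n k <= C * q ^+ k) ->
  (forall k, g ^~ k @ \oo --> (0 : R)) ->
  (forall n, {ae P, forall w, `|Xn n w| <= g n (cnt B w)}) ->
  ('E_P[(fun w => Xn n w ^+ 2)%R])%E @[n --> \oo] --> 0%E.
Proof.
move=> q0 gC g0 Xg; rewrite unlock.
have C0 : 0 <= C by have /andP[/le_trans h /h] := gC 0%N 0%N; rewrite expr0 mulr1.
have ig : P.-integrable setT (EFin \o (fun w => C ^+ 2 * (q ^+ 2) ^+ cnt B w)).
  apply/integrableP; split.
    apply/measurable_EFinP; exact: (measurable_cnt_real (fun k => C ^+ 2 * (q ^+ 2) ^+ k)).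
  under eq_integral do rewrite /= ger0_norm ?mulr_ge0 ?exprn_ge0// EFinM.
  rewrite ge0_integralZl_EFin//.
  - have := exp_moment (sqr_ge0 q) => h.
    by rewrite lte_mul_pinfty// ?lee_fin ?sqr_ge0// ge0_fin_numE.
  - by move=> w _; rewrite lee_fin exprn_ge0// sqr_ge0.
  - apply/measurable_EFinP; exact: (measurable_cnt_real (fun k => (q ^+ 2) ^+ k)).
  - by rewrite sqr_ge0.
have g2 n k : g n k ^+ 2 <= C ^+ 2 * (q ^+ 2) ^+ k.
  have /andP[h1 h2] := gC n k.
  by rewrite -exprM mulnC exprM -exprMn lerXn2r// nnegrE// (le_trans h1).
have mg n : measurable_fun setT (fun w : config R => (g n (cnt B w) ^+ 2)%:E).
  by apply/measurable_EFinP; exact: (measurable_cnt_real (fun k => g n k ^+ 2)).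
have cg k : (fun n => (g n k ^+ 2)%:E) @ \oo --> 0%E.
  have h : (fun n => g n k ^+ 2) @ \oo --> (0 : R).
    have -> : (fun n => g n k ^+ 2) = (fun n => g n k * g n k).
      by apply/funext => n; rewrite expr2.
    by rewrite -[X in _ --> X](mulr0 0); exact: cvgM.
  by apply: cvg_EFin; [exact: nearW|exact: h].
have fg (w : config R) n : (`|(g n (cnt B w) ^+ 2)%:E| <=
    (EFin \o (fun w => C ^+ 2 * (q ^+ 2) ^+ cnt B w)%R) w)%E.
  by rewrite /= lee_fin ger0_norm ?sqr_ge0.
have [_ _] := @dominated_convergence _ (config R) R P setT measurableT
  (fun n w => (g n (cnt B w) ^+ 2)%:E) (cst 0%E) _ mg (measurable_cst _)
  (aeW P (fun w _ => cg (cnt B w))) ig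
  (aeW P (fun w n _ => fg w n)).
rewrite integral0 => H.
apply: (squeeze_cvge _ (cvg_cst 0%E) H); apply: nearW => n.
apply/andP; split; first by apply: integral_ge0 => w _; rewrite lee_fin sqr_ge0.
apply: ae_ge0_le_integral_nonmeas => //.
- by move=> w; rewrite lee_fin sqr_ge0.
- by move=> w; rewrite lee_fin sqr_ge0.
have [N [mN N0 sN]] := Xg n; exists N; split=> //.
apply: subset_trans sN => w /= h1 h2; apply: h1.
rewrite lee_fin -(ger0_norm (sqr_ge0 (Xn n w))) normrX.
by rewrite lerXn2r ?nnegrE ?normr_ge0// (andP (gC _ _)).1.
Qed.

End domination.

Section arrangements.
Context {X : choiceType} {V : nmodType}.

(** The list of the tuples summed by [injsum], free of duplicates whenever [e] is; it links the
    recursive sum with the sum over a finite set of tuples in [multN]. *)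
Fixpoint arrangements (k : nat) (e : seq X) : seq (seq X) :=
  if k is k'.+1 then [seq x :: s | x <- e, s <- arrangements k' [seq y <- e | y != x]]
  else [:: [::]].

Lemma injsum_arrangements k e (phi : seq X -> V) : injsum k e phi = \sum_(s <- arrangements k e) phi s.
Proof.
elim: k e phi => [|k IH] e phi /=; first by rewrite big_seq1.
by rewrite big_allpairs_dep; apply: eq_bigr => x _; rewrite IH.
Qed.

Lemma mem_arrangements k e s :
  (s \in arrangements k e) = [&& size s == k, uniq s & all (mem e) s].
Proof.
elim: k e s => [|k IH] e s /=; first by case: s.
apply/allpairsPdep/and3P.
  move=> [x [t [xe]]]; rewrite IH => /and3P[/eqP tk ut /allP te] ->; split=> /=.
  - by rewrite tk.
  - rewrite ut andbT; apply/negP => /te.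
    by rewrite /= mem_filter eqxx.
  - by rewrite xe; apply/allP => y /te; rewrite /= mem_filter => /andP[].
case: s => [[]//|x t] /= [/eqP[tk] /andP[xt ut] /andP[xe /allP te]].
exists x, t; split=> //; rewrite IH tk eqxx ut/=; apply/allP => y yt.
rewrite /= mem_filter; apply/andP; split; last exact: te.
by apply: contraNneq xt => <-.
Qed.

Lemma uniq_arrangements k e : uniq e -> uniq (arrangements k e).
Proof.
elim: k e => [//|k IH] e ue /=; apply: allpairs_uniq_dep => //.
  by move=> x _; apply: IH; exact: filter_uniq.
by move=> [x s] [y t] _ _ /= [-> ->].
Qed.

End arrangements.

Lemma multN_injsum {R : realType} (B : set (R * R)) k (phi : seq (R * R) -> R) w :
  bnd B -> multN B (fun s : k.-tuple (R * R) => phi s) w = injsum k (pts B w) phi.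
Proof.
move=> bB; rewrite injsum_arrangements /multN.
pose r : seq (k.-tuple (R * R)) := pmap insub (arrangements k (pts B w)).
have ur : uniq r by apply: pmap_sub_uniq; apply/uniq_arrangements/uniq_pts.
have -> : [set s : k.-tuple (R * R) | uniq s /\ in_power ((w : set _) `&` B) s] = [set` r].
  apply/seteqP; split=> s /=; rewrite mem_pmap_sub mem_arrangements size_tuple eqxx/=.
    move=> [-> sB]; apply/allP => x /tnthP[i ->].
    by apply/(mem_pts _ _ bB); exact: sB.
  move=> /andP[us /allP sB]; split=> // i.
  exact/(mem_pts _ _ bB)/sB/mem_tnth.
rewrite -fsbig_seq// -(big_map val xpredT phi); congr (\sum_(s <- _) _).
rewrite /r (pmap_filter (insubK _)); apply/all_filterP/allP => s.
rewrite mem_arrangements => /and3P[sk _ _]; case: insubP => //.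
by rewrite sk.
Qed.

Section pseudo_chaotic.
Context {R : realType} (P : probability (config R) R).
Hypothesis poissonP : poisson_random_measure P.
Local Notation X := (R * R)%type.
Variables (T M : R).
Hypotheses (T_gt0 : 0 < T) (M_gt0 : 0 < M).
Variable lambda : R -> config R -> R.
Hypothesis lambda_pred : predictable lambda.
Variable Y : config R -> R.
Hypothesis Y_NTM : measurable_wrt (FNTM T M) Y.
Hypothesis good0 : P (~` good T M lambda Y) = 0%E.
Local Notation B := (box T M).
Local Notation cf := (coef P T M lambda).
Local Notation good := (good T M lambda Y).
Local Notation HT := (counting_process lambda T).

Let mB : measurable B := measurable_box T M.
Let bB : bnd B := bnd_box T M.

Let mgood : measurable (good : set (config R)).
Proof.
by have := measurable_idc poissonP measurableT (measurable_good lambda_pred Y_NTM); rewrite setTI.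
Qed.

(** The box is empty with positive probability, so some good configuration has no atom there, and
    H_T = Y = 0 on it. This is why the expansion has no constant term. *)
Lemma local_value_nil : local_value Y [::] = 0.
Proof.
have [w [w0 [Aw /eqP gw]]] : exists w : config R, cnt B w = 0%N /\ good w.
  apply: contrapT => /forallNP H.
  have : (P [set w | cnt B w = 0%N] <= P (~` good))%E.
    apply: le_measure; rewrite ?inE.
    - exact: (measurable_cnt_vague poissonP 0%N mB bB).
    - exact: measurableC.
    - by move=> w w0 gw; apply: (H w).
  rewrite good0 (P_cnt poissonP)// lee_fin leNgt => /negP; apply.
  by rewrite /poiss expr0 fact0 divr1 mul1r expR_gt0.
have w0' : pts B w = [::] by exact: size0nil.
have -> := @local_valueE R T M Y Y_NTM w [::] w0' isT.
have -> : add_points w [set` [::]] = w by rewrite add_pointsE.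
by rewrite -gw (counting_process_bounded Aw) w0'.
Qed.

Lemma ae_identity : {ae P, forall w, HT w = subsum (pts B w) cf}.
Proof.
have gd : {ae P, forall w, good w}.
  by exists (~` good); split=> //; exact: measurableC.
have bd := ae_bad_prob poissonP lambda_pred Y_NTM good0.
apply: (negligibleS _ (negligibleU gd bd)) => w /= h.
apply: contrapT => h2; apply: h.
have {h2}[gw bw] : good w /\ (forall s, uniq s -> {subset s <= pts B w} ->
    bad_prob P T M lambda Y s = 0%E).
  by split; apply: contrapT => h3; apply: h2; [left|right].
have [_ /eqP ->] := gw.
have -> : Y w = local_value Y (pts B w).
  rewrite /local_value; apply: (local_eq Y_NTM) => x Bx.
  have H : is_config ((Config (is_config0 R) : set _) `|` [set` pts B w]).
    by apply: is_config_sub (configP w) => y [//|/= /(mem_pts _ _ bB)[]].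
  rewrite atoms_add_points// set0U /=; split=> [wx|/(mem_pts _ _ bB)[]//].
  exact/(mem_pts _ _ bB).
rewrite -[LHS](subsum_mobius (pts B w) (local_value Y)); apply: subsum_ext => J Je.
(* The empty subset contributes [local_value Y [::]], which is 0, in agreement with the convention
   for [coef]. *)
have [->|J0] := eqVneq J [::]; first by rewrite /= local_value_nil /coef eqxx.
apply/esym/(coef_mobius poissonP T_gt0 M_gt0 lambda_pred Y_NTM (w' := w)) => //.
- exact: subseq_uniq Je (uniq_pts B w).
- exact: subseq_sorted (@time_le_trans R) _ _ Je (sorted_pts B w).
- by move=> x /(mem_subseq Je)/(mem_pts _ _ bB).
- move=> K KJ; apply: bw.
    by rewrite rev_uniq (subseq_uniq (subseq_trans KJ Je))// uniq_pts.
  by move=> x; rewrite mem_rev => /(mem_subseq (subseq_trans KJ Je)).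
Qed.

Lemma subsum_coef_le e : `|subsum e cf| <= 3 ^+ size e.
Proof.
apply: (le_trans (ler_norm_subsum e (psi := fun s => 2 ^+ size s) _)).
  by move=> s; exact: coef_le.
by rewrite subsum_pow.
Qed.

Lemma L2_HT : L2 P HT.
Proof.
split.
  move=> Z mZ; apply: cfg_FN_inf.
  by have := measurable_counting_process T lambda_pred measurableT mZ; rewrite setTI.
(* The base 9 is the square of the 3 in [subsum_coef_le]. *)
rewrite unlock; apply: (@le_lt_trans _ _ (\int[P]_w (9 ^+ cnt B w)%:E)%E).
  apply: ae_ge0_le_integral_nonmeas => //.
  - by move=> w; rewrite lee_fin sqr_ge0.
  - apply/measurable_EFinP; exact: (measurable_cnt_real poissonP mB bB (fun k => 9 ^+ k)).
  have [N [mN N0 sN]] := ae_identity; exists N; split=> //.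
  apply: subset_trans sN => w /= h1 h2; apply: h1.
  rewrite lee_fin h2 -(ger0_norm (sqr_ge0 (subsum _ _))) normrX.
  apply: (@le_trans _ _ ((3 ^+ cnt B w) ^+ 2)).
    by rewrite lerXn2r ?nnegrE ?normr_ge0 ?exprn_ge0//; exact: subsum_coef_le.
  by rewrite -exprM mulnC exprM -natrX.
exact: exp_moment.
Qed.

(** The factor 1/j! cancels the j! orderings of each subset; the empty subset may be included
    because [coef] vanishes there. *)
Lemma pseudo_partial n w :
  \sum_(1 <= j < n.+1) j`!%:R^-1 * multN B (c P T M lambda (k:=j)) w =
  \sum_(0 <= j < n.+1) subsumk (pts B w) j cf.
Proof.
rewrite [RHS]big_nat_recl// subsumk0 /coef eqxx add0r -/coef big_add1.
rewrite big_nat [RHS]big_nat; apply: eq_bigr => j _.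
have -> : multN B (c P T M lambda (k:=j.+1)) w = multN B (fun s : j.+1.-tuple X => cf s) w.
  apply: eq_fsbigr => s; rewrite inE => -[_ sB].
  by apply: cE => // i; have [] := sB i.
rewrite multN_injsum// injsum_subsumk; [|exact: symseq_coef|exact: uniq_pts].
by rewrite -[X in _ * X]mulr_natl mulKf// pnatr_eq0 -lt0n fact_gt0.
Qed.

Lemma pseudo_cvg : L2_cvg P (fun n w =>
   \sum_(1 <= j < n.+1) j`!%:R^-1 * multN B (c P T M lambda (k:=j)) w) HT.
Proof.
(* With k atoms the partial sum is exact as soon as n >= k; before that, the full sum and the
   partial sum are each at most 3^k in absolute value. *)
pose g (n k : nat) : R := if (k < n.+1)%N then 0 else 2 * 3 ^+ k.
apply: (@L2_dominated R P poissonP B mB bB _ g 2 3) => //.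
- move=> n k; rewrite /g; case: ifP => _; last by rewrite lexx mulr_ge0 ?exprn_ge0.
  by rewrite lexx mulr_ge0 ?exprn_ge0.
- move=> k; apply: cvg_near_cst; near=> n.
  by rewrite /g ifT// ltnS; near: n; exact: nbhs_infty_ge.
move=> n; have [N [mN N0 sN]] := ae_identity; exists N; split=> //.
apply: subset_trans sN => w /= h1 h2; apply: h1.
rewrite h2 pseudo_partial /g; case: ltnP => nk.
  by rewrite sum_subsumk// subrr normr0.
rewrite mulrDl mul1r; apply: (le_trans (ler_normB _ _)); apply: lerD.
  exact: subsum_coef_le.
apply: (le_trans (ler_norm_sum _ _ _)).
apply: (@le_trans _ _ (\sum_(0 <= j < n.+1) subsumk (pts B w) j (fun s => 2 ^+ size s))).
  by apply: ler_sum => j _; apply: ler_norm_subsumk => s; exact: coef_le.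
apply: (le_trans (sum_subsumk_le _ _ _)); first by move=> s; rewrite exprn_ge0.
by rewrite subsum_pow.
Unshelve. all: by end_near. Qed.

End pseudo_chaotic.

(** * Chaos expansion *)

Section product_measurability.
Context {R : realType}.
Context d (Z : measurableType d) d1 (Y1 : measurableType d1) d2 (Y2 : measurableType d2)
    (m1 : {sigma_finite_measure set Y1 -> \bar R}) (m2 : {sigma_finite_measure set Y2 -> \bar R}).
(** Tonelli turns the integral over the product into two successive integrals, each measurable in
    the remaining parameters. *)
Lemma measurable_ge0_prod_integral (f : Z * (Y1 * Y2) -> \bar R) :
  (forall p, 0 <= f p)%E -> measurable_fun setT f ->
  measurable_fun setT (fun z => \int[(m1 \x m2)%E]_y f (z, y))%E.
Proof.
move=> f0 mf.
have sw : measurable_fun setT (fun p : (Z * Y1) * Y2 => (p.1.1, (p.1.2, p.2))).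
  apply: measurable_fun_pair; first by apply: measurableT_comp measurable_fst; exact: measurable_fst.
  apply: measurable_fun_pair; last exact: measurable_snd.
  by apply: measurableT_comp measurable_fst; exact: measurable_snd.
pose g := f \o (fun p : (Z * Y1) * Y2 => (p.1.1, (p.1.2, p.2))).
have m2f : measurable_fun setT (fubini_F m2 g).
  by apply: measurable_fun_fubini_tonelli_F; [exact: measurableT_comp|by move=> p; exact: f0].
have m1f : measurable_fun setT (fubini_F m1 (fubini_F m2 g)).
  by apply: measurable_fun_fubini_tonelli_F => // p; apply: integral_ge0 => y _; exact: f0.
have -> : (fun z => \int[(m1 \x m2)%E]_y f (z, y))%E =
  fubini_F m1 (fubini_F m2 g); last exact: m1f.
apply/funext => z; rewrite fubini_tonelli1//.
by apply: measurableT_comp mf _; exact: measurable_pair1.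
Qed.

Lemma measurable_param_Rintegral_prod 
    (D : set (Y1 * Y2)%type) (f : Z -> (Y1 * Y2)%type -> R) :
  measurable D ->
  measurable_fun [set: (Z * (Y1 * Y2))%type] (fun p => f p.1 p.2) ->
  measurable_fun setT (fun z => \int[(m1 \x m2)%E]_(y in D) f z y).
Proof.
move=> mD mf.
pose h (p : Z * (Y1 * Y2)) : \bar R := (f p.1 p.2 * \1_D p.2)%:E.
have mh : measurable_fun setT h.
  apply/measurable_EFinP; apply: measurable_funM => //.
  apply: (measurableT_comp (measurable_indic mD)); exact: measurable_snd.
have -> : (fun z => \int[(m1 \x m2)%E]_(y in D) f z y) = (fun z => fine
    (\int[(m1 \x m2)%E]_y (h^\+)%E (z, y) - \int[(m1 \x m2)%E]_y (h^\-)%E (z, y))%E).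
  apply/funext => z; rewrite /Rintegral integral_mkcond.
  rewrite integralE; congr fine; congr (_ - _)%E;
    apply: eq_integral => y _; rewrite ?funeposE ?funenegE /h/= patchE indicE;
    by case: ifP => _; rewrite ?mulr1 ?mulr0.
apply: (measurableT_comp (fine_measurable measurableT)).
apply: emeasurable_funB.
  by apply: measurable_ge0_prod_integral => //; exact: measurable_funepos.
by apply: measurable_ge0_prod_integral => //; exact: measurable_funeneg.
Qed.
End product_measurability.

Section bounded_integrals.
Context d (Y : measurableType d) {R : realType}.
Variables (mu : {measure set Y -> \bar R}) (D : set Y).
Hypotheses (mD : measurable D) (finD : (mu D < +oo)%E).
Implicit Types (f g : Y -> R) (b : R).

Definition bdmeas f := measurable_fun setT f /\ exists b, forall x, `|f x| <= b.

Lemma bdmeas_integrable f : bdmeas f -> mu.-integrable D (EFin \o f).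
Proof.
move=> [mf [b fb]]; apply: measurable_bounded_integrable => //.
  exact: measurable_funTS.
exists b; split; first exact: num_real.
by move=> y yb x Dx; apply: (le_trans (fb x)); exact: ltW.
Qed.

Lemma bdmeasD f g : bdmeas f -> bdmeas g ->
  \int[mu]_(x in D) (f x + g x) = \int[mu]_(x in D) f x + \int[mu]_(x in D) g x.
Proof. by move=> /bdmeas_integrable i1 /bdmeas_integrable i2; rewrite RintegralD. Qed.

Lemma bdmeasZ (a : R) f : bdmeas f ->
  \int[mu]_(x in D) (a * f x) = a * \int[mu]_(x in D) f x.
Proof. by move=> /bdmeas_integrable i1; rewrite RintegralZl. Qed.

Lemma bdmeas_cst (a : R) : \int[mu]_(x in D) a = a * fine (mu D).
Proof. by rewrite Rintegral_cst. Qed.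

Lemma bdmeas_bound f b : bdmeas f -> (forall x, `|f x| <= b) ->
  `|\int[mu]_(x in D) f x| <= b * fine (mu D).
Proof.
move=> mf fb; have i1 := bdmeas_integrable mf.
apply: (le_trans (le_normr_Rintegral mD i1)); rewrite -bdmeas_cst.
apply: le_Rintegral => //; first exact: integrable_norm i1.
apply: (bdmeas_integrable (f := cst b)); split; first exact: measurable_cst.
by exists `|b| => x.
Qed.

Lemma bdmeas_EFin f : bdmeas f ->
  (\int[mu]_(x in D) (f x)%:E = (\int[mu]_(x in D) f x)%:E)%E.
Proof.
move=> /bdmeas_integrable i1; rewrite /Rintegral fineK//.
exact: (integrable_fin_num mD i1).
Qed.

End bounded_integrals.

Section iterated_integrals.
Context {R : realType}.
Local Notation X := (R * R)%type.
Variables (T M : R).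
Hypotheses (T_gt0 : 0 < T) (M_gt0 : 0 < M).
Local Notation B := (box T M).

Let mB : measurable B := measurable_box T M.
Let bB : bnd B := bnd_box T M.
Let dxB_fin : (dx R B < +oo)%E := dx_fin mB bB.

Fixpoint itint (k : nat) (phi : seq X -> R) : R :=
  if k is k'.+1 then \int[dx R]_(x in B) itint k' (fun s => phi (x :: s))
  else phi [::].

(** A bound depending on the length only gives integrability over the powers of the box, whose
    measures are finite, and survives fixing the first points, sums and multiples. *)
Definition admissible (phi : seq X -> R) :=
  mseq (fun _ : unit => phi) /\ exists b : nat -> R, forall s, `|phi s| <= b (size s).

Lemma admissible_mseq phi d (Z : measurableType d) : admissible phi -> mseq (fun _ : Z => phi).
Proof.
by move=> [mphi _]; exact: (mseq_comp (measurable_cst (tt : unit)) mphi).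
Qed.

Lemma mfuns_cat d (Z : measurableType d) (s t : seq (Z -> X)) :
  mfuns s -> mfuns t -> mfuns (s ++ t).
Proof.
elim: s => [//|x s IH] ms mt; apply: mfuns_cons; first by apply: ms; left.
by apply: IH => // u us; apply: ms; right.
Qed.

Lemma mseq_cat d (Z : measurableType d) d' (U : measurableType d')
    (phi : Z -> seq X -> U) (s : seq (Z -> X)) :
  mseq phi -> mfuns s -> mseq (fun z t => phi z (ev s z ++ t)).
Proof.
move=> mphi ms d1 Z1 g t mg mt.
have := mphi _ _ g ([seq x \o g | x <- s] ++ t) mg
  (mfuns_cat (mfuns_comp mg ms) mt).
congr (measurable_fun _ _); apply/funext => z.
by rewrite -(ev_comp g s) -map_cat.
Qed.

Lemma admissible_cat phi s : admissible phi -> admissible (fun t => phi (s ++ t)).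
Proof.
move=> [mphi [b Hb]]; split.
  have := mseq_cat mphi (mfuns_cst (Z := unit) (s := s)).
  by congr mseq; apply/funext => z; apply/funext => t; rewrite ev_cst.
by exists (fun n => b (size s + n)%N) => t; rewrite -size_cat.
Qed.

Lemma admissible_cons phi x : admissible phi -> admissible (fun t => phi (x :: t)).
Proof. exact: (@admissible_cat phi [:: x]). Qed.

Lemma admissibleD phi psi : admissible phi -> admissible psi -> admissible (fun t => phi t + psi t).
Proof.
move=> [m1 [b1 H1]] [m2 [b2 H2]]; split.
  move=> d Z g s mg ms; apply: measurable_funD; [exact: (m1 _ _ g s mg ms)|exact: (m2 _ _ g s mg ms)].
exists (fun n => b1 n + b2 n) => s; apply: (le_trans (ler_normD _ _)).
exact: lerD.
Qed.

Lemma admissibleZ (a : R) phi : admissible phi -> admissible (fun t => a * phi t).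
Proof.
move=> [m1 [b1 H1]]; split.
  move=> d Z g s mg ms; apply: measurable_funM; [exact: measurable_cst|exact: (m1 _ _ g s mg ms)].
by exists (fun n => `|a| * b1 n) => s; rewrite normrM ler_wpM2l.
Qed.

Lemma admissible_pow (q : R) : 0 <= q -> admissible (fun s => q ^+ size s).
Proof.
move=> q0; split.
  move=> d Z g s mg ms; have -> : (fun z => q ^+ size (ev s z)) = cst (q ^+ size s).
    by apply/funext => z; rewrite size_map.
  exact: measurable_cst.
by exists (fun n => q ^+ n) => s; rewrite ger0_norm// exprn_ge0.
Qed.

Lemma admissible0 : admissible (fun=> 0).
Proof.
split; first by move=> d Z g s mg ms; exact: measurable_cst.
by exists (fun=> 0) => s; rewrite normr0.
Qed.

Lemma admissible_sum (I : Type) (r : seq I) (F : I -> seq X -> R) :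
  (forall i, admissible (F i)) -> admissible (fun s => \sum_(i <- r) F i s).
Proof.
move=> aF; elim: r => [|i r IH].
  by under eq_fun do rewrite big_nil; exact: admissible0.
by under eq_fun do rewrite big_cons; exact: admissibleD.
Qed.

Lemma measurable_itint k d (Z : measurableType d) (phi : Z -> seq X -> R) :
  mseq phi -> measurable_fun setT (fun z => itint k (phi z)).
Proof.
elim: k d Z phi => [|k IH] d Z phi mphi /=.
  exact: (mseq_ev (s := [::]) mphi).
refine (measurable_param_Rintegral_prod lebesgue_measure lebesgue_measure
  (f := fun z x => itint k (fun s => phi z (x :: s))) mB _).
apply: (IH _ _ (fun (p : Z * X) s => phi p.1 (p.2 :: s))).
exact: mseq_cons.
Qed.

Lemma dxD (f g : X -> R) : bdmeas f -> bdmeas g ->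
  \int[dx R]_(x in B) (f x + g x) = \int[dx R]_(x in B) f x + \int[dx R]_(x in B) g x.
Proof. exact: (bdmeasD (mu := dx R) mB dxB_fin). Qed.

Lemma dxZ (a : R) (f : X -> R) : bdmeas f ->
  \int[dx R]_(x in B) (a * f x) = a * \int[dx R]_(x in B) f x.
Proof. exact: (bdmeasZ (mu := dx R) mB dxB_fin). Qed.

Let dxB_fine : fine (dx R B) = T * M.
Proof. by rewrite dx_box ?ltW. Qed.

Lemma dx_cst (a : R) : \int[dx R]_(x in B) a = a * (T * M).
Proof.
apply: (etrans (bdmeas_cst (dx R) mB a)).
by congr (_ * _); exact: dxB_fine.
Qed.

Lemma dx_bound (f : X -> R) b : bdmeas f -> (forall x, `|f x| <= b) ->
  `|\int[dx R]_(x in B) f x| <= b * (T * M).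
Proof.
move=> mf fb; apply: (le_trans (bdmeas_bound (mu := dx R) mB dxB_fin mf fb)).
by rewrite le_eqVlt; apply/orP; left; apply/eqP; congr (_ * _); exact: dxB_fine.
Qed.

Lemma dx_EFin (f : X -> R) : bdmeas f ->
  (\int[dx R]_(x in B) (f x)%:E = (\int[dx R]_(x in B) f x)%:E)%E.
Proof. exact: (bdmeas_EFin (mu := dx R) mB dxB_fin). Qed.

Lemma itint_bound k (phi : seq X -> R) (b : R) : mseq (fun _ : unit => phi) ->
  (forall s, size s = k -> `|phi s| <= b) -> `|itint k phi| <= b * (T * M) ^+ k.
Proof.
elim: k phi b => [|k IH] phi b mphi Hb /=; first by rewrite mulr1; exact: Hb.
have mphi' x : mseq (fun (_ : unit) s => phi (x :: s)).
  have := mseq_cat mphi (mfuns_cst (Z := unit) (s := [:: x])); exact.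
have Hx x : `|itint k (fun s => phi (x :: s))| <= b * (T * M) ^+ k.
  by apply: IH => // s sk; apply: Hb; rewrite /= sk.
have mf : measurable_fun setT (fun x => itint k (fun s => phi (x :: s))).
  apply: (measurable_itint k (phi := fun x s => phi (x :: s))).
  have := mseq_cons mphi => /(mseq_comp (h := fun x => (tt, x))); apply.
  exact: measurable_fun_pair.
have bf : bdmeas (fun x => itint k (fun s => phi (x :: s))).
  by split=> //; exists (b * (T * M) ^+ k).
apply: (le_trans (dx_bound bf Hx)).
by rewrite exprS mulrA [X in _ <= X]mulrAC.
Qed.

Lemma bdmeas_itint k phi : admissible phi ->
  bdmeas (fun x => itint k (fun s => phi (x :: s))).
Proof.
move=> aphi; have [mphi [b Hb]] := aphi; split.
  apply: (measurable_itint k (phi := fun x s => phi (x :: s))).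
  have := mseq_cons mphi => /(mseq_comp (h := fun x => (tt, x))); apply.
  exact: measurable_fun_pair.
exists (b k.+1 * (T * M) ^+ k) => x.
apply: itint_bound; first by have [] := admissible_cons x aphi.
by move=> s sk; rewrite -sk; exact: (Hb (x :: s)).
Qed.

Lemma itint_ext k phi psi : (forall s, size s = k -> phi s = psi s) -> itint k phi = itint k psi.
Proof.
elim: k phi psi => [|k IH] phi psi H /=; first exact: H.
by apply: eq_Rintegral => x _; apply: IH => s sk; apply: H; rewrite /= sk.
Qed.

Lemma itintD k phi psi : admissible phi -> admissible psi ->
  itint k (fun s => phi s + psi s) = itint k phi + itint k psi.
Proof.
elim: k phi psi => [//|k IH] phi psi aphi apsi /=.
rewrite -dxD; try exact: bdmeas_itint.
by apply: eq_Rintegral => x _; rewrite -IH//; exact: admissible_cons.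
Qed.

Lemma itintZ k (a : R) phi : admissible phi -> itint k (fun s => a * phi s) = a * itint k phi.
Proof.
elim: k phi => [//|k IH] phi aphi /=.
rewrite -dxZ; last exact: bdmeas_itint.
by apply: eq_Rintegral => x _; rewrite -IH//; exact: admissible_cons.
Qed.

Lemma itint0 k : itint k (fun=> 0) = 0.
Proof.
by elim: k => [//|k IH] /=; rewrite IH dx_cst mul0r.
Qed.

Lemma itint_sum k (I : Type) (r : seq I) (F : I -> seq X -> R) :
  (forall i, admissible (F i)) ->
  itint k (fun s => \sum_(i <- r) F i s) = \sum_(i <- r) itint k (F i).
Proof.
move=> aF; elim: r => [|i r IH].
  rewrite big_nil -[RHS](itint0 k); apply: itint_ext => s _; by rewrite big_nil.
rewrite big_cons -IH -itintD//; last exact: admissible_sum.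
by apply: itint_ext => s _; rewrite big_cons.
Qed.

Lemma itint_cat r l (phi : seq X -> R) :
  itint r (fun t => itint l (fun u => phi (t ++ u))) = itint (r + l) phi.
Proof.
by elim: r phi => [//|r IH] phi /=; apply: eq_Rintegral => x _; rewrite -IH.
Qed.

Lemma itinte_itint k phi : admissible phi -> itinte T M k (fun s => (phi s)%:E) = (itint k phi)%:E.
Proof.
elim: k phi => [//|k IH] phi aphi /=.
rewrite -dx_EFin; last exact: bdmeas_itint.
by apply: eq_integral => x _; rewrite -IH//; exact: admissible_cons.
Qed.

End iterated_integrals.

Lemma product_measure1_null d1 (Y1 : measurableType d1) d2 (Y2 : measurableType d2)
    {R : realType} (m1 : {measure set Y1 -> \bar R})
    (m2 : {sigma_finite_measure set Y2 -> \bar R})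
    (A1 : set Y1) (A2 : set Y2) (F : set (Y1 * Y2)) :
  measurable A1 -> measurable A2 -> measurable F -> m1 A1 = 0%E ->
  F `<=` A1 `*` A2 -> (m1 \x m2)%E F = 0%E.
Proof.
move=> mA1 mA2 mF m0 FA; apply: (@subset_measure0 _ _ _ _ F (A1 `*` A2)) => //.
  exact: measurableX.
have E : (m1 \x m2)%E (A1 `*` A2) = 0%E by rewrite product_measure1E// m0 mul0e.
exact: E.
Qed.

Section null_sets.
Context {R : realType}.
Local Notation X := (R * R)%type.

Lemma dx_finite_set0 (F : set X) : finite_set F -> dx R F = 0%E.
Proof.
move=> fF.
have mfin (S : set R) : finite_set S -> measurable S.
  by move=> fS; apply: countable_measurable => //; exact: finite_set_countable.
have f1 : finite_set (fst @` F) by exact: finite_image.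
have f2 : finite_set (snd @` F) by exact: finite_image.
have := @product_measure1_null _ _ _ _ R lebesgue_measure lebesgue_measure
  (fst @` F) (snd @` F) F (mfin _ f1) (mfin _ f2).
apply.
- exact: measurable_finite.
- exact/countable_lebesgue_measure0/finite_set_countable.
- by move=> x Fx; split; exists x.
Qed.

End null_sets.

Lemma Rintegral_null_ext d (Y : measurableType d) {R : realType}
    (mu : {measure set Y -> \bar R}) (D N : set Y) (f g : Y -> R) :
  measurable D -> measurable N -> mu N = 0%E ->
  measurable_fun setT f -> measurable_fun setT g ->
  (forall x, ~ N x -> f x = g x) ->
  \int[mu]_(x in D) f x = \int[mu]_(x in D) g x.
Proof.
move=> mD mN N0 mf mg fg; rewrite /Rintegral; congr fine.
apply: ae_eq_integral => //.
- exact/measurable_EFinP/measurable_funTS.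
- exact/measurable_EFinP/measurable_funTS.
exists N; split=> // x /= H; apply: contrapT => Nx; apply: H => _.
by rewrite fg.
Qed.

(** With D the forward difference, the right side is D^(j+1) G at 0 and the left side is D^j applied
    to D G. This is the passage from j to j + 1 compensated factors. *)
Lemma pascal_alternating {R : comPzRingType} (j : nat) (G : nat -> R) :
  \sum_(0 <= i < j.+1) (-1) ^+ (j - i) * 'C(j, i)%:R * (G i.+1 - G i) =
  \sum_(0 <= i < j.+2) (-1) ^+ (j.+1 - i) * 'C(j.+1, i)%:R * G i.
Proof.
rewrite [RHS]big_nat_recl//= subn0 bin0.
under [in RHS]eq_bigr => i _ do rewrite subSS binS natrD mulrDr mulrDl.
rewrite big_split/= addrA; under [LHS]eq_bigr => i _ do rewrite mulrBr.
rewrite sumrB addrC; congr (_ + _).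
rewrite [in LHS]big_nat_recl//= subn0 bin0 [in RHS]big_nat_recr//= bin_small//.
rewrite mulr0 mul0r addr0 opprD -sumrN exprS !mulN1r !mulr1 mulNr; congr (_ + _).
rewrite [LHS]big_nat [RHS]big_nat; apply: eq_bigr => i /andP[_ ij].
by rewrite subnS -mulNr -mulNr -mulN1r -exprS prednK// subn_gt0.
Qed.

Section compensated_integrals.
Context {R : realType}.
Local Notation X := (R * R)%type.
Variables (T M : R).
Hypotheses (T_gt0 : 0 < T) (M_gt0 : 0 < M).
Local Notation B := (box T M).
Local Notation itint := (itint T M).

Let mB : measurable B := measurable_box T M.
Let bB : bnd B := bnd_box T M.

Lemma bdmeas_scale (a : R) (f : X -> R) : bdmeas f -> bdmeas (fun x => a * f x).
Proof.
move=> [mf [b fb]]; split; first by apply: measurable_funM.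
by exists (`|a| * b) => x; rewrite normrM ler_wpM2l.
Qed.

Lemma bdmeas_sum (I : Type) (r : seq I) (f : I -> X -> R) :
  (forall i, bdmeas (f i)) -> bdmeas (fun x => \sum_(i <- r) f i x).
Proof.
move=> bf; elim: r => [|i r [m [b H]]].
  under eq_fun do rewrite big_nil; split; first exact: measurable_cst.
  by exists 0 => x; rewrite normr0.
have [mi [bi Hi]] := bf i.
under eq_fun do rewrite big_cons; split; first exact: measurable_funD.
by exists (bi + b) => x; apply: (le_trans (ler_normD _ _)); exact: lerD.
Qed.

Lemma dx_sum (I : Type) (r : seq I) (f : I -> X -> R) :
  (forall i, bdmeas (f i)) ->
  \int[dx R]_(x in B) (\sum_(i <- r) f i x) =
  \sum_(i <- r) \int[dx R]_(x in B) f i x.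
Proof.
move=> bf; elim: r => [|i r IH].
  under eq_Rintegral do rewrite big_nil.
  by rewrite dx_cst// mul0r big_nil.
rewrite big_cons -IH -dxD//; last exact: bdmeas_sum.
by apply: eq_Rintegral => x _; rewrite big_cons.
Qed.

(** Finite sets are measurable and null, so the measurability of [f] follows from that of [g], and
    the integrals agree. *)
Lemma dx_null_ext (F : set X) (f g : X -> R) : finite_set F ->
  measurable_fun setT g -> (forall x, ~ F x -> f x = g x) ->
  \int[dx R]_(x in B) f x = \int[dx R]_(x in B) g x.
Proof.
move=> fF mg fg; have mF : measurable F by exact: measurable_finite.
apply: (Rintegral_null_ext (mu := dx R) mB mF (dx_finite_set0 fF) _ mg fg).
move=> _ Y mY; rewrite setTI.
have -> : f @^-1` Y = (g @^-1` Y `\` F) `|` (f @^-1` Y `&` F).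
  apply/seteqP; split=> x /=.
    by move=> fx; have [Fx|Fx] := pselect (F x); [right|left; rewrite -fg].
  by move=> [[gx Fx]|[]//]; rewrite fg.
apply: measurableU; last first.
  by apply: measurable_finite; apply: sub_finite_set fF => x [].
by apply: measurableD => //; rewrite -[X in measurable X]setTI; exact: mg.
Qed.

(* Expansion of the compensated product of j factors N(dx) - dx over the
   factors N(dx), [e] listing the available atoms. *)
Definition compsum (j : nat) (e : seq X) (phi : seq X -> R) :=
  \sum_(0 <= i < j.+1) (-1) ^+ (j - i) * 'C(j, i)%:R *
    injsum i e (fun s => itint (j - i) (fun t => phi (s ++ t))).

Lemma itint_insert l s x (phi : seq X -> R) : symseq phi ->
  itint l (fun t => phi (x :: s ++ t)) = itint l (fun t => phi (s ++ x :: t)).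
Proof.
move=> sphi; apply: itint_ext => t _; apply: sphi.
by rewrite -cat_rcons -[x :: _]/((x :: s) ++ t) perm_cat2r perm_sym perm_rcons.
Qed.

Lemma bdmeas_itint_insert l s (phi : seq X -> R) : admissible phi -> symseq phi ->
  bdmeas (fun x => itint l (fun t => phi (x :: s ++ t))).
Proof.
move=> aphi sphi; under eq_fun do rewrite itint_insert//.
exact: (bdmeas_itint T_gt0 M_gt0 l (admissible_cat s aphi)).
Qed.

(** By symmetry the new variable x may join the variables that are integrated, which raises their
    number from j - i to j + 1 - i. *)
Lemma compsum_int j e (phi : seq X -> R) : admissible phi -> symseq phi ->
  \int[dx R]_(x in B) compsum j e (fun s => phi (x :: s)) =
  \sum_(0 <= i < j.+1) (-1) ^+ (j - i) * 'C(j, i)%:R *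
    injsum i e (fun s => itint (j.+1 - i) (fun t => phi (s ++ t))).
Proof.
move=> aphi sphi.
have bTR i l : bdmeas (fun x => injsum i e (fun s => itint l (fun t => phi (x :: s ++ t)))).
  under eq_fun do rewrite injsum_arrangements.
  by apply: bdmeas_sum => s; exact: bdmeas_itint_insert.
rewrite dx_sum; last by move=> i; exact: bdmeas_scale.
rewrite [LHS]big_nat [RHS]big_nat; apply: eq_bigr => i /andP[_ ij].
rewrite dxZ//; congr (_ * _); rewrite injsum_arrangements subSn//=.
under eq_Rintegral do rewrite injsum_arrangements.
rewrite dx_sum; last by move=> s; exact: bdmeas_itint_insert.
apply: eq_bigr => s _; apply: eq_Rintegral => x _; exact: itint_insert.
Qed.

Lemma bdmeas_compsum j e (phi : seq X -> R) : admissible phi -> symseq phi ->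
  bdmeas (fun x => compsum j e (fun s => phi (x :: s))).
Proof.
move=> aphi sphi; apply: bdmeas_sum => i; apply: bdmeas_scale.
under eq_fun do rewrite injsum_arrangements.
by apply: bdmeas_sum => s; exact: bdmeas_itint_insert.
Qed.

Lemma multNtilde_compsum w j p (phi : seq X -> R) : admissible phi -> symseq phi ->
  multNtilde_avoiding B w p (fun t : j.-tuple X => phi t) =
  compsum j [seq y <- pts B w | y \notin p] phi.
Proof.
elim: j p phi => [|j IH] p phi aphi sphi.
  by rewrite /= /compsum big_nat1 subnn expr0 bin0 !mul1r.
rewrite [LHS]/=; set e := [seq y <- pts B w | y \notin p].
have inner x : multNtilde_avoiding B w (x :: p)
    (fun s : j.-tuple X => phi [tuple of x :: s]) =
    compsum j [seq y <- e | y != x] (fun s => phi (x :: s)).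
  rewrite (IH _ (fun s => phi (x :: s))).
  - rewrite -filter_predI; congr compsum; apply: eq_filter => y /=.
    by rewrite in_cons negb_or.
  - exact: admissible_cons.
  - exact: symseq_cons.
(* Outside the finite list [e] the restriction to atoms different from x is void, so the Lebesgue
   part may drop it. *)
have -> : \int[dx R]_(x in B) multNtilde_avoiding B w (x :: p)
    (fun s : j.-tuple X => phi [tuple of x :: s]) =
  \int[dx R]_(x in B) compsum j e (fun s => phi (x :: s)).
  apply: (dx_null_ext (finite_seq e)); first by have [] := bdmeas_compsum j e aphi sphi.
  move=> x /negP xe; rewrite inner (_ : [seq y <- e | y != x] = e)//.
  by apply/all_filterP/allP => y ye; apply: contraNneq xe => <-.
rewrite compsum_int//.
have -> : ((w : set _) `&` B) `\` [set` p] = [set` e].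
  apply/seteqP; split=> x /=; rewrite mem_filter.
    by move=> [wBx /negP xp]; rewrite xp; exact/(mem_pts _ _ bB).
  by move=> /andP[/negP xp /(mem_pts _ _ bB)].
rewrite -fsbig_seq ?filter_uniq ?uniq_pts//.
under eq_bigr do rewrite inner /compsum.
rewrite exchange_big/= -sumrB /compsum -pascal_alternating.
rewrite [LHS]big_nat [RHS]big_nat; apply: eq_bigr => i /andP[_ ij].
by rewrite mulrBr -mulr_sumr subSS.
Qed.

End compensated_integrals.

(** The triangle r + l < n is summed along its diagonals k = r + l. *)
Lemma triangle_sum {V : nmodType} (n : nat) (F : nat -> nat -> V) :
  \sum_(0 <= r < n) \sum_(0 <= l < n - r) F r l =
  \sum_(0 <= k < n) \sum_(0 <= r < k.+1) F r (k - r)%N.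
Proof.
elim: n => [|n IH]; first by rewrite !big_nil.
rewrite [RHS]big_nat_recr//= -IH.
transitivity (\sum_(0 <= r < n.+1) (\sum_(0 <= l < n - r) F r l + F r (n - r)%N)).
  rewrite [LHS]big_nat [RHS]big_nat; apply: eq_bigr => r /andP[_ rn].
  by rewrite subSn// big_nat_recr.
rewrite big_split/=; congr (_ + _).
by rewrite big_nat_recr//= subnn big_nil addr0.
Qed.

(** The coefficient of order k in the Cauchy product of the series of exp x and exp y. *)
Lemma sum_binomial_exp {R : realType} (k : nat) (x y : R) :
  \sum_(0 <= r < k.+1) (x ^+ r / r`!%:R) * (y ^+ (k - r) / (k - r)`!%:R) =
  (x + y) ^+ k / k`!%:R.
Proof.
rewrite addrC exprDn mulr_suml big_mkord; apply: eq_bigr => i _.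
have ik : (i <= k)%N by rewrite -ltnS.
have f0 n : n`!%:R != 0 :> R by rewrite pnatr_eq0 -lt0n fact_gt0.
rewrite -(bin_fact ik) !natrM -mulr_natr; field.
by rewrite !f0 pnatr_eq0 -lt0n bin_gt0 ik.
Qed.

Section chaos_kernels.
Context {R : realType}.
Local Notation X := (R * R)%type.
Variables (T M : R).
Hypotheses (T_gt0 : 0 < T) (M_gt0 : 0 < M).
Local Notation B := (box T M).
Local Notation itint := (itint T M).

Implicit Type psi : seq X -> R.
Variable phi : seq X -> R.
Hypotheses (mphi : mseq (fun _ : unit => phi)) (sphi : symseq phi).
Hypothesis phi_le : forall s, `|phi s| <= 2 ^+ size s.

Let aphi : admissible phi.
Proof. by split=> //; exists (fun n => 2 ^+ n). Qed.

(** Each integrated variable costs a factor 2 from the bound on [phi] and the area [T * M] of the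
    box. *)
Definition rate : R := 2 * (T * M).
Local Notation q := rate.

Lemma rate_ge0 : 0 <= q.
Proof. by rewrite /rate !mulr_ge0// ltW. Qed.
Let q0 := rate_ge0.

Definition secint (psi : seq X -> R) l s := itint l (fun t => psi (s ++ t)).

Lemma admissible_secint psi l : admissible psi -> admissible (secint psi l).
Proof.
move=> apsi; have [mpsi [b Hb]] := apsi; split.
  move=> d Z g s mg ms; apply: (measurable_itint T M l (phi := fun z t => psi (ev s z ++ t))).
  exact: (mseq_cat (admissible_mseq apsi) ms).
exists (fun n => b (n + l)%N * (T * M) ^+ l) => s; apply: itint_bound => //.
  by have [] := admissible_cat s apsi.
by move=> t tl; rewrite -tl -size_cat.
Qed.

Lemma secint_secint psi r l s : itint r (fun t => secint psi l (s ++ t)) = secint psi (r + l) s.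
Proof.
by rewrite /secint -itint_cat; apply: itint_ext => t _; apply: itint_ext => u _; rewrite catA.
Qed.

Lemma symseq_secint psi l : symseq psi -> symseq (secint psi l).
Proof.
move=> spsi s t st; apply: itint_ext => u _; apply: spsi.
by rewrite perm_cat2r.
Qed.

Lemma secint_bound psi l s (C : R) : mseq (fun _ : unit => psi) ->
  (forall s, `|psi s| <= C * 2 ^+ size s) ->
  `|secint psi l s| <= C * 2 ^+ size s * q ^+ l.
Proof.
move=> mpsi H; rewrite /rate exprMn mulrA; apply: itint_bound => //.
  by have := mseq_cat mpsi (mfuns_cst (Z := unit) (s := s));
    congr mseq; apply/funext => z; apply/funext => t; rewrite ev_cst.
by move=> t tl; apply: (le_trans (H _)); rewrite size_cat tl exprD mulrA.
Qed.

Definition chaospart n s := \sum_(0 <= l < n) secint phi l s / l`!%:R.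

Lemma chaospart_diff n p s : (n <= p)%N ->
  `|chaospart p s - chaospart n s| <= 2 ^+ size s * (expR q - exppart n q).
Proof.
move=> np; rewrite /chaospart (big_cat_nat (leq0n n) np)/= addrAC subrr add0r.
apply: (@le_trans _ _ (2 ^+ size s * (exppart p q - exppart n q))); last first.
  by rewrite ler_wpM2l ?exprn_ge0// lerB// exppart_le.
rewrite /exppart (big_cat_nat (leq0n n) np)/= addrAC subrr add0r mulr_sumr.
apply: (le_trans (ler_norm_sum _ _ _)); apply: ler_sum => l _.
rewrite normrM [X in _ * X]ger0_norm ?invr_ge0// mulrA ler_wpM2r ?invr_ge0//.
rewrite -[2 ^+ _]mul1r; apply: secint_bound => // t; by rewrite mul1r.
Qed.

(* Kernels of the chaos expansion: f(s) = sum_l 1/l! \int phi(s, t) dt^l. *)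
Definition chaosker s : R := limn (chaospart ^~ s).

Lemma chaospart_cvg s : chaospart ^~ s @ \oo --> chaosker s.
Proof.
suff : cvgn (series (fun l => secint phi l s / l`!%:R)) by [].
apply: normed_cvg; apply: (@series_le_cvg _ _ (fun l => 2 ^+ size s * exp_coeff q l)).
- by move=> l; exact: normr_ge0.
- by move=> l; rewrite /exp_coeff !mulr_ge0 ?exprn_ge0 ?invr_ge0.
- move=> l; rewrite /= normrM [X in _ * X]ger0_norm ?invr_ge0// /exp_coeff mulrA.
  rewrite ler_wpM2r ?invr_ge0// -[2 ^+ _]mul1r.
  by apply: secint_bound => // t; rewrite mul1r.
- exact: (is_cvg_seriesZ (k := 2 ^+ size s) (@is_cvg_series_exp_coeff R q)).
Qed.

Lemma chaosker_diff n s : `|chaosker s - chaospart n s| <= 2 ^+ size s * (expR q - exppart n q).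
Proof.
have H : (fun p => `|chaospart p s - chaospart n s|) @ \oo --> `|chaosker s - chaospart n s|.
  by apply: cvg_norm; apply: cvgB; [exact: chaospart_cvg|exact: cvg_cst].
rewrite -(cvg_lim _ H)//; apply: limr_le; first by apply/cvg_ex; eexists; exact: H.
by near=> p; apply: chaospart_diff; near: p; exact: nbhs_infty_ge.
Unshelve. all: by end_near. Qed.

Lemma chaosker_le s : `|chaosker s| <= expR q * 2 ^+ size s.
Proof.
have := chaosker_diff 0 s; rewrite /chaospart /exppart !big_nil !subr0.
by rewrite mulrC.
Qed.

Lemma admissible_chaosker : admissible chaosker.
Proof.
split; last by exists (fun n => expR q * 2 ^+ n) => s; exact: chaosker_le.
move=> d Z g s mg ms.
apply: (@measurable_fun_cvg _ _ _ _ (fun n z => chaospart n (ev s z))); last first.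
  by move=> z _; exact: chaospart_cvg.
move=> n; rewrite /chaospart.
have [H _] := admissible_sum (index_iota 0 n) (fun l => admissibleZ (l`!%:R^-1) (admissible_secint l aphi)).
have := H _ Z (fun=> tt) s (measurable_cst _) ms; congr (measurable_fun _ _); apply/funext => z.
by apply: eq_bigr => l _; rewrite mulrC.
Qed.

Lemma symseq_chaosker : symseq chaosker.
Proof.
move=> s t st; rewrite /chaosker; congr (limn _); apply/funext => n.
by apply: eq_bigr => l _; rewrite (symseq_secint l sphi st).
Qed.

(** The limit is not exchanged with the iterated integral: [chaosker] differs from its partial sum
    by a tail bound uniform in the points, and integrating r variables multiplies this bound by at
    most q^r. *)
Lemma secint_chaosker_diff r n s :
  `|secint chaosker r s - \sum_(0 <= l < n) secint phi (r + l) s / l`!%:R| <=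
  2 ^+ size s * q ^+ r * (expR q - exppart n q).
Proof.
have akp : admissible (chaospart n).
  rewrite /chaospart; have := admissible_sum (index_iota 0 n) (fun l => admissibleZ (l`!%:R^-1) (admissible_secint l aphi)).
  by congr admissible; apply/funext => t; apply: eq_bigr => l _; rewrite mulrC.
have -> : \sum_(0 <= l < n) secint phi (r + l) s / l`!%:R = secint (chaospart n) r s.
  transitivity (itint r (fun t => \sum_(0 <= l < n) (l`!%:R^-1 * secint phi l (s ++ t)))); last first.
    by apply: itint_ext => t _; apply: eq_bigr => l _; rewrite mulrC.
  rewrite (itint_sum T_gt0 M_gt0 r (index_iota 0 n) (F := fun l t => l`!%:R^-1 * secint phi l (s ++ t))); last first.
    by move=> l; apply: admissibleZ; apply: admissible_cat; exact: admissible_secint.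
  apply: eq_bigr => l _; rewrite (itintZ T_gt0 M_gt0 r); last first.
    by apply: admissible_cat; exact: admissible_secint.
  by rewrite secint_secint mulrC.
have -> : secint chaosker r s - secint (chaospart n) r s =
    secint (fun t => chaosker t + -1 * chaospart n t) r s.
  rewrite /secint (itintD T_gt0 M_gt0 r (psi := fun t => -1 * chaospart n (s ++ t))).
  - rewrite itintZ ?mulN1r//; exact: admissible_cat.
  - by apply: admissible_cat; exact: admissible_chaosker.
  - by apply: admissibleZ; exact: admissible_cat.
rewrite mulrAC [X in _ <= X * _]mulrC; apply: secint_bound.
  have [] // := admissibleD admissible_chaosker (admissibleZ (-1) akp).
by move=> t; rewrite mulN1r mulrC; exact: chaosker_diff.
Qed.

(* The coefficient of subsets of [size s] points in a partial sum of the chaos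
   expansion; it tends to phi(s), with error 2 ^+ size s * resumerr n. *)
Definition resum n s := \sum_(0 <= r < n) (-1) ^+ r / r`!%:R * secint chaosker r s.

(** At n = 0 the sum [resum] is empty and the error is [phi] itself, bounded by 2 to the size of s,
    hence the value 1. *)
Definition resumerr n : R := if n is 0 then 1 else
  \sum_(0 <= r < n) q ^+ r / r`!%:R * (expR q - exppart (n - r) q).

Lemma resumerr_ge0 n : 0 <= resumerr n.
Proof.
case: n => [|n]; first exact: ler01.
apply: sumr_ge0 => r _; rewrite mulr_ge0//.
  by rewrite mulr_ge0 ?exprn_ge0 ?invr_ge0.
by rewrite subr_ge0 exppart_le.
Qed.

(** The Cauchy product of the truncated series collapses to a truncation of exp(q + q). Both terms
    tend to exp(2q), so the error vanishes in the limit. *)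
Lemma resumerrE n : resumerr n.+1 = exppart n.+1 q * expR q - exppart n.+1 (q + q).
Proof.
rewrite /resumerr; under eq_bigr do rewrite mulrBr; rewrite sumrB -mulr_suml; congr (_ - _).
under eq_bigr do rewrite /exppart mulr_sumr.
rewrite triangle_sum /exppart; apply: eq_bigr => k _; exact: sum_binomial_exp.
Qed.

Lemma resumerr_cvg : resumerr @ \oo --> (0 : R).
Proof.
rewrite -cvg_shiftS.
have -> : (fun n => resumerr n.+1) = (fun n => exppart n.+1 q * expR q - exppart n.+1 (q + q)).
  by apply/funext => n; exact: resumerrE.
suff : (fun n => exppart n.+1 q * expR q - exppart n.+1 (q + q)) @ \oo -->
    expR q * expR q - expR (q + q) by rewrite expRD subrr.
apply: cvgB; last first.
  by have := @exppart_cvg R (q + q); rewrite -cvg_shiftS.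
apply: cvgM; last exact: cvg_cst.
by have := @exppart_cvg R q; rewrite -cvg_shiftS.
Qed.

Lemma resumerr_le n : resumerr n <= 1 + expR (q + q).
Proof.
case: n => [|n]; first by rewrite /= lerDl expR_ge0.
rewrite resumerrE; apply: (@le_trans _ _ (exppart n.+1 q * expR q)).
  by rewrite gerBl exppart_ge0// addr_ge0.
rewrite expRD; apply: (@le_trans _ _ (expR q * expR q)); last by rewrite lerDr.
by rewrite ler_wpM2r ?expR_ge0// exppart_le.
Qed.

Lemma resum_diff n s : `|phi s - resum n s| <= 2 ^+ size s * resumerr n.
Proof.
case: n => [|n]; first by rewrite /resum big_nil subr0 mulr1.
(* On the triangle r + l <= n the coefficient of [secint phi k] is (1 - 1)^k / k!, so only the term
   k = 0, which is [phi s], survives. Subtracting [resum] then leaves only tails of the inner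
   series. *)
have -> : phi s = \sum_(0 <= r < n.+1) (-1) ^+ r / r`!%:R *
    \sum_(0 <= l < n.+1 - r) secint phi (r + l) s / l`!%:R.
  under eq_bigr do rewrite mulr_sumr.
  rewrite triangle_sum big_nat_recl//= [X in _ + X]big1 ?addr0 => [|k _].
    rewrite big_nat1 expr0 fact0 !divr1 mul1r/= /secint/=.
    by rewrite cats0.
  have E : \sum_(0 <= r < k.+2) ((-1) ^+ r / r`!%:R) * (1 ^+ (k.+1 - r) / (k.+1 - r)`!%:R) = 0 :> R.
    by rewrite sum_binomial_exp addNr expr0n mul0r.
  transitivity ((\sum_(0 <= r < k.+2) ((-1) ^+ r / r`!%:R) * (1 ^+ (k.+1 - r) / (k.+1 - r)`!%:R))
    * secint phi k.+1 s); last by rewrite E mul0r.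
  rewrite mulr_suml big_nat [RHS]big_nat; apply: eq_bigr => r /andP[_ rk].
  by rewrite subnKC -1?ltnS// expr1n mul1r; ring.
rewrite /resum -sumrB /resumerr mulr_sumr.
apply: (le_trans (ler_norm_sum _ _ _)); apply: ler_sum => r _.
rewrite -mulrBr normrM normrM normrX normrN1 expr1n mul1r distrC.
rewrite (ger0_norm (x := r`!%:R^-1)) ?invr_ge0// mulrC mulrA.
rewrite [X in _ <= X * _]mulrA -[X in _ <= X]mulrAC ler_wpM2r ?invr_ge0//.
exact: secint_chaosker_diff.
Qed.

End chaos_kernels.

Section chaos_partial_sums.
Context {R : realType}.
Local Notation X := (R * R)%type.

Lemma subsumk_sum (I : Type) (r : seq I) e k (F : I -> seq X -> R) :
  subsumk e k (fun s => \sum_(i <- r) F i s) = \sum_(i <- r) subsumk e k (F i).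
Proof.
elim: e k F => [|x e IH] [|k] F //=; first by rewrite big1.
by rewrite !IH -big_split.
Qed.

Lemma subsumk_sub e k (phi psi : seq X -> R) :
  subsumk e k (fun s => phi s - psi s) = subsumk e k phi - subsumk e k psi.
Proof.
elim: e k phi psi => [|x e IH] [|k] phi psi //=; first by rewrite subr0.
by rewrite !IH opprD addrACA.
Qed.

Lemma subsumk_pow2_le (e : seq X) k : subsumk e k (fun s => 2 ^+ size s) <= 3 ^+ size e :> R.
Proof.
elim: e k => [|x e IH] [|k] //=.
  by rewrite expr0 exprn_ege1// ler1n.
under [X in _ + X]subsumk_ext do rewrite exprS.
rewrite subsumk_scale; have := IH k.+1; have := IH k; rewrite exprS; lra.
Qed.

Variables (T M : R).
Hypotheses (T_gt0 : 0 < T) (M_gt0 : 0 < M).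
Local Notation B := (box T M).

Variable phi : seq X -> R.
Hypotheses (mphi : mseq (fun _ : unit => phi)) (sphi : symseq phi).
Hypothesis phi_le : forall s, `|phi s| <= 2 ^+ size s.
Local Notation ff := (chaosker T M phi).
Local Notation dk := (resum T M phi).
Local Notation gm := (resumerr T M).

(** Each subset of size i carries i! orderings, and i! times the binomial coefficient of j and i,
    divided by j!, is 1 / (j - i)!. *)
Lemma compsum_subsumk j e : uniq e ->
  j`!%:R^-1 * compsum T M j e ff = \sum_(0 <= i < j.+1)
    (-1) ^+ (j - i) / (j - i)`!%:R * subsumk e i (secint T M ff (j - i)).
Proof.
move=> ue; rewrite /compsum mulr_sumr [LHS]big_nat [RHS]big_nat.
apply: eq_bigr => i /andP[_ ij].
rewrite (injsum_subsumk i (phi := secint T M ff (j - i)))//; last first.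
  by apply: symseq_secint; exact: symseq_chaosker.
have f0 n : n`!%:R != 0 :> R by rewrite pnatr_eq0 -lt0n fact_gt0.
rewrite -(bin_fact (n := j) (m := i)) ?natrM// -mulr_natl; field.
by rewrite !f0 pnatr_eq0 -lt0n bin_gt0 -ltnS ij.
Qed.

(** Exchanging the sums over j and i collects, for a subset of i points, the terms r = j - i < n -
    i, that is [resum] of order n - i. *)
Lemma chaos_partial n e : uniq e ->
  \sum_(0 <= j < n) j`!%:R^-1 * compsum T M j e ff =
  \sum_(0 <= i < (size e).+1) subsumk e i (dk (n - i)).
Proof.
move=> ue; under eq_bigr do rewrite compsum_subsumk//.
rewrite -(triangle_sum n (fun i r => (-1) ^+ r / r`!%:R * subsumk e i (secint T M ff r))).
transitivity (\sum_(0 <= i < n) subsumk e i (dk (n - i))).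
  apply: eq_bigr => i _; rewrite /resum subsumk_sum; apply: eq_bigr => r _.
  by rewrite subsumk_scale.
(* The ranges up to n and up to [size e] differ by zero terms: [resum] of order 0 is an empty sum,
   and no subset has more than [size e] points. *)
have [nk|nk] := leqP n (size e).+1.
  rewrite [RHS](big_cat_nat (leq0n n) nk)/= [X in _ + X]big_nat [X in _ + X]big1 ?addr0// => i /andP[ni _].
  have -> : (n - i = 0)%N by apply/eqP; rewrite subn_eq0.
  by rewrite /resum subsumk_sum big_nil.
rewrite (big_cat_nat (leq0n (size e).+1) (ltnW nk))/= [X in _ + X]big_nat.
by rewrite [X in _ + X]big1 ?addr0// => i /andP[ni _]; exact: subsumk_gt.
Qed.

Lemma chaos_diff n e : uniq e ->
  `|subsum e phi - \sum_(0 <= j < n) j`!%:R^-1 * compsum T M j e ff| <=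
  3 ^+ size e * \sum_(0 <= i < (size e).+1) gm (n - i).
Proof.
move=> ue; rewrite chaos_partial// -(sum_subsumk phi (ltnSn (size e))) -sumrB.
apply: (le_trans (ler_norm_sum _ _ _)); rewrite mulr_sumr; apply: ler_sum => i _.
rewrite -subsumk_sub; apply: (@le_trans _ _ (subsumk e i (fun s => gm (n - i) * 2 ^+ size s))).
  by apply: ler_norm_subsumk => s; rewrite mulrC; exact: resum_diff.
rewrite subsumk_scale mulrC ler_wpM2r ?resumerr_ge0//.
exact: subsumk_pow2_le.
Qed.

End chaos_partial_sums.

Section chaos_convergence.
Context {R : realType} (P : probability (config R) R).
Hypothesis poissonP : poisson_random_measure P.
Local Notation X := (R * R)%type.
Variables (T M : R).
Hypotheses (T_gt0 : 0 < T) (M_gt0 : 0 < M).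
Local Notation B := (box T M).

Let mB : measurable B := measurable_box T M.
Let bB : bnd B := bnd_box T M.

Variable phi : seq X -> R.
Hypotheses (mphi : mseq (fun _ : unit => phi)) (sphi : symseq phi).
Hypothesis phi_le : forall s, `|phi s| <= 2 ^+ size s.
Local Notation ff := (chaosker T M phi).
Variable F : config R -> R.
Hypothesis FE : {ae P, forall w, F w = subsum (pts B w) phi}.

Lemma chaos_partialE n w : ff [::] +
    \sum_(1 <= j < n.+1) j`!%:R^-1 * multNtilde B (fun t : j.-tuple X => ff t) w =
  \sum_(0 <= j < n.+1) j`!%:R^-1 * compsum T M j (pts B w) ff.
Proof.
rewrite [RHS]big_nat_recl// big_add1 fact0 invr1 mul1r; congr (_ + _).
  by rewrite /compsum big_nat1 subnn expr0 bin0 !mul1r.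
apply: eq_bigr => j _; congr (_ * _); rewrite /multNtilde.
rewrite (multNtilde_compsum T_gt0 M_gt0 w j.+1 [::] (phi := ff)).
- by rewrite filter_predT.
- exact: admissible_chaosker.
- exact: symseq_chaosker.
Qed.

Lemma chaos_cvg : L2_cvg P (fun n w => ff [::] +
  \sum_(1 <= j < n.+1) j`!%:R^-1 * multNtilde B (fun t : j.-tuple X => ff t) w) F.
Proof.
pose K : R := 1 + expR (rate T M + rate T M).
pose g (n k : nat) : R := 3 ^+ k * \sum_(0 <= i < k.+1) resumerr T M (n.+1 - i).
have K0 : 0 <= K by rewrite addr_ge0 ?expR_ge0.
have g0 n := resumerr_ge0 T_gt0 M_gt0 n.
(* In the constant 6 = 2 * 3, the factor 3^k is already in [g], and 2^k bounds the number k + 1 of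
   terms of its sum, each at most K. *)
apply: (@L2_dominated R P poissonP B mB bB _ g K 6) => //.
- move=> n k; rewrite mulr_ge0 ?exprn_ge0//= ?sumr_ge0//=.
  rewrite mulrC -[6%:R](_ : 2 * 3 = _ :> R); last by rewrite -natrM.
  rewrite exprMn /g mulrAC [leLHS]mulrC ler_wpM2r ?exprn_ge0//.
  apply: (@le_trans _ _ (\sum_(0 <= i < k.+1) K)).
    by apply: ler_sum => i _; exact: resumerr_le.
  rewrite sumr_const_nat subn0 -[leLHS]mulr_natl ler_wpM2r// -natrX ler_nat.
  exact: ltn_expl.
- move=> k; have H : forall j, (fun n => \sum_(0 <= i < j) resumerr T M (n.+1 - i)) @ \oo --> (0 : R).
    elim=> [|j IH].
      by under eq_fun do rewrite big_nil; exact: cvg_cst.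
    have H : (fun n => resumerr T M (n.+1 - j)) @ \oo --> (0 : R).
      have : (fun m => resumerr T M (m - j)) @ \oo --> (0 : R).
        by rewrite (cvg_centern j (resumerr T M)); exact: resumerr_cvg.
      by rewrite -cvg_shiftS.
    under eq_fun do rewrite big_nat_recr//=.
    suff : (fun n => \sum_(0 <= i < j) resumerr T M (n.+1 - i) + resumerr T M (n.+1 - j)) @ \oo --> (0 + 0 : R).
      by rewrite addr0.
    exact: cvgD.
  by rewrite -(mulr0 (3 ^+ k : R)); apply: cvgM; [exact: cvg_cst|exact: H].
move=> n; have [N [mN N0 sN]] := FE; exists N; split=> //.
apply: subset_trans sN => w /= h1 h2; apply: h1.
by rewrite h2 chaos_partialE; apply: chaos_diff => //; exact: uniq_pts.
Qed.

End chaos_convergence.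

Section chaos_expectation.
Context {R : realType} (P : probability (config R) R).
Hypothesis poissonP : poisson_random_measure P.
Local Notation X := (R * R)%type.
Variables (T M : R).
Hypotheses (T_gt0 : 0 < T) (M_gt0 : 0 < M).
Local Notation B := (box T M).
Local Notation itint := (itint T M).

Let mB : measurable B := measurable_box T M.
Let bB : bnd B := bnd_box T M.

Definition has_mean (f : config R -> R) (v : R) :=
  P.-integrable setT (EFin \o f) /\ (\int[P]_w (f w)%:E = v%:E)%E.

Lemma has_meanD f g a b : has_mean f a -> has_mean g b ->
  has_mean (fun w => f w + g w) (a + b).
Proof.
move=> [i1 e1] [i2 e2]; split; first exact: (integrableD measurableT i1 i2).
by under eq_integral do rewrite EFinD; rewrite integralD_EFin// e1 e2.
Qed.

Lemma has_meanZ k f a : has_mean f a -> has_mean (fun w => k * f w) (k * a).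
Proof.
move=> [i1 e1]; split; first exact: (integrableZl measurableT k i1).
by under eq_integral do rewrite EFinM; rewrite integralZl// e1.
Qed.

Lemma has_mean0 : has_mean (fun=> 0) 0.
Proof. by split; [exact: integrable0|exact: integral0]. Qed.

Lemma has_mean_sum (I : Type) (r : seq I) (f : I -> config R -> R) (a : I -> R) :
  (forall i, has_mean (f i) (a i)) ->
  has_mean (fun w => \sum_(i <- r) f i w) (\sum_(i <- r) a i).
Proof.
move=> H; elim: r => [|i r IH].
  by under eq_fun do rewrite big_nil; rewrite big_nil; exact: has_mean0.
by under eq_fun do rewrite big_cons; rewrite big_cons; exact: has_meanD.
Qed.

Lemma has_mean_injsum_ge0 k (psi : seq X -> R) : admissible psi -> (forall s, 0 <= psi s) ->
  has_mean (fun w => injsum k (pts B w) psi) (itint k psi).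
Proof.
move=> apsi psi0.
have mpsi : mseq (fun (w : @cfg R) (s : seq X) => (psi s)%:E).
  move=> d Z g s mg ms; apply/measurable_EFinP.
  have [m _] := apsi; exact: (m _ _ (fun=> tt) s (measurable_cst _) ms).
have E w : (injsum k (pts B w) psi)%:E = injsum k (pts B w) (fun s => (psi s)%:E).
  by rewrite !injsum_arrangements sumEFin.
have e1 : (\int[P]_w (injsum k (pts B w) psi)%:E = (itint k psi)%:E)%E.
  under eq_integral do rewrite E.
  apply: (etrans (multi_mecke poissonP T M k (phi := fun s _ => (psi s)%:E) mpsi _)).
    by move=> s w; rewrite lee_fin.
  rewrite -itinte_itint//; congr itinte; apply/funext => s.
  rewrite integral_cst//; apply: (etrans (congr1 (mule _) (probability_setT P))).
  by rewrite mule1.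
split=> //; apply/integrableP; split.
  have m1 : measurable_fun setT (fun w : @cfg R => injsum k (pts B w) (fun s => (psi s)%:E)).
    by apply: (measurable_injsum_pts k (phi := fun _ s => (psi s)%:E)).
  have -> : EFin \o (fun w => injsum k (pts B w) psi) =
    (fun w => injsum k (pts B w) (fun s => (psi s)%:E)) by apply/funext => w; exact: E.
  exact: (measurable_vague poissonP m1).
under eq_integral do rewrite /= ger0_norm ?injsum_arrangements ?sumr_ge0// -injsum_arrangements.
by rewrite e1 ltry.
Qed.

Variable phi : seq X -> R.
Hypotheses (mphi : mseq (fun _ : unit => phi)) (sphi : symseq phi).
Hypothesis phi_le : forall s, `|phi s| <= 2 ^+ size s.

Let aphi : admissible phi.
Proof. by split=> //; exists (fun n => 2 ^+ n). Qed.

(** Mecke's formula concerns nonnegative integrands; [phi] is the difference of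
    [phi s + 2 ^+ size s] and [2 ^+ size s], both nonnegative by the bound on [phi]. *)
Lemma has_mean_injsum k : has_mean (fun w => injsum k (pts B w) phi) (itint k phi).
Proof.
have a2 : admissible (fun s : seq X => 2 ^+ size s : R) by exact: admissible_pow.
have := has_meanD (@has_mean_injsum_ge0 k (fun s => phi s + 2 ^+ size s) (admissibleD aphi a2) _)
  (has_meanZ (-1) (@has_mean_injsum_ge0 k (fun s => 2 ^+ size s) a2 _)).
rewrite itintD// mulN1r addrK.
have -> : (fun w => injsum k (pts B w) (fun s => phi s + 2 ^+ size s) +
    -1 * injsum k (pts B w) (fun s => 2 ^+ size s)) = (fun w => injsum k (pts B w) phi).
  by apply/funext => w; rewrite !injsum_arrangements big_split/= mulN1r addrK.
apply=> s; last exact: exprn_ge0.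
by have := phi_le s; rewrite ler_norml => /andP[h _]; rewrite -lerBlDr sub0r.
Qed.

Lemma has_mean_subsumk k : has_mean (fun w => subsumk (pts B w) k phi) (itint k phi / k`!%:R).
Proof.
rewrite mulrC; have := has_meanZ (k`!%:R^-1) (has_mean_injsum k).
congr (has_mean _ _); apply/funext => w.
rewrite injsum_subsumk//; last exact: uniq_pts.
by rewrite -[X in _ * X]mulr_natl mulKf// pnatr_eq0 -lt0n fact_gt0.
Qed.

Variable F : config R -> R.
Hypothesis mF : measurable_fun setT F.
Hypothesis FE : {ae P, forall w, F w = subsum (pts B w) phi}.

(** The mean of the sum over subsets of fewer than n points is the n-th partial sum of the series
    defining [chaosker] at the empty list; domination by 3 to the power of the count lets n tend to
    infinity. *)
Lemma expectation_chaos : ('E_P[F] = (chaosker T M phi [::])%:E)%E.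
Proof.
pose S n w := \sum_(0 <= j < n) subsumk (pts B w) j phi.
have mS n : has_mean (S n) (chaospart T M phi n [::]).
  by apply: has_mean_sum => l; exact: has_mean_subsumk.
have S_le n w : `|S n w| <= 3 ^+ cnt B w.
  apply: (le_trans (ler_norm_sum _ _ _)).
  apply: (@le_trans _ _ (\sum_(0 <= j < n) subsumk (pts B w) j (fun s => 2 ^+ size s))).
    by apply: ler_sum => j _; exact: ler_norm_subsumk.
  apply: (le_trans (sum_subsumk_le _ _ _)); first by move=> s; rewrite exprn_ge0.
  by rewrite subsum_pow.
have ig : P.-integrable setT (EFin \o (fun w => 3 ^+ cnt B w)).
  apply/integrableP; split.
    by apply/measurable_EFinP; exact: (measurable_cnt_real poissonP mB bB (fun k => 3 ^+ k)).
  under eq_integral do rewrite /= ger0_norm ?exprn_ge0//.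
  exact: exp_moment.
have SF : {ae P, forall w, [set: config R] w -> (S n w)%:E @[n --> \oo] --> (F w)%:E}.
  have [N [mN N0 sN]] := FE; exists N; split=> //.
  apply: subset_trans sN => w /= h1 h2; apply: h1 => _.
  apply: cvg_near_cst; near=> n; rewrite h2 /S sum_subsumk//.
  by near: n; exact: nbhs_infty_gt.
have Sg : {ae P, forall w n, [set: config R] w ->
    (`|(S n w)%:E| <= (EFin \o (fun w => 3 ^+ cnt B w)%R) w)%E}.
  by apply: aeW => w n _; rewrite lee_fin.
have [_ _ H] := @dominated_convergence _ (config R) R P setT measurableT
  (fun n w => (S n w)%:E) (EFin \o F) (EFin \o (fun w => 3 ^+ cnt B w))
  (fun n => measurable_int P (mS n).1) ((measurable_EFinP _ _).2 mF) SF ig Sg.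
have E : (fun n => (chaospart T M phi n [::])%:E) = (fun n => \int[P]_w (S n w)%:E)%E.
  by apply/funext => n; rewrite (mS n).2.
have {}H : (fun n => (chaospart T M phi n [::])%:E) @ \oo --> (\int[P]_w (F w)%:E)%E.
  by rewrite E; exact: H.
rewrite unlock; apply: (cvg_unique _ H) => //.
by apply: cvg_EFin; [exact: nearW|exact: chaospart_cvg].
Unshelve. all: by end_near. Qed.

End chaos_expectation.

Section square_integrable_kernels.
Context {R : realType}.
Local Notation X := (R * R)%type.
Variables (T M : R).
Hypotheses (T_gt0 : 0 < T) (M_gt0 : 0 < M).
Local Notation B := (box T M).

Lemma in_power_cons (A : set X) k x (s : k.-tuple X) :
  A x -> in_power A s -> in_power A [tuple of x :: s].
Proof.
by move=> Ax As i; case: (unliftP ord0 i) => [j|] ->; rewrite ?tnthS ?tnth0.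
Qed.

Lemma lebesgue_power_ext (A : set X) k (f g : k.-tuple X -> \bar R) :
  (forall s, in_power A s -> f s = g s) -> lebesgue_power A f = lebesgue_power A g.
Proof.
elim: k f g => [|k IH] f g fg /=; first by apply: fg => -[].
apply: eq_integral => x; rewrite inE => Ax; apply: IH => s As.
by apply: fg; exact: in_power_cons.
Qed.

(** [c] and [coef] are only known to agree on the box, and all conditions in [L2s] concern the
    box. *)
Lemma L2s_ext k (f g : k.-tuple X -> R) :
  (forall s, in_power B s -> f s = g s) -> L2s B g -> L2s B f.
Proof.
move=> fg [sg mg ig]; split.
- move=> s t Bs st; rewrite !fg//; first exact: sg.
  move=> i; have : tnth t i \in s by rewrite (perm_mem st) mem_tnth.
  by move=> /tnthP[j ->].
- apply: eq_measurable_fun mg => s; rewrite inE => Bs; exact/esym/fg.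
- by rewrite (@lebesgue_power_ext _ _ _ (fun s => (g s ^+ 2)%:E))// => s /fg ->.
Qed.

Lemma L2s_seq k (phi : seq X -> R) : admissible phi -> symseq phi ->
  L2s B (fun s : k.-tuple X => phi s).
Proof.
move=> aphi sphi; have [mphi [b Hb]] := aphi; split.
- by move=> s t _; exact: sphi.
- apply: measurable_funTS.
  have := mseq_tuple (k := k) mphi.
  move=> /measurableT_comp /(_ (measurable_pair1 tt)).
  exact.
- rewrite (itinte_power T M k (fun s => (phi s ^+ 2)%:E)) itinte_itint ?ltry//.
  split; last first.
    exists (fun n => b n ^+ 2) => s; rewrite normrX lerXn2r ?nnegrE//.
    exact: le_trans (Hb s).
  move=> d Z g s mg ms; apply: measurable_funX.
  exact: (mphi _ _ g s mg ms).
Qed.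

End square_integrable_kernels.

(* HT_of_NTM is needed: an F^N-predictable lambda may depend on the points of N
   outside [0,T] x [0,M], for instance
     lambda_t = M 1{t > T/2} 1{N([0,T/2] x ]M,M+1]) > 0},
   while every element of L^{2,T,M} is a.s. a functional of N^{T,M}.  The
   conclusion implies HT_of_NTM. *)
Theorem theorem3p15 (R : realType) (P : probability (config R) R)
  (poissonP : poisson_random_measure P)
  (T M : R) (T_gt0 : 0 < T) (M_gt0 : 0 < M)
  (lambda : R -> config R -> R)
  (lambda_ge0 : forall (t : R) w, 0 <= t -> 0 <= lambda t w)
  (lambda_pred : predictable lambda)
  (lambda_leM : {ae P, forall w, forall t : R, 0 <= t -> lambda t w <= M})
  (HT_of_NTM : exists Y : config R -> R, measurable_wrt (FNTM T M) Y /\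
     {ae P, forall w, counting_process lambda T w = Y w}) :
  pseudo_chaotic_expansion P T M (counting_process lambda T) (c P T M lambda).
Proof.
have [Y [Y_NTM HY]] := HT_of_NTM.
have good0 : P (~` good T M lambda Y) = 0%E by exact: good_full.
have mphi : mseq (fun _ : unit => coef P T M lambda) by exact: mseq_coef.
have sphi := @symseq_coef R P T M lambda.
have phi_le s : `|coef P T M lambda s| <= 2 ^+ size s by exact: coef_le.
have FE := ae_identity poissonP T_gt0 M_gt0 lambda_pred Y_NTM good0.
split; first split.
- exact: (L2_HT poissonP T_gt0 M_gt0 lambda_pred Y_NTM good0).
- exists (fun j s => chaosker T M (coef P T M lambda) s); split.
    by move=> j _; apply: L2s_seq => //; [exact: admissible_chaosker|exact: symseq_chaosker].
  (* The kernel of order 0 is the mean, so the centering constant of the chaos expansion is the term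
     j = 0 of the series. *)
  have -> : fine 'E_P[counting_process lambda T]%E = chaosker T M (coef P T M lambda) [::].
    rewrite (expectation_chaos poissonP T_gt0 M_gt0 mphi sphi phi_le _ FE)//.
    exact: (measurable_vague poissonP (measurable_counting_process T lambda_pred)).
  exact: (chaos_cvg poissonP T_gt0 M_gt0 mphi sphi phi_le FE).
- move=> j j0; apply: (@L2s_ext _ _ _ _ _ (fun s : j.-tuple _ => coef P T M lambda s)).
    by move=> s Bs; exact: cE.
  by apply: L2s_seq => //; split=> //; exists (fun n => 2 ^+ n).
exact: (pseudo_cvg poissonP T_gt0 M_gt0 lambda_pred Y_NTM good0).
Qed.
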